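(* For every integer $k\ge 2$, every $\beta>0$ and every $\nu$ with $0<\nu<1$ there is a constant $c>0$ such that for all $n\ge 3$, all $\varepsilon$ with $0<\varepsilon\le c/\log^2 n$ and all $p$ with $0<p<1$ the following holds. Let $G$ be a graph on $n$ vertices with minimum degree $\delta(G)\ge\beta pn$. Suppose that $G$ is $(\varepsilon,p,1,2)$-pseudorandom if $k=2$, and that $G$ is both $(\varepsilon,p,k-1,2k-1)$-pseudorandom and $(\varepsilon,p,k,k+1)$-pseudorandom if $k>2$. Then $G$ contains at least $(1-\nu)^n p^{kn}\,n!$ copies of the $k$th power of a Hamilton cycle.
   Context: Graphs are finite and simple. For $\varepsilon>0$, $0<p<1$ and positive integers $a\le b$, an $n$-vertex graph $G$ is $(\varepsilon,p,a,b)$-pseudorandom if $\big|e(X,Y)-p|X||Y|\big|<\varepsilon p|X||Y|$ for all disjoint $X,Y\subseteq V(G)$ with $|X|\ge\varepsilon p^{a}n$ and $|Y|\ge\varepsilon p^{b}n$, where $e(X,Y)$ is the number of edges with one endvertex in $X$ and the other in $Y$. The $k$th power of a graph $H$ is the graph on $V(H)$ in which two distinct vertices are adjacent if and only if their distance in $H$ is at most $k$. Copies are counted as labelled copies: the number of copies of the $k$th power of a Hamilton cycle in $G$ is the number of orderings $(v_0,\dots,v_{n-1})$ of $V(G)$ (indices modulo $n$) such that $v_iv_{i+j}\in E(G)$ whenever $1\le j\le k$ and $v_i\neq v_{i+j}$. *)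

(* Defs.v *)
From HB Require Import structures.
From mathcomp Require Import all_boot all_order all_algebra.
From mathcomp Require Import reals exp.

Set Implicit Arguments.
Unset Strict Implicit.
Unset Printing Implicit Defensive.

Import Order.TTheory GRing.Theory Num.Theory.
Local Open Scope ring_scope.

Record sgraph (T : finType) := SGraph {
  adj :> rel T;
  adj_sym : symmetric adj;
  adj_irrefl : irreflexive adj
}.

Definition degree (T : finType) (G : sgraph T) (x : T) : nat :=
  #|[set y | adj G x y]|.

(* The neutral element #|T| exceeds every degree, so this is the true minimum
   as soon as T is nonempty. *)
Definition min_degree (T : finType) (G : sgraph T) : nat :=
  \big[minn/#|T|]_(x : T) degree G x.

(* Edges are unordered pairs {x, y}. *)
Definition edges_between (T : finType) (G : sgraph T) (X Y : {set T}) : nat :=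
  #|[set [set x; y] | x in X, y in Y & adj G x y]|.

Definition pseudorandom (R : realType) (T : finType) (G : sgraph T)
    (eps p : R) (a b : nat) : Prop :=
  forall X Y : {set T}, [disjoint X & Y] ->
    eps * p ^+ a * #|T|%:R <= #|X|%:R ->
    eps * p ^+ b * #|T|%:R <= #|Y|%:R ->
    `|(edges_between G X Y)%:R - p * #|X|%:R * #|Y|%:R|
      < eps * p * #|X|%:R * #|Y|%:R.

(* An ordering of V(G) is an injective v : 'I_#|T| -> T. The cyclic successor
   ordS maps i to i + 1 modulo #|T|, so iter j (ordS _) i is the index i + j.
   When #|T| <= k, i + j may be i itself, whence the test v i != v (i + j). *)
Definition ham_power_copies (T : finType) (G : sgraph T) (k : nat)
    : {set {ffun 'I_#|T| -> T}} :=
  [set v : {ffun 'I_#|T| -> T} | injectiveb v &&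
    [forall i : 'I_#|T|, forall j : 'I_k.+1,
      let i' := iter j (@ordS #|T|) i in
      (1 <= j)%N && (v i != v i') ==> adj G (v i) (v i')]].

(* Main.v *)
(* The proof follows the absorbing method.

   Connecting. If the ends of two k-th powers of paths have many common neighbours in suitable sets,
   they can be joined through a bounded number of vertices of these sets: moving a window of k
   positions along, almost all choices of vertices for the window are reached from one end, and the
   same holds for the same window read backwards from the other end.

   Absorbing. A reservoir W of about n / log n vertices is set aside, with a path A of the same order
   of magnitude that can absorb any subset of W without changing its ends. A vertex r is absorbed by
   2k of its neighbours forming the k-th power of a path, with r put in the middle; when k = 2 such
   a path in the neighbourhood need not exist and a longer gadget replaces it.

   Counting. In the remaining set U the vertices of a long path are chosen one by one. A choice that
   is typical for the sets in use keeps a proportion (1 - g) p of each of them, so that a path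
   covering all but about n / log n vertices of U can be chosen in about
   ((1 - g)^(k+1) p^k)^N |U|! ways. Every such path extends to a copy: the leftover vertices are
   inserted through W, the cycle is closed through W, and the rest of W is absorbed. Ignoring the
   order of the c n / log n vertices outside the long path loses at most a factor
   n^(c n / log n) = e^(c n), where c is small. *)
Require Import Defs.
From HB Require Import structures.
From mathcomp Require Import all_boot all_order all_algebra.
From mathcomp Require Import boolp reals sequences exp.
From mathcomp Require Import zify ring lra.

Set Implicit Arguments.
Unset Strict Implicit.
Unset Printing Implicit Defensive.

Import Order.TTheory GRing.Theory Num.Theory.

(** The parameter [c] of the lemmas is no constant in the end: the reserved sets have about
    [n / log n] vertices, so [c] is of order [1 / log n], and each lemma has to record how small
    [eps] must be in terms of [c]. The arguments need [eps] below a multiple of [c], except for the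
    double counting in [fork], which needs [eps] below a multiple of [c ^+ 2]. This is the origin of
    the squared logarithm.

    The second concern is the exponent of [p]. The candidates for the next vertex of a path number
    about [p^k n], or [p^(k+1) n] inside a neighbourhood, and the sets to be avoided must be smaller
    by a factor of order [eps]. Exponents beyond the reach of the given density force the detours of
    the proof: windows whose positions are given up one at a time, and separate constructions for
    squares.

    Finally, bounded numbers of vertices are compared with [eps p^k n]. This quantity is at least
    [1 / 4] unless the graph is complete, and a complete graph has all [n!] copies. *)

Section PowerPath.
Variables (T : eqType) (e : rel T).
Implicit Types (s a b : seq T).

(* [s] is a [d]-th power of a path. *)
Fixpoint pw (d : nat) s : bool :=
  if s is x :: s' then all (e x) (take d s') && pw d s' else true.

Lemma pwP x0 d s :
  reflect (forall i j, i < j -> j < size s -> j <= i + d ->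
            e (nth x0 s i) (nth x0 s j)) (pw d s).
Proof.
apply: (iffP idP).
- elim: s => [|x s IH] //= /andP[/all_nthP Ha Hs] [|i] [|j] //= ij js jd.
  + have := Ha x0 j; rewrite nth_take; last by lia.
    by apply; rewrite size_take; case: ifP; lia.
  + by apply: IH => //; lia.
- elim: s => [|x s IH] //= H; apply/andP; split.
  + apply/(all_nthP x0) => i; rewrite size_take_min => Hi.
    rewrite nth_take; last by lia.
    by apply: (H 0 i.+1) => //; lia.
  + by apply: IH => i j ij js jd; apply: (H i.+1 j.+1) => //; lia.
Qed.

Lemma pw_cat_l d a b : pw d (a ++ b) -> pw d a.
Proof.
elim: a => [|x a IH] //= /andP[Ha /IH ->]; rewrite andbT.
by move: Ha; rewrite take_cat; case: ltnP => // Hd; rewrite all_cat (take_oversize Hd) => /andP[].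
Qed.

Lemma pw_cat_r d a b : pw d (a ++ b) -> pw d b.
Proof. by elim: a => [|x a IH] //= /andP[_ /IH]. Qed.

Lemma pw_take d n s : pw d s -> pw d (take n s).
Proof. by rewrite -{1}(cat_take_drop n s) => /pw_cat_l. Qed.

Lemma pw_drop d n s : pw d s -> pw d (drop n s).
Proof. by rewrite -{1}(cat_take_drop n s) => /pw_cat_r. Qed.

(** Vertices on different sides of [s] are more than [d] apart, so no adjacency between [a] and [b]
    is asked for. *)
Lemma pw_glue d a s b : d <= size s -> pw d (a ++ s) -> pw d (s ++ b) ->
  pw d (a ++ s ++ b).
Proof.
move=> ds; elim: a => [|x a IH] //= /andP[Ha Has] Hsb.
rewrite IH // andbT catA takel_cat //.
by rewrite size_cat; lia.
Qed.

Lemma pw_rev (esym : symmetric e) d s : pw d s -> pw d (rev s).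
Proof.
case: s => [|x0 s'] //; set s := x0 :: s' => /(pwP x0) H.
apply/(pwP x0) => i j ij; rewrite size_rev => js jd.
rewrite !nth_rev //; last by lia.
by rewrite esym; apply: H; lia.
Qed.

Lemma pw_weak d d' s : d' <= d -> pw d s -> pw d' s.
Proof.
case: s => [|x0 s'] // dd /(pwP x0) H.
by apply/(pwP x0) => i j ij js jd; apply: H => //; lia.
Qed.

(** At most [d.+1] vertices are pairwise within distance [d], so they form a clique. *)
Lemma pw_clique d d' s : size s <= d.+1 -> pw d s -> pw d' s.
Proof.
case: s => [|x0 s'] // dd /(pwP x0) H.
by apply/(pwP x0) => i j ij js jd; apply: H => //; lia.
Qed.

Lemma pw_rcons d s z : pw d s -> all (e^~ z) (drop (size s - d) s) ->
  pw d (rcons s z).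
Proof.
move=> /(pwP z) H /(all_nthP z) Hz; apply/(pwP z) => i j ij.
rewrite size_rcons => js jd; rewrite !nth_rcons.
have -> : i < size s by lia.
case: ltnP => jj; first exact: H.
have -> : j == size s by lia.
have := Hz (i - (size s - d)); rewrite size_drop nth_drop.
by rewrite subnKC; [apply|]; lia.
Qed.

(* Vertices on both sides of the inserted vertex get one step further apart. *)
Lemma pw_insert (esym : symmetric e) d v a b : pw d (a ++ b) ->
  all (e v) (a ++ b) -> pw d.+1 a -> pw d.+1 b -> pw d.+1 (a ++ v :: b).
Proof.
move=> H; rewrite all_cat => /andP[Ha Hb] pa pb.
apply/(pwP v) => i j ij; rewrite size_cat /= => js jd; rewrite !nth_cat.
case: (ltnP i (size a)) => ia; case: (ltnP j (size a)) => ja.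
- by move/(pwP v): pa; apply.
- case E: (j - size a) => [|m] /=.
    by rewrite esym; apply: (allP Ha); apply: mem_nth.
  have := (pwP v _ _ H) i j.-1; rewrite !nth_cat ia.
  have -> : (j.-1 < size a) = false by lia.
  have -> : j.-1 - size a = m by lia.
  by apply; rewrite ?size_cat; lia.
- lia.
- have [j' Ej] : exists j', j - size a = j'.+1 by exists (j - size a).-1; lia.
  rewrite Ej; case E: (i - size a) => [|m] /=.
    by apply: (allP Hb); apply: mem_nth; lia.
  by move/(pwP v): pb; apply; lia.
Qed.

End PowerPath.

(** * Cyclic orderings and copies *)

Section Copies.
Variables (T : finType) (G : sgraph T) (k : nat).

Lemma iter_ordS m (i : 'I_m) j : val (iter j (@ordS m) i) = ((i + j) %% m)%N.
Proof.
elim: j => [|j IH]; first by rewrite addn0 modn_small.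
by rewrite iterS /= IH -addn1 modnDml addn1 addnS.
Qed.

(** Repeating the first [k] vertices at the end unrolls the cyclic condition; since [k <= #|T|], an
    index [i + j] wraps around at most once. *)
Lemma copy_of_cycle t0 (cyc : seq T) : (k <= #|T|)%N -> uniq cyc -> size cyc = #|T| ->
  pw G k (cyc ++ take k cyc) -> [ffun i : 'I_#|T| => nth t0 cyc i] \in ham_power_copies G k.
Proof.
move=> kT ucyc scyc /(pwP _ t0) H; rewrite inE; apply/andP; split.
  apply/injectiveP => i j; rewrite !ffunE => /eqP; rewrite nth_uniq ?scyc ?ltn_ord //.
  by move=> /eqP/val_inj.
apply/forallP => i; apply/forallP => j; apply/implyP => /andP[j0 _]; rewrite !ffunE iter_ordS.
have := H i (i + j)%N; rewrite nth_cat scyc ltn_ord nth_cat scyc size_cat scyc size_takel ?scyc //.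
have iT := ltn_ord i; have jk : (j <= k)%N by rewrite -ltnS.
move: (val i) (val j) iT jk j0 kT => {}i {}j iT jk j0 kT.
have -> : ((i + j) %% #|T| = if i + j < #|T| then i + j else i + j - #|T|)%N.
  case: ltnP => h; first by rewrite modn_small.
  by rewrite -{1}(subnK h) modnDr modn_small //; lia.
case: (ltnP (i + j) #|T|) => h Hij; first by apply: Hij; lia.
by move: Hij; rewrite nth_take; [apply|]; lia.
Qed.

(** Truncation to the first [N] values sends the copies onto a set containing all these tuples, so
    one completion of each long path is enough for the count. *)
Lemma copies_ge N (P : pred (N.-tuple T)) : (k <= #|T|)%N -> (N <= #|T|)%N ->
  (forall t, P t -> exists cyc, [/\ uniq cyc, size cyc = #|T|, pw G k (cyc ++ take k cyc) &
    take N cyc = t]) ->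
  (#|[set t | P t]| <= #|ham_power_copies G k|)%N.
Proof.
move=> kT NT H.
pose f (v : {ffun 'I_#|T| -> T}) := [tuple v (widen_ord NT i) | i < N].
apply: leq_trans (leq_imset_card f _); apply: subset_leq_card; apply/subsetP => t.
rewrite inE => /H[cyc [ucyc scyc pcyc tcyc]].
have [t0 _|T0] := pickP (@predT T).
  apply/imsetP; exists [ffun i : 'I_#|T| => nth t0 cyc i]; first exact: copy_of_cycle.
  apply: val_inj; rewrite /= -tcyc; apply: (@eq_from_nth _ t0).
    by rewrite size_takel ?scyc // size_map size_enum_ord.
  rewrite size_takel ?scyc // => i iN; rewrite nth_take //.
  by rewrite (nth_map (Ordinal iN)) ?size_enum_ord // ffunE /= nth_enum_ord.
(* No default vertex exists here; the empty ordering is the only one and it is a copy. *)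
have T00 : #|T| = 0%N by apply: eq_card0.
have noI (i : 'I_#|T|) : False by case: i => i; rewrite T00.
have N0 : N = 0%N by apply/eqP; rewrite -leqn0 -T00.
apply/imsetP.
exists [ffun i => tnth t (cast_ord (etrans T00 (esym N0)) i)].
  rewrite inE; apply/andP; split; first by apply/injectiveP => i; case: (noI i).
  by apply/forallP => i; case: (noI i).
by apply: eq_from_tnth => i; case: (noI (widen_ord NT i)).
Qed.

Lemma complete_copies : (forall x y, x != y -> G x y) ->
  (#|T|`! <= #|ham_power_copies G k|)%N.
Proof.
move=> H; have := card_inj_ffuns 'I_#|T| T; rewrite card_ord ffactnn => <-.
apply: subset_leq_card; apply/subsetP => v; rewrite !inE => vi; rewrite vi /=.
apply/forallP => i; apply/forallP => j; apply/implyP => /andP[_]; exact: H.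
Qed.

Lemma subset_of_card (X : {set T}) m : (m <= #|X|)%N -> exists2 Y : {set T}, Y \subset X & #|Y| = m.
Proof.
move=> mX; exists [set x in take m (enum X)].
  by apply/subsetP => x; rewrite inE => /mem_take; rewrite mem_enum.
rewrite cardsE (card_uniqP _) ?take_uniq ?enum_uniq // size_takel //.
by rewrite -cardE.
Qed.

Lemma blocks (sz : nat -> nat) r : (\sum_(i < r) sz i <= #|T|)%N ->
  exists B : nat -> {set T}, (forall i, (i < r)%N -> #|B i| = sz i) /\
    forall i j, (i < r)%N -> (j < r)%N -> i != j -> [disjoint B i & B j].
Proof.
elim: r => [|r IH] H; first by exists (fun=> set0); split.
rewrite big_ord_recr /= in H.
have [|B [cB dB]] := IH; first by apply: leq_trans H; rewrite leq_addr.
pose V := \bigcup_(i < r) B i.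
have cV : (#|V| <= \sum_(i < r) sz i)%N.
  rewrite /V; elim/big_rec2: _ => [|i y1 y2 _ IH2]; first by rewrite cards0.
  by apply: leq_trans (leq_card_setU _ _) _; rewrite cB // leq_add2l.
have [|Y YV cY] := @subset_of_card (~: V) (sz r).
  by rewrite -(leq_add2l #|V|) cardsC; apply: leq_trans H; rewrite leq_add2r.
have YB i : (i < r)%N -> [disjoint Y & B i].
  move=> ir; rewrite disjoints_subset; apply: (subset_trans YV); rewrite setCS.
  exact: (bigcup_sup (Ordinal ir)).
have last_or x : (x < r.+1)%N -> x = r \/ (x < r)%N by rewrite ltnS leq_eqVlt => /predU1P.
exists (fun i => if (i < r)%N then B i else Y); split=> [i|i j].
  by case/last_or => [->|ir]; rewrite ?ltnn // ir cB.
case/last_or => [->|ir] /last_or[->|jr] ij; rewrite ?ltnn ?ir ?jr.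
- by rewrite eqxx in ij.
- exact: YB.
- by rewrite disjoint_sym YB.
- exact: dB.
Qed.

End Copies.

Local Open Scope ring_scope.

(** * Density *)

Section Density.
Variables (R : realFieldType) (T : finType) (G : sgraph T) (eps p : R).
Implicit Types (X Y D E : {set T}) (s : seq T).

Definition nb (x : T) : {set T} := [set y | G x y].
Definition cN s : {set T} := [set y | all (fun x => G x y) s].

Lemma cN_cons x s : cN (x :: s) = nb x :&: cN s.
Proof. by apply/setP => y; rewrite !inE. Qed.

Lemma cN_nil : cN [::] = setT.
Proof. by apply/setP => y; rewrite !inE. Qed.

Lemma cN_rev s : cN (rev s) = cN s.
Proof. by apply/setP => y; rewrite !inE all_rev. Qed.

(* Apart from [complete_or_large], pseudorandomness is only used to bound edge counts from below. *)
Definition dense (ka eta : R) := forall X Y, [disjoint X & Y] ->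
  ka <= #|X|%:R -> eta <= #|Y|%:R ->
  (1 - eps) * p * #|X|%:R * #|Y|%:R <= \sum_(y in Y) #|nb y :&: X|%:R.

Lemma dense_mono ka eta ka' eta' : ka <= ka' -> eta <= eta' ->
  dense ka eta -> dense ka' eta'.
Proof. by move=> k1 k2 H X Y d X1 Y1; apply: H => //; apply: le_trans; eauto. Qed.

Lemma card_inD (A : {set T}) (P : pred T) :
  #|[set x in A | P x]|%:R = \sum_(x in A) (P x)%:R :> R.
Proof.
rewrite -sum1_card natr_sum; under eq_bigl do rewrite inE.
by rewrite big_mkcondr; apply: eq_bigr => x _; case: (P x).
Qed.

Lemma exchange_card X Y (r : rel T) :
  \sum_(y in Y) #|[set x in X | r x y]|%:R
  = \sum_(x in X) #|[set y in Y | r x y]|%:R :> R.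
Proof.
under eq_bigr do rewrite card_inD.
by rewrite exchange_big; apply: eq_bigr => x _; rewrite card_inD.
Qed.

Lemma nbI y X : nb y :&: X = [set x in X | G x y].
Proof. by apply/setP => x; rewrite !inE andbC (adj_sym G y). Qed.

Lemma dense_sym ka eta : dense ka eta -> dense eta ka.
Proof.
move=> H X Y d X1 Y1; have := H Y X; rewrite disjoint_sym => /(_ d Y1 X1).
under [X in _ <= X -> _]eq_bigr do rewrite nbI.
under [X in _ -> _ <= X]eq_bigr do rewrite nbI.
rewrite exchange_card mulrAC; congr (_ <= _); apply: eq_bigr => x _.
by congr (_%:R); apply: eq_card => z; rewrite !inE (adj_sym G z).
Qed.

Hypotheses (p0 : 0 < p) (eps0 : 0 < eps).

(* If a (ka, eta)-dense pair had too many vertices z seeing few good d, these z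
   would send too many bad edges to D. *)
Lemma transfer ka eta D E (th : R) (Q : rel T) :
  eps <= 1 / 4 -> 0 <= eta -> dense ka eta -> [disjoint D & E] ->
  ka <= #|D|%:R ->
  (forall d, d \in D -> #|[set z in E | G d z && ~~ Q d z]|%:R <= th) ->
  #|[set z in E | #|[set d in D | G d z && Q d z]|%:R < p / 2 * #|D|%:R]|%:R
    <= Num.max (4 * th / p) eta.
Proof.
move=> eps4 eta0 dn dDE kD Hth; set E' := [set z in E | _].
rewrite leNgt; apply/negP; rewrite gt_max => /andP[thE etaE].
have dD : [disjoint D & E'].
  by apply: (disjointWr _ dDE); apply/subsetP => z; rewrite inE => /andP[].
have := dn _ _ dD kD (ltW etaE).
under [X in _ <= X -> _]eq_bigr do rewrite nbI.
have split z : #|[set x in D | G x z]|%:R = #|[set x in D | G x z && Q x z]|%:R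
    + #|[set x in D | G x z && ~~ Q x z]|%:R :> R.
  rewrite -natrD; congr (_%:R).
  rewrite -(cardsID [set x | Q x z] [set x in D | G x z]); congr (_ + _)%N;
  by apply: eq_card => x; rewrite !inE -?andbA //; case: (Q x z); rewrite ?andbT ?andbF.
under [X in _ <= X -> _]eq_bigr do rewrite split.
rewrite big_split /= => H1.
have H2 : \sum_(z in E') #|[set x in D | G x z && Q x z]|%:R
    <= p / 2 * #|D|%:R * #|E'|%:R.
  rewrite [leRHS]mulr_natr -sumr_const; apply: ler_sum => z.
  by rewrite inE => /andP[_ /ltW].
have H3 : \sum_(z in E') #|[set x in D | G x z && ~~ Q x z]|%:R <= #|D|%:R * th.
  rewrite (exchange_card D E' (fun x z => G x z && ~~ Q x z)).
  rewrite mulr_natl -sumr_const; apply: ler_sum => d dD'.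
  apply: le_trans (Hth _ dD'); rewrite ler_nat; apply: subset_leq_card.
  by apply/subsetP => z; rewrite !inE -!andbA => /and4P[-> _ -> ->].
have D0 : 0 < #|D|%:R :> R.
  rewrite ltr0n lt0n; apply/negP => /eqP/cards0_eq D0.
  have : E' = set0.
    apply/setP => z; rewrite !inE D0 cards0 mulr0; apply/negP => /andP[_].
    by rewrite ltNge ler0n.
  by move=> E0; move: etaE; rewrite E0 cards0; move: eta0; lra.
have H4 : (3 / 4) * p * #|D|%:R * #|E'|%:R <= (1 - eps) * p * #|D|%:R * #|E'|%:R.
  by rewrite !ler_wpM2r ?ler0n ?(ltW p0) //; lra.
have H5 : #|D|%:R * (p * #|E'|%:R) <= #|D|%:R * (4 * th) by move: H1 H2 H3 H4; lra.
rewrite ler_pM2l // in H5.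
move: thE; rewrite ltr_pdivrMr // mulrC; lra.
Qed.

(** The exceptional set may meet [X], whereas density speaks of disjoint sets. A part [Z] of it with
    between [eta] and [eta + 1] elements is removed from [X], at the cost of a fraction [g / 2] of
    [X]; the other half of [g] pays for [eps]. *)
Lemma bad_lt ka eta X (g : R) : dense ka eta -> 0 < eta -> g <= 1 ->
  eps <= g / 2 -> eta + 1 <= g / 2 * #|X|%:R -> ka <= #|X|%:R / 2 ->
  #|[set v | #|nb v :&: X|%:R < (1 - g) * p * #|X|%:R]|%:R < eta.
Proof.
move=> dn eta0 g1 epsg etaX kX; set B := [set v | _].
rewrite ltNge; apply/negP => HB.
have exm : exists m : nat, eta <= m%:R by exists #|B|.
case: (ex_minnP exm) => m etam minm.
have mB : (m <= #|B|)%N by apply: minm.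
have m0 : 0 < m%:R :> R by apply: lt_le_trans etam.
have mlt : m%:R <= eta + 1.
  case: m m0 minm {etam mB} => [|m] m0 minm; first by rewrite ltxx in m0.
  rewrite -natr1 lerD2r leNgt; apply/negP => /ltW /minm; lia.
have [Z ZB Zm] : exists2 Z : {set T}, Z \subset B & #|Z| = m.
  exists [set x in take m (enum B)].
    by apply/subsetP => x; rewrite inE => /mem_take; rewrite mem_enum.
  rewrite cardsE; have /card_uniqP -> : uniq (take m (enum B)).
    by rewrite take_uniq ?enum_uniq.
  by rewrite size_takel // -cardE.
have dXZ : [disjoint X :\: Z & Z].
  by rewrite disjoint_sym disjoints_subset; apply/subsetP => x; rewrite !inE => ->.
have cX : (1 - g / 2) * #|X|%:R <= #|X :\: Z|%:R.
  have : #|X|%:R <= #|X :\: Z|%:R + #|Z|%:R :> R.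
    rewrite -natrD ler_nat -(cardsID Z X) addnC leq_add2l.
    by rewrite subset_leq_card // subsetIr.
  by rewrite Zm; lra.
have X0 : 0 <= #|X|%:R :> R by [].
have Xp : 0 < #|X|%:R :> R.
  by rewrite lt0r X0 andbT; apply/eqP => XE; move: etaX; rewrite XE mulr0; lra.
have kXZ : ka <= #|X :\: Z|%:R.
  have : 0 <= (1 - g) * #|X|%:R by rewrite mulr_ge0 // subr_ge0.
  by move: cX kX; lra.
have := dn _ _ dXZ kXZ; rewrite Zm => /(_ etam).
apply/negP; rewrite -ltNge.
apply: (@le_lt_trans _ _ (\sum_(y in Z) #|nb y :&: X|%:R)).
  apply: ler_sum => y _; rewrite ler_nat subset_leq_card //.
  by apply: setIS; apply: subsetDl.
apply: (@lt_le_trans _ _ (\sum_(y in Z) (1 - g) * p * #|X|%:R)).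
  have [z zZ] : exists z, z \in Z by apply/card_gt0P; rewrite Zm -(ltr0n R).
  rewrite (big_setD1 z zZ) [ltRHS](big_setD1 z zZ) /=; apply: ltr_leD.
    by have := subsetP ZB _ zZ; rewrite inE.
  apply: ler_sum => y; rewrite inE => /andP[_ /(subsetP ZB)].
  by rewrite inE => /ltW.
rewrite sumr_const Zm -[leLHS]mulr_natr ler_wpM2r ?(ltW m0) //.
have -> : (1 - g) * p * #|X|%:R = p * ((1 - g) * #|X|%:R) by ring.
have -> : (1 - eps) * p * #|X :\: Z|%:R = p * ((1 - eps) * #|X :\: Z|%:R) by ring.
rewrite ler_pM2l //.
have : (1 - eps) * ((1 - g / 2) * #|X|%:R) <= (1 - eps) * #|X :\: Z|%:R.
  by rewrite ler_wpM2l //; lra.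
apply: le_trans; rewrite mulrA ler_wpM2r //.
have g0 : 0 <= g by move: epsg (eps0); lra.
have : 0 <= eps * g by apply: mulr_ge0 => //; exact: ltW.
by move: epsg (eps0); lra.
Qed.

End Density.

(** * Reaching and connecting *)

Section AlmostAll.
Variables (R : realFieldType) (T : finType) (G : sgraph T) (eps p : R).
Variable k : nat.
Local Notation entry := (nat * {set T} * R)%type.

Definition near (a b : nat) := ((a <= b + k) && (b <= a + k))%N.

Definition compat (h : seq (nat * T)) (q : nat) (z : T) :=
  all (fun a => near a.1 q ==> G a.2 z) h.

(* For the entries [(q, E, th)] of [L] in turn, all but [th] of the vertices of [E] that are adjacent
   to the earlier vertices at positions within [k] of [q] can be put at position [q]; whatever is
   chosen in this way, [P] holds of the final history of (position, vertex) pairs. *)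
Fixpoint almost_all (h : seq (nat * T)) (L : seq entry)
    (P : seq (nat * T) -> Prop) : Prop :=
  if L is (q, E, th) :: L' then
    exists2 B : {set T}, #|B|%:R <= th &
      forall z, z \in E -> z \notin B -> compat h q z -> almost_all ((q, z) :: h) L' P
  else P h.

Definition coh (h : seq (nat * T)) :=
  forall a b, a \in h -> b \in h -> a != b -> near a.1 b.1 -> G a.2 b.2.

Lemma near_sym a b : near a b = near b a.
Proof. by rewrite /near andbC. Qed.

Lemma compatP h q z :
  reflect (forall a, a \in h -> near a.1 q -> G a.2 z) (compat h q z).
Proof.
apply: (iffP allP) => H a /H; first by move/implyP.
by move=> Ha; apply/implyP.
Qed.

Lemma coh_nil : coh [::]. Proof. by []. Qed.

Lemma coh_cons h q z : coh h -> compat h q z -> coh ((q, z) :: h).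
Proof.
move=> ch /compatP cz a b; rewrite !inE => /orP[/eqP->|ah] /orP[/eqP->|bh] /=.
- by rewrite eqxx.
- by move=> _ nab; rewrite (adj_sym G); apply: cz; rewrite // near_sym.
- by move=> _ nab; apply: cz.
- exact: ch.
Qed.

Lemma almost_all_impl h L P Q : (forall h', P h' -> Q h') -> almost_all h L P -> almost_all h L Q.
Proof.
move=> PQ; elim: L h => [|[[q E] th] L IH] h /=; first exact: PQ.
by case=> B HB H; exists B => // z zE zB cz; apply: IH; apply: H.
Qed.

Lemma almost_all_coh h L P : coh h -> almost_all h L P -> almost_all h L (fun h' => coh h' /\ P h').
Proof.
elim: L h => [|[[q E] th] L IH] h //= ch.
case=> B HB H; exists B => // z zE zB cz; apply: IH; last exact: H.
exact: coh_cons.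
Qed.

Lemma almost_all_eqi h h' L P : (forall a b, a =i b -> P a -> P b) -> h =i h' ->
  almost_all h L P -> almost_all h' L P.
Proof.
move=> PP; elim: L h h' => [|[[q E] th] L IH] h h' hh /=; first exact: PP.
case=> B HB H; exists B => // z zE zB cz.
apply: (IH ((q, z) :: h)); first by move=> x; rewrite !inE hh.
by apply: H => //; rewrite /compat (eq_all_r hh).
Qed.

Lemma almost_all_cat h L L' P : almost_all h L (fun h' => almost_all h' L' P) -> almost_all h (L ++ L') P.
Proof.
elim: L h => [|[[q E] th] L IH] h //= [B HB H].
by exists B => // z zE zB cz; apply: IH; apply: H.
Qed.

Lemma almost_all_all h (L : seq entry) P : coh h -> (forall q E th, (q, E, th) \in L -> 0 <= th) ->
  (forall h', {subset h <= h'} -> coh h' ->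
     (forall q E th, (q, E, th) \in L -> exists2 z, z \in E & (q, z) \in h') ->
     P h') -> almost_all h L P.
Proof.
elim: L h => [|[[q E] th] L IH] h /= ch H0 H; first by apply: H.
exists set0; first by rewrite cards0; apply: (H0 q E); rewrite mem_head.
move=> z zE _ cz; apply: IH; first exact: coh_cons.
  by move=> q' E' th' I; apply: (H0 q' E'); rewrite inE I orbT.
move=> h' sh ch' H'; apply: H => //.
  by move=> x xh; apply: sh; rewrite inE xh orbT.
move=> q' E' th'; rewrite inE => /orP[/eqP[-> -> _]|]; last exact: H'.
by exists z => //; apply: sh; rewrite mem_head.
Qed.

Lemma almost_all_le h L L' P :
  all2 (fun a b : entry => (a.1 == b.1) && (a.2 <= b.2)) L L' ->
  almost_all h L P -> almost_all h L' P.
Proof.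
elim: L L' h => [|[[q E] th] L IH] [|[[q' E'] th'] L'] h //=.
case/andP=> /andP[/eqP[<- <-] tt] HL [B HB H].
exists B; first exact: le_trans tt.
by move=> z zE zB cz; apply: IH => //; apply: H.
Qed.

Hypotheses (p0 : 0 < p) (eps0 : 0 < eps) (eps4 : eps <= 1 / 4)
  (p1 : p <= 1).

Definition nearc q (L : seq entry) := count (fun a => near q a.1.1) L.

(** The price for giving up position [q]: a factor [4 / p] from [transfer] at positions that must be
    adjacent to it, and a factor [2] from averaging at the others. *)
Definition relax (ka eta : R) q (L : seq entry) :=
  [seq (a.1, if near q a.1.1 then Num.max (4 * a.2 / p) eta else 2 * a.2) | a <- L].

(* By transfer, each later vertex z keeps a p/2 (or 1/2) fraction of the d in D
   for which the rest of the string succeeds. *)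
Lemma almost_all_remove_aux ka eta q0 (P : seq (nat * T) -> Prop) (L : seq entry) :
  dense G eps p ka eta -> 0 < ka -> 0 <= eta ->
  (forall a b, a =i b -> P a -> P b) ->
  forall h (D : {set T}),
  (forall q E th, (q, E, th) \in L -> [disjoint D & E]) ->
  (forall d, d \in D -> almost_all ((q0, d) :: h) L P) ->
  ka * 2 ^+ size L * p <= #|D|%:R * p ^+ nearc q0 L ->
  almost_all h (relax ka eta q0 L) (fun h' => exists d, P ((q0, d) :: h')).
Proof.
move=> dn ka0 eta0 PP; elim: L => [|[[q E] th] L IH] h D dDE HD sz /=.
  have : 0 < #|D|%:R :> R.
    rewrite lt0r ler0n andbT; apply/eqP => D0; move: sz; rewrite D0 mul0r expr0 mulr1.
    by rewrite leNgt mulr_gt0.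
  by rewrite ltr0n => /card_gt0P[d /HD Hd]; exists d.
pose ok z d := `[< almost_all ((q, z) :: (q0, d) :: h) L P >].
pose Eh := [set z in E | compat h q z].
have dDEh : [disjoint D & Eh].
  apply: disjointWr (dDE q E th _); last by rewrite mem_head.
  by apply/subsetP => z; rewrite inE => /andP[].
have dDE' q' E' th' : (q', E', th') \in L -> [disjoint D & E'].
  by move=> I; apply: (dDE q' E' th'); rewrite inE I orbT.
have bad d : d \in D ->
    #|[set z in Eh | (near q0 q ==> G d z) && ~~ ok z d]|%:R <= th.
  move=> dD; case: (HD _ dD) => B HB H; apply: le_trans HB.
  rewrite ler_nat; apply: subset_leq_card; apply/subsetP => z.
  rewrite !inE => /and3P[/andP[zE cz] nz]; apply: contraR => zB.
  by apply/asboolP; apply: H => //; rewrite /compat /= nz.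
have main (D' : {set T}) z : D' \subset D -> (forall d, d \in D' -> ok z d) ->
    ka * 2 ^+ size L * p <= #|D'|%:R * p ^+ nearc q0 L ->
    almost_all ((q, z) :: h) (relax ka eta q0 L) (fun h' => exists d, P ((q0, d) :: h')).
  move=> sD okD szD'; apply: (IH _ D') => //.
    by move=> q' E' th' I; apply: disjointWl (dDE' _ _ _ I).
  move=> d /okD/asboolP; apply: almost_all_eqi => // x.
  by rewrite !inE orbCA.
have D0 : 0 <= #|D|%:R :> R by [].
case: ifP => nq.
  have sz' : ka * 2 ^+ size L * 2 * p <= #|D|%:R * p ^+ nearc q0 L * p.
    by move: sz; rewrite /= nq /= add1n !exprS; lra.
  rewrite ler_pM2r // in sz'.
  have kD : ka <= #|D|%:R.
    apply: (@le_trans _ _ (ka * 2 ^+ size L * 2)).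
      by rewrite -mulrA -exprSr ler_peMr ?(ltW ka0) // exprn_ege1 // ler1n.
    by apply: (le_trans sz'); rewrite ler_piMr // exprn_ile1 // ltW.
  exists [set z in Eh | #|[set d in D | G d z && ok z d]|%:R < p / 2 * #|D|%:R].
    apply: (transfer p0 eps4 eta0 dn dDEh kD (Q := fun d z => ok z d)) => d dD.
    by move: (bad d dD); rewrite nq.
  move=> z zE; rewrite !inE zE => + cz; rewrite cz /= -leNgt => Dz.
  apply: (main [set d in D | G d z && ok z d]).
  - by apply/subsetP => d; rewrite inE => /andP[].
  - by move=> d; rewrite !inE => /and3P[].
  have : p / 2 * #|D|%:R * p ^+ nearc q0 L <= #|[set d in D | G d z && ok z d]|%:R * p ^+ nearc q0 L.
    by rewrite ler_wpM2r // exprn_ge0 // ltW.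
  apply: le_trans.
  have : ka * 2 ^+ size L * 2 * p <= #|D|%:R * p ^+ nearc q0 L * p by rewrite ler_pM2r.
  by lra.
have sz' : ka * 2 ^+ size L * 2 * p <= #|D|%:R * p ^+ nearc q0 L.
  by move: sz; rewrite /= nq /= add0n !exprS; lra.
(* No adjacency is required here, so averaging suffices: if more than [2 * th] vertices [z] failed
   for over half of [D], some [d] would have more than [th] failures. *)
exists [set z in Eh | #|[set d in D | ok z d]|%:R < 2^-1 * #|D|%:R :> R].
  set B := [set z in Eh | _].
  have H1 : \sum_(z in B) #|[set d in D | ~~ ok z d]|%:R <= #|D|%:R * th.
    rewrite (exchange_card R D B (fun d z => ~~ ok z d)).
    rewrite mulr_natl -sumr_const; apply: ler_sum => d dD.
    apply: le_trans (bad d dD); rewrite ler_nat; apply: subset_leq_card.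
    by apply/subsetP => z; rewrite !inE nq /= -!andbA => /and4P[-> -> _ ->].
  have H2 : 2^-1 * #|D|%:R * #|B|%:R <= \sum_(z in B) #|[set d in D | ~~ ok z d]|%:R :> R.
    rewrite [leLHS]mulr_natr -sumr_const; apply: ler_sum => z; rewrite inE => /andP[_ Hz].
    have : #|D|%:R <= #|[set d in D | ok z d]|%:R + #|[set d in D | ~~ ok z d]|%:R :> R.
      rewrite -natrD ler_nat -(cardsID [set d | ok z d] D); apply: leq_add.
        by rewrite subset_leq_card //; apply/subsetP => d; rewrite !inE.
      by rewrite subset_leq_card //; apply/subsetP => d; rewrite !inE andbC.
    by move: Hz; lra.
  have Dp : 0 < #|D|%:R :> R.
    rewrite lt0r D0 andbT; apply/eqP => DE; move: sz'; rewrite DE mul0r leNgt.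
    by rewrite !mulr_gt0 // exprn_gt0.
  rewrite -(ler_pM2l Dp); move: (le_trans H2 H1); lra.
move=> z zE; rewrite !inE zE => + cz; rewrite cz /= -leNgt => Dz.
apply: (main [set d in D | ok z d]).
- by apply/subsetP => d; rewrite inE => /andP[].
- by move=> d; rewrite !inE => /andP[].
have : 2^-1 * #|D|%:R * p ^+ nearc q0 L <= #|[set d in D | ok z d]|%:R * p ^+ nearc q0 L.
  by rewrite ler_wpM2r // exprn_ge0 // ltW.
by apply: le_trans; lra.
Qed.

(** Half of [D] is set aside for the exceptional vertices of the removed position. What remains
    shrinks by [p / 2] or [1 / 2] at each later position and must have [ka] elements whenever
    density is applied; it may drop below [ka] after the last application, whence the factor [p] on
    the left of the size condition. *)
Lemma almost_all_remove ka eta q0 (D : {set T}) (th0 : R) (P : seq (nat * T) -> Prop) (L : seq entry) h :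
  dense G eps p ka eta -> 0 < ka -> 0 <= eta ->
  (forall a b, a =i b -> P a -> P b) ->
  (forall d h', P ((q0, d) :: h') -> P h') ->
  (forall q E th, (q, E, th) \in L -> [disjoint D & E]) ->
  (forall d, compat h q0 d) ->
  th0 <= #|D|%:R / 2 ->
  ka * 2 ^+ size L * p <= #|D|%:R / 2 * p ^+ nearc q0 L ->
  almost_all h ((q0, D, th0) :: L) P -> almost_all h (relax ka eta q0 L) P.
Proof.
move=> dn ka0 eta0 PP Pd dDE ch thD sz /= [B HB H].
apply: (@almost_all_impl _ _ (fun h' => exists d, P ((q0, d) :: h'))).
  by move=> h' [d /Pd].
apply: (@almost_all_remove_aux _ _ _ _ _ dn ka0 eta0 PP h (D :\: B)).
- move=> q E th I; apply: disjointWl (dDE _ _ _ I); exact: subsetDl.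
- by move=> d; rewrite inE => /andP[dB dD]; apply: H.
apply: (le_trans sz); rewrite ler_wpM2r ?exprn_ge0 ?(ltW p0) //.
have : #|D|%:R <= #|D :\: B|%:R + #|B|%:R :> R.
  rewrite -natrD ler_nat -(cardsID B D) addnC leq_add2l.
  by rewrite subset_leq_card // subsetIr.
by move: HB thD; lra.
Qed.

End AlmostAll.

(** * Moving a window along *)

Section Reach.
Variables (R : realFieldType) (T : finType) (G : sgraph T) (eps p : R).
Variables (k : nat) (t0 : T).
Local Notation n := (#|T|%:R : R).
Local Notation entry := (nat * {set T} * R)%type.
Local Notation almost_all := (@almost_all R T G k).

(** Only the window [s] is tied to the history. The earlier vertices [w] are existential, and this
    is what allows their positions to be dropped from the history by [almost_all_remove]. *)
Definition reached (S : nat -> {set T}) (x : seq T) (i : nat) (h : seq (nat * T)) :=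
  exists w s, [/\ size w = i, size s = k, pw G k (x ++ w ++ s),
    forall j, (j < i)%N -> nth t0 w j \in S j &
    forall j, (j < k)%N -> nth t0 s j \in S (i + j)%N /\ (i + j, nth t0 s j)%N \in h].

Lemma reached_eqi S x i a b : a =i b -> reached S x i a -> reached S x i b.
Proof.
move=> ab [w [s [sw ss H Hw Hs]]]; exists w, s; split => // j /Hs [? ?].
by rewrite -ab.
Qed.

Lemma reached_drop S x i q d h : (q < i)%N -> reached S x i ((q, d) :: h) ->
  reached S x i h.
Proof.
move=> qi [w [s [sw ss H Hw Hs]]]; exists w, s; split => // j jk.
have [? ] := Hs j jk; rewrite inE => /orP[/eqP[E _]|//]; lia.
Qed.

Lemma reached_step S x i h z : (0 < k)%N -> coh G k h -> reached S x i h ->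
  (i + k, z)%N \in h -> z \in S (i + k)%N -> reached S x i.+1 h.
Proof.
move=> k0 ch [w [s [sw ss H Hw Hs]]] zh zS.
case: s ss H Hs => [|y s]; first by move=> /=; lia.
move=> ss H Hs; exists (rcons w y), (rcons s z); split.
- by rewrite size_rcons sw.
- by rewrite size_rcons.
- rewrite cat_rcons -rcons_cons -!rcons_cat; apply: pw_rcons => //.
  have -> : drop (size (x ++ w ++ y :: s) - k) (x ++ w ++ y :: s) = y :: s.
    by rewrite catA size_cat ss addnK drop_size_cat.
  apply/(all_nthP t0) => j; rewrite ss => jk; have [_ jh] := Hs j jk.
  apply: (ch (i + j, nth t0 (y :: s) j)%N (i + k, z)%N) => //=.
    by apply/eqP => -[]; lia.
  by rewrite /near; lia.
- move=> j ji; rewrite nth_rcons sw; case: ltnP => [/Hw //|ij].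
  have -> : j = i by lia.
  by rewrite eqxx; have [] := Hs 0%N k0; rewrite addn0.
move=> j jk; rewrite nth_rcons; case: ltnP => js.
  have [] := Hs j.+1; first by move: ss => /=; lia.
  by rewrite /= addSnnS.
have -> : j = size s by move: ss => /=; lia.
rewrite eqxx; have -> : (i.+1 + size s = i + k)%N by rewrite -ss /=; lia.
by [].
Qed.

Lemma reached_steps S x i m h : (0 < k)%N -> coh G k h -> reached S x i h ->
  (forall j, (j < m)%N -> exists2 z, z \in S (i + k + j)%N & (i + k + j, z)%N \in h) ->
  reached S x (i + m) h.
Proof.
move=> k0 ch; elim: m => [|m IH] H0 H; first by rewrite addn0.
rewrite addnS; have [z zS zh] := H m (ltnSn m).
have E : (i + m + k = i + k + m)%N by lia.
by apply: (reached_step (z := z)) => //; rewrite ?E //; apply: IH => // j jm; apply: H; lia.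
Qed.

Hypotheses (p0 : 0 < p) (p1 : p <= 1) (eps0 : 0 < eps) (eps4 : eps <= 1 / 4).
Hypothesis (k2 : (2 <= k)%N).

Lemma almost_all_le_map (I : eqType) (s : seq I) h (q : I -> nat) (E : I -> {set T})
    (th th' : I -> R) P : (forall i, i \in s -> th i <= th' i) ->
  almost_all h [seq (q i, E i, th i) | i <- s] P -> almost_all h [seq (q i, E i, th' i) | i <- s] P.
Proof.
move=> H; apply: almost_all_le; elim: s H => [|i s IH] H //=.
rewrite !eqxx /= H ?mem_head //; apply: IH => j js.
by apply: H; rewrite inE js orbT.
Qed.

(* Dropping the first position of the window multiplies the exceptional sets by at most [4 / p]. *)
Definition thr (i j : nat) : R := 4 ^+ i * eps * p ^+ (maxn k j - i) * n.

Lemma n_ge0 : 0 <= n. Proof. by []. Qed.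

Lemma thr_ge0 i j : 0 <= thr i j.
Proof. by rewrite /thr !mulr_ge0 ?exprn_ge0 // ltW. Qed.

Section Stage.
Variables (S F : nat -> {set T}) (x : seq T) (o : nat).
Hypothesis FS : forall j, F j \subset S (o + j)%N.
Hypothesis Sdis : forall i j, i != j -> [disjoint S i & S j].

Definition stage i := [seq (o + j, F j, thr i j)%N | j <- iota i k].

Lemma Fdis i j : i != j -> [disjoint F i & F j].
Proof.
move=> ij; apply: disjointW (FS i) (FS j) _; apply: Sdis; apply: contra ij; lia.
Qed.

(** Position [o + i + k] enters, with no exceptional vertices, before position [o + i] is removed.
    All [k] remaining positions are within [k] of the removed one, so each threshold grows by
    [4 / p], which is the drop by one of the exponent in [thr]. *)
Lemma stage_step i ka th0 : (i < k)%N ->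
  dense G eps p ka (eps * p ^+ k.-1 * n) -> 0 < ka -> 
  ka * 2 ^+ k * p <= #|F i|%:R / 2 * p ^+ k ->
  th0 <= #|F i|%:R / 2 ->
  almost_all [::] ((o + i, F i, th0)%N :: [seq (o + j, F j, thr i j)%N | j <- iota i.+1 k.-1])
     (reached S x (o + i)) ->
  almost_all [::] (stage i.+1) (reached S x (o + i.+1)).
Proof.
move=> ik dn ka0 sz th0F /almost_all_coh -/(_ (@coh_nil _ _ _)) H.
have H1 : almost_all [::] ((o + i, F i, th0)%N :: [seq (o + j, F j, thr i j)%N | j <- iota i.+1 k])
     (reached S x (o + i.+1)).
  have -> : iota i.+1 k = iota i.+1 k.-1 ++ [:: (i + k)%N].
    by rewrite -[in LHS](ltn_predK k2) -[k.-1.+1]addn1 iotaD /=; congr (_ ++ [:: _]); lia.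
  rewrite map_cat -cat_cons; apply: almost_all_cat; apply: almost_all_impl H => h [ch Hr] /=.
  exists set0; first by rewrite cards0 thr_ge0.
  move=> z zF _ cz; rewrite addnS.
  apply: (@reached_step _ _ _ _ z); first by lia.
  - exact: coh_cons.
  - case: Hr => w [s [sw ss Hp Hw Hs]]; exists w, s; split => // j /Hs [? jh].
    by rewrite inE jh orbT.
  - by rewrite inE addnA eqxx.
  - by have := subsetP (FS (i + k)%N) z zF; rewrite addnA.
have nk : nearc k (o + i)%N [seq (o + j, F j, thr i j)%N | j <- iota i.+1 k] = k.
  rewrite -[RHS](size_iota i.+1 k) -[RHS](size_map (fun j => (o + j, F j, thr i j)%N)).
  apply/eqP; rewrite -all_count; apply/allP => a /mapP[j]; rewrite mem_iota => ij -> /=.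
  by rewrite /near; lia.
have eta0 : 0 <= eps * p ^+ k.-1 * n by rewrite !mulr_ge0 ?exprn_ge0 // ltW.
have H2 : almost_all [::] (relax p k ka (eps * p ^+ k.-1 * n) (o + i)
    [seq (o + j, F j, thr i j)%N | j <- iota i.+1 k]) (reached S x (o + i.+1)).
  apply: (almost_all_remove p0 eps4 p1 dn ka0 eta0 _ _ _ _ th0F _ H1).
  - exact: reached_eqi.
  - by move=> d h; apply: reached_drop; rewrite addnS.
  - move=> q E th /mapP[j]; rewrite mem_iota => ij [_ -> _].
    by apply: Fdis; apply/eqP; lia.
  - by [].
  by rewrite nk size_map size_iota.
move: H2; rewrite /relax -map_comp; apply: almost_all_le_map => j; rewrite mem_iota => ij /=.
have -> : near k (o + i) (o + j) by rewrite /near; lia.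
rewrite ge_max; apply/andP; split.
  rewrite /thr ler_pdivrMr //.
  have -> : (maxn k j - i = (maxn k j - i.+1).+1)%N by lia.
  by rewrite !exprS; lra.
rewrite /thr ler_wpM2r ?n_ge0 //.
have -> : eps * p ^+ k.-1 = 1 * (eps * p ^+ k.-1) by rewrite mul1r.
rewrite -mulrA; apply: ler_pM => //; first by rewrite mulr_ge0 ?exprn_ge0 // ltW.
  by rewrite exprn_ege1 // ler1n.
rewrite ler_wpM2l ?(ltW eps0) // ler_wiXn2l ?(ltW p0) //; lia.
Qed.

(** The induction starts at stage 1 because the first removal is the hard one. The set [F i] has
    about [p^(k-i) n] vertices and shrinks by [k - 1] further factors [p] before density is last
    used on it. For [i >= 1] the density threshold [p^(2k-2) n] covers this; for [i = 0] the
    exponent is [2k-1], supplied for [k > 2] only. *)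
Lemma stages (c : R) i : (1 <= i)%N ->
  dense G eps p (eps * p ^+ (2 * k - 2) * n) (eps * p ^+ k.-1 * n) ->
  4 ^+ k.+1 * eps <= c ->
  (forall j, (1 <= j)%N -> (j < k)%N -> c * p ^+ (k - j) * n <= #|F j|%:R) ->
  0 < n ->
  almost_all [::] (stage 1) (reached S x o.+1) -> (i <= k)%N ->
  almost_all [::] (stage i) (reached S x (o + i)).
Proof.
move=> i1 dn Hc Fc n0 H1 ik.
elim: i i1 ik => [//|[|i] IH] _ ik; first by rewrite addn1.
have {IH} := IH isT (ltnW ik); rewrite /stage -{2}(ltn_predK k2) /=.
have c0 : 0 < c by apply: lt_le_trans Hc; rewrite mulr_gt0 // exprn_gt0.
have Fi := Fc i.+1 isT ik.
apply: (stage_step ik dn) => //.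
- by rewrite !mulr_gt0 // exprn_gt0.
- apply: (@le_trans _ _ (c * p ^+ (k - i.+1) * n / 2 * p ^+ k)); last first.
    by rewrite ler_wpM2r ?exprn_ge0 ?(ltW p0) // ler_wpM2r // invr_ge0.
  have -> : eps * p ^+ (2 * k - 2) * n * 2 ^+ k * p =
     (2 * 2 ^+ k * eps) * p ^+ (2 * k - 2).+1 * (n / 2) by rewrite exprS; field.
  have -> : c * p ^+ (k - i.+1) * n / 2 * p ^+ k = c * p ^+ (k - i.+1 + k) * (n / 2).
    by rewrite exprD; ring.
  rewrite ler_wpM2r ?divr_ge0 //; apply: ler_pM; rewrite ?exprn_ge0 ?(ltW p0) //.
  + by rewrite !mulr_ge0 ?exprn_ge0 // ltW.
  + apply: le_trans Hc; rewrite ler_wpM2r ?(ltW eps0) // -exprS.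
    by rewrite lerXn2r ?nnegrE // ler_nat.
  + by rewrite ler_wiXn2l ?(ltW p0) //; lia.
apply: (@le_trans _ _ (c * p ^+ (k - i.+1) * n / 2)); last first.
  by rewrite ler_wpM2r // invr_ge0.
have -> : c * p ^+ (k - i.+1) * n / 2 = c / 2 * p ^+ (k - i.+1) * n by ring.
rewrite /thr; have -> : (maxn k i.+1 - i.+1 = k - i.+1)%N by lia.
rewrite ler_wpM2r ?n_ge0 // ler_wpM2r ?exprn_ge0 ?(ltW p0) //.
rewrite ler_pdivlMr //; apply: le_trans Hc.
have -> : 4 ^+ i.+1 * eps * 2 = (4 ^+ i.+1 * 2) * eps by ring.
rewrite ler_wpM2r ?(ltW eps0) //.
apply: (@le_trans _ _ (4 ^+ i.+2)).
  by rewrite [leRHS]exprSr ler_wpM2l ?exprn_ge0 // ler_nat.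
by apply: ler_weXn2l; [rewrite ler1n | apply: leqW].
Qed.

Lemma stages_generic (c : R) :
  (forall j, (j < k)%N -> F (k + j)%N = S (o + k + j)%N) ->
  dense G eps p (eps * p ^+ (2 * k - 2) * n) (eps * p ^+ k.-1 * n) ->
  4 ^+ k.+1 * eps <= c ->
  (forall j, (1 <= j)%N -> (j < k)%N -> c * p ^+ (k - j) * n <= #|F j|%:R) ->
  0 < n ->
  almost_all [::] (stage 1) (reached S x o.+1) ->
  almost_all [::] [seq ((o + k + j)%N, S (o + k + j)%N, 4 ^+ k * eps * p ^+ j * n) | j <- iota 0 k]
     (reached S x (o + k)).
Proof.
move=> FSk dn Hc Fc n0 H1.
have := stages (ltnW k2) dn Hc Fc n0 H1 (leqnn k).
rewrite /stage -[X in iota X _]addn0 iotaDl -map_comp; congr (almost_all _ _ _).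
apply/eq_in_map => j; rewrite mem_iota add0n => /andP[_ jk] /=.
by rewrite addnA FSk // /thr; have -> : (maxn k (k + j) - k = j)%N by lia.
Qed.

End Stage.
End Reach.

Section ReachBig.
Variables (R : realFieldType) (T : finType) (G : sgraph T) (eps p : R).
Variables (k : nat) (t0 : T).
Local Notation n := (#|T|%:R : R).
Local Notation almost_all := (@almost_all R T G k).
Local Notation reached := (reached G k t0).

(* Up to the factor [c], [X] contains the expected number of ways to continue the path whose last
   vertex is the first one of [s]. *)
Definition rich (c : R) (s : seq T) (X : {set T}) :=
  forall l, (l <= k)%N -> c * p ^+ l * n <= #|cN G (take l s) :&: X|%:R.

Lemma rich_rev_drop c x X j : rich c (rev x) X -> size x = k ->
  c * p ^+ (k - j) * n <= #|cN G (drop j x) :&: X|%:R.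
Proof.
move=> /(_ (k - j)%N (leq_subr _ _)) H sx; move: H; rewrite take_rev sx cN_rev.
case: (leqP j k) => jk; first by rewrite subKn.
have -> : (k - j = 0)%N by lia.
by rewrite subn0 !drop_oversize ?sx // ltnW.
Qed.

Lemma reached0 (S : nat -> {set T}) x h : size x = k -> pw G k x ->
  coh G k h ->
  (forall j, (j < k)%N -> exists2 z, z \in cN G (drop j x) :&: S (0 + j)%N & (j, z) \in h) ->
  reached S x 0 h.
Proof.
move=> sx px ch H.
have [f Hf] : exists f : nat -> T,
    forall j, (j < k)%N -> f j \in cN G (drop j x) :&: S (0 + j)%N /\ (j, f j) \in h.
  have : forall j, exists z, (j < k)%N -> z \in cN G (drop j x) :&: S (0 + j)%N /\ (j, z) \in h.
    move=> j; case: (ltnP j k) => jk; last by exists t0.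
    by have [z zF zh] := H j jk; exists z.
  by move/choice => [f Hf]; exists f.
exists [::], (mkseq f k); split => //.
- by rewrite size_mkseq.
- rewrite cat0s; apply/(pwP G t0) => i j ij; rewrite size_cat size_mkseq sx => jk jd.
  rewrite !nth_cat sx; case: (ltnP i k) => ik; case: (ltnP j k) => jk'.
  + by move/(pwP G t0): px; apply; rewrite ?sx.
  + rewrite nth_mkseq; last by lia.
    have [|+ _] := Hf (j - k)%N; first by lia.
    rewrite !inE => /andP[/(all_nthP t0)/(_ (i - (j - k))%N) + _].
    by rewrite size_drop nth_drop subnKC ?sx; [apply|]; lia.
  + by lia.
  rewrite !nth_mkseq; try lia.
  have [|_ Hi] := Hf (i - k)%N; first by lia.
  have [|_ Hj] := Hf (j - k)%N; first by lia.
  apply: (ch _ _ Hi Hj) => /=; first by apply/eqP => -[]; lia.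
  by rewrite /near; lia.
- by move=> j jk; rewrite nth_mkseq // !add0n; have [] := Hf j jk; rewrite inE => /andP[].
Qed.

Hypotheses (p0 : 0 < p) (p1 : p <= 1) (eps0 : 0 < eps) (eps4 : eps <= 1 / 4).
Hypothesis (k2 : (2 <= k)%N).

(** The thresholds decrease with [j] because the vertices chosen earlier in the window leave about
    [p^j n] candidates at its [j]-th position. *)
Definition generic_reach (S : nat -> {set T}) (x : seq T) (l : nat) :=
  almost_all [::] [seq ((l + j)%N, S (l + j)%N, 4 ^+ k * eps * p ^+ j * n) | j <- iota 0 k]
     (reached S x l).

(** The sets [F j] consist of common neighbours of the relevant part of [x], so every coherent
    choice of the first window is reached and the exceptional sets at stage 0 are empty. Density
    with exponent [2k-1] then pays for the first removal. *)
Lemma reach3 (c : R) (S : nat -> {set T}) x :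
  dense G eps p (eps * p ^+ (2 * k - 1) * n) (eps * p ^+ k.-1 * n) ->
  4 ^+ k.+1 * eps <= c -> 0 < n ->
  (forall i j, i != j -> [disjoint S i & S j]) ->
  size x = k -> pw G k x ->
  (forall q, (q < k)%N -> rich c (rev x) (S q)) ->
  generic_reach S x k.
Proof.
move=> dn Hc n0 Sdis sx px Sx; rewrite /generic_reach.
pose F j := cN G (drop j x) :&: S (0 + j)%N.
have FS j : F j \subset S (0 + j)%N by apply: subsetIr.
have c0 : 0 < c by apply: lt_le_trans Hc; rewrite mulr_gt0 // exprn_gt0.
have Fc j : (j < k)%N -> c * p ^+ (k - j) * n <= #|F j|%:R.
  by move=> jk; apply: rich_rev_drop => //; apply: Sx.
have dn' : dense G eps p (eps * p ^+ (2 * k - 2) * n) (eps * p ^+ k.-1 * n).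
  apply: dense_mono dn => //; rewrite ler_wpM2r // ler_wpM2l ?(ltW eps0) //.
  by rewrite ler_wiXn2l ?(ltW p0) //; lia.
have := @stages_generic R T G eps p k t0 p0 p1 eps0 eps4 k2 S F x 0 FS Sdis c.
rewrite add0n; apply => //.
  by move=> j jk; rewrite /F drop_oversize ?cN_nil ?setTI // sx; lia.
  by move=> j _ jk; apply: Fc.
have k0 : (0 < k)%N by lia.
have Hc2 : 2 * 2 ^+ k * eps <= c.
  apply: le_trans Hc; rewrite ler_wpM2r ?(ltW eps0) // -exprS.
  by rewrite lerXn2r ?nnegrE // ler_nat.
have F0 := Fc _ k0; rewrite subn0 in F0.
have two1 : 1 <= 2 ^+ k :> R by rewrite exprn_ege1 // ler1n.
apply: (@stage_step R T G eps p k t0 p0 p1 eps0 eps4 k2 S F x 0 FS Sdis 0 _ (thr T eps p k 0 0) _ dn) => //.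
- by rewrite !mulr_gt0 // exprn_gt0.
- apply: (@le_trans _ _ (c * p ^+ k * n / 2 * p ^+ k)); last first.
    by rewrite ler_wpM2r ?exprn_ge0 ?(ltW p0) // ler_wpM2r // invr_ge0.
  have -> : eps * p ^+ (2 * k - 1) * n * 2 ^+ k * p =
     (2 * 2 ^+ k * eps) * p ^+ (2 * k - 1).+1 * (n / 2) by rewrite exprS; field.
  have -> : c * p ^+ k * n / 2 * p ^+ k = c * p ^+ (2 * k - 1).+1 * (n / 2).
    have -> : (2 * k - 1).+1 = (k + k)%N by move: k2; clear; lia.
    by rewrite exprD; ring.
  by rewrite ler_wpM2r ?divr_ge0 // ler_wpM2r // exprn_ge0 // ltW.
- apply: (@le_trans _ _ (c * p ^+ k * n / 2)); last by rewrite ler_wpM2r // invr_ge0.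
  rewrite /thr expr0 maxn0 subn0.
  have -> : c * p ^+ k * n / 2 = (c / 2) * p ^+ k * n by ring.
  rewrite ler_wpM2r // ler_wpM2r ?exprn_ge0 ?(ltW p0) //.
  have : 2 * eps <= 2 * 2 ^+ k * eps.
    by rewrite ler_wpM2r ?(ltW eps0) // ler_peMr.
  by move: Hc2; lra.
have -> : ((0 + 0)%N, F 0%N, thr T eps p k 0 0) :: [seq ((0 + j)%N, F j, thr T eps p k 0 j) | j <- iota 1 k.-1]
   = [seq ((0 + j)%N, F j, thr T eps p k 0 j) | j <- iota 0 k].
  have -> : iota 0 k = 0%N :: iota 1 k.-1 by rewrite -[in LHS](ltn_predK k2).
  by [].
apply: almost_all_all => //.
  by move=> q E th /mapP[j _ [_ _ ->]]; exact: thr_ge0.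
move=> h _ ch H.
apply: (reached0 sx px ch) => j jk.
have [|z zF zh] := H j (F j) (thr T eps p k 0 j); last by exists z.
by apply/mapP; exists j; rewrite ?mem_iota.
Qed.

End ReachBig.

Section BadSets.
Variables (R : realFieldType) (T : finType) (G : sgraph T) (eps p : R).
Local Notation n := (#|T|%:R : R).

Definition few_atypical (g : R) (d : nat) := forall X : {set T},
  10 / g * (eps * p ^+ d * n) <= #|X|%:R ->
  #|[set v | #|nb G v :&: X|%:R < (1 - g) * p * #|X|%:R]|%:R <= eps * p ^+ d.+1 * n.

(** The last hypothesis turns the rounding error [1] of [bad_lt] into four times the threshold
    [eta]; the [10] in [few_atypical] comes from [eta + 1 <= 5 * eta] and the bound [g / 2]. *)
Lemma few_atypicalP (g : R) d : 0 < p -> p <= 1 -> 0 < eps -> 0 < g -> g <= 1 ->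
  eps <= g / 2 -> dense G eps p (eps * p ^+ d * n) (eps * p ^+ d.+1 * n) ->
  1 <= 4 * (eps * p ^+ d.+1 * n) -> few_atypical g d.
Proof.
move=> p0 p1 e0 g0 g1 eg dn H3 X HX; apply/ltW.
set a := eps * p ^+ d * n in dn HX *.
have aE : eps * p ^+ d.+1 * n = p * a by rewrite exprS /a; ring.
rewrite aE in dn H3 *.
have pa0 : 0 < p * a by move: H3; lra.
have a0 : 0 < a by rewrite pmulr_rgt0 in pa0.
have paa : p * a <= a by rewrite ler_piMl // ltW.
have ga : 10 * a <= g * #|X|%:R.
  have := ler_wpM2l (ltW g0) HX.
  by have -> : g * (10 / g * a) = 10 * a by field; rewrite gt_eqF.
have X0 : g * #|X|%:R <= #|X|%:R by rewrite ler_piMl.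
apply: (bad_lt p0 e0 dn) => //.
- by move: H3 paa ga; lra.
- by move: ga X0 a0; lra.
Qed.

Definition atyp (X : {set T}) := [set v | #|nb G v :&: X|%:R < p / 2 * #|X|%:R].

Lemma atyp_le d (X : {set T}) : few_atypical (1 / 2) d -> 20 * (eps * p ^+ d * n) <= #|X|%:R ->
  #|atyp X|%:R <= eps * p ^+ d.+1 * n.
Proof.
move=> H HX; have -> : atyp X = [set v | #|nb G v :&: X|%:R < (1 - 1 / 2) * p * #|X|%:R].
  by apply/setP => v; rewrite !inE; congr (_ < _); field.
by apply: H; apply: le_trans HX; rewrite le_eqVlt; apply/orP; left; apply/eqP; field.
Qed.

Lemma natypP (X : {set T}) v : v \notin atyp X -> p / 2 * #|X|%:R <= #|nb G v :&: X|%:R.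
Proof. by rewrite inE -leNgt. Qed.

Lemma card_rem (A B : {set T}) : #|A|%:R - #|B|%:R <= #|A :\: B|%:R :> R.
Proof.
rewrite lerBlDr -natrD ler_nat -(cardsID B A) addnC leq_add2l.
by rewrite subset_leq_card // subsetIr.
Qed.

End BadSets.

(** * Reaching when [k = 2] *)

Section Reach2.
Variables (R : realFieldType) (T : finType) (G : sgraph T) (eps p : R).
Variables (t0 : T).
Local Notation n := (#|T|%:R : R).
Local Notation k := 2%N.
Local Notation almost_all := (@almost_all R T G k).
Local Notation reached := (reached G k t0).
Local Notation atyp := (atyp G p).

Hypotheses (p0 : 0 < p) (p1 : p <= 1) (eps0 : 0 < eps) (eps4 : eps <= 1 / 4).
Hypothesis dn : dense G eps p (eps * p ^+ 2 * n) (eps * p * n).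
Hypothesis fa : few_atypical G eps p (1 / 2) 1.
Hypothesis n0 : 0 < n.

Section Core.
Variables (c : R) (S : nat -> {set T}) (x0 x1 : T).
Hypotheses (c1 : c <= 1) (cp : 0 < c) (Hc : 512 * eps <= c ^+ 2).
Hypothesis Sdis : forall i j, i != j -> [disjoint S i & S j].
Hypothesis Scard : forall q, (q < 6)%N -> c * n <= #|S q|%:R.
Hypothesis Sx1 : c * p * n <= #|nb G x1 :&: S 1%N|%:R.
Hypothesis Sx2 : c * p ^+ 2 * n <= #|cN G [:: x0; x1] :&: S 0%N|%:R.

Lemma eps_c : 512 * eps <= c.
Proof. by apply: (le_trans Hc); rewrite expr2 ler_piMl // ltW. Qed.

Let pn0 : 0 < p * n. Proof. by rewrite mulr_gt0. Qed.
Let ppn0 : 0 < p ^+ 2 * n. Proof. by rewrite mulr_gt0 // exprn_gt0. Qed.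
Let ppn : p ^+ 2 * n <= p * n.
Proof. by rewrite expr2 -mulrA ler_piMl // ltW. Qed.
Let pnn : p * n <= n. Proof. by rewrite ler_piMl // ltW. Qed.

Let cM (a b : R) : 512 * eps <= c -> 0 <= b -> 512 * (eps * b) <= c * b.
Proof. by move=> H b0; rewrite mulrA ler_wpM2r. Qed.

Let atyp1 (X : {set T}) : 20 * (eps * (p * n)) <= #|X|%:R ->
  #|atyp X|%:R <= eps * (p ^+ 2 * n).
Proof.
move=> H; rewrite mulrA; apply: (atyp_le fa); rewrite expr1.
by apply: le_trans H; rewrite -[eps * p * n]mulrA.
Qed.

Definition mid z1 z2 z3 z4 :=
  [&& z1 \in S 0%N, z2 \in S 1%N, z3 \in S 2%N, G x0 z1, G x1 z1, G x1 z2, G z1 z2,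
   G z1 z3, G z2 z3, G z2 z4 & G z3 z4].

(* Sets of size about [p^3 n] are too small for density when [k = 2], so the third vertex cannot be
   found as in [reach3]. Double counting gives a fourth vertex with many candidates for the third
   one instead, and density applies to these and the candidates for the fifth. *)
Lemma fork : exists z4, [/\ z4 \in S 3%N, z4 \notin atyp (S 4%N), z4 \notin atyp (S 5%N) &
  eps * (p ^+ 2 * n) <= #|[set z3 in S 2%N | [exists z1, exists z2, mid z1 z2 z3 z4]]|%:R].
Proof.
have epsc := eps_c.
have e1 := cM 0 epsc (ltW n0).
have e2 := cM 0 epsc (ltW pn0).
have e3 := cM 0 epsc (ltW ppn0).
have e1' : eps * (p * n) <= eps * n by rewrite ler_wpM2l // ltW.
have e2' : eps * (p ^+ 2 * n) <= eps * (p * n) by rewrite ler_wpM2l // ltW.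
have en0 : 0 < eps * (p ^+ 2 * n) by rewrite mulr_gt0.
have [S2 S3 S4 S5] : [/\ c * n <= #|S 2%N|%:R, c * n <= #|S 3%N|%:R,
  c * n <= #|S 4%N|%:R & c * n <= #|S 5%N|%:R] by split; apply: Scard.
pose S3' := S 3%N :\: atyp (S 4%N) :\: atyp (S 5%N).
have b4 : #|atyp (S 4%N)|%:R <= eps * (p ^+ 2 * n) by apply: atyp1; lra.
have b5 : #|atyp (S 5%N)|%:R <= eps * (p ^+ 2 * n) by apply: atyp1; lra.
have cS3' : c * n / 2 <= #|S3'|%:R.
  have := card_rem R (S 3%N :\: atyp (S 4%N)) (atyp (S 5%N)).
  have := card_rem R (S 3%N) (atyp (S 4%N)).
  by rewrite -/S3'; lra.
pose X2 := nb G x1 :&: S 1%N :\: atyp S3'.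
have cX2 : c * (p * n) / 2 <= #|X2|%:R.
  have := card_rem R (nb G x1 :&: S 1%N) (atyp S3').
  have : #|atyp S3'|%:R <= eps * (p ^+ 2 * n) by apply: atyp1; lra.
  by rewrite -/X2; move: Sx1; lra.
pose Z1 := cN G [:: x0; x1] :&: S 0%N :\: atyp X2.
have cZ1 : c * (p ^+ 2 * n) / 2 <= #|Z1|%:R.
  have := card_rem R (cN G [:: x0; x1] :&: S 0%N) (atyp X2).
  have : #|atyp X2|%:R <= eps * (p ^+ 2 * n) by apply: atyp1; lra.
  by rewrite -/Z1; move: Sx2; lra.
pose D z1 := nb G z1 :&: X2.
have cD z1 : z1 \in Z1 -> c * (p ^+ 2 * n) / 4 <= #|D z1|%:R.
  rewrite inE => /andP[/natypP H _]; apply: le_trans H.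
  have := ler_wpM2l (ltW p0) cX2; rewrite expr2; lra.
pose W z2 := nb G z2 :&: S3'.
have cW z2 : z2 \in X2 -> c * (p * n) / 4 <= #|W z2|%:R.
  rewrite inE => /andP[/natypP H _]; apply: le_trans H.
  have := ler_wpM2l (ltW p0) cS3'; lra.
(* [Q z2 z3] guarantees many common neighbours [z4] of [z2] and [z3]; [Q2 z1 z3] asks for some
   suitable [z2] between [z1] and [z3]. *)
pose Q z2 z3 := z3 \notin atyp (W z2).
pose Q2 z1 z3 := [exists z2 in D z1, G z2 z3 && Q z2 z3].
have subS (i : nat) (A B : {set T}) : A \subset S i -> A :\: B \subset S i.
  by apply: subset_trans; apply: subsetDl.
have X2S : X2 \subset S 1%N by apply: subS; apply: subsetIr.
have Z1S : Z1 \subset S 0%N by apply: subS; apply: subsetIr.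
have S3S : S3' \subset S 3%N by apply: subS; apply: subsetDl.
have dn' : dense G eps p (eps * (p ^+ 2 * n)) (eps * (p * n)).
  by rewrite (mulrA eps p) (mulrA eps (p ^+ 2)); exact: dn.
have DpR (y : R) : 4 * y / p = 4 * (y / p) by rewrite mulrA.
have T1 z1 : z1 \in Z1 ->
    #|[set z3 in S 2%N | G z1 z3 && ~~ Q2 z1 z3]|%:R <= 4 * (eps * (p * n)).
  move=> z1Z; have cD1 := cD _ z1Z.
  have dDS : [disjoint D z1 & S 2%N].
    apply: (disjointWl _ (Sdis (isT : 1%N != 2%N))).
    by apply: subset_trans X2S; apply: subsetIr.
  have ge0 : 0 <= eps * (p * n) by rewrite mulr_ge0 // ltW.
  have kD : eps * (p ^+ 2 * n) <= #|D z1|%:R by move: cD1 e3 en0; lra.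
  have bz2 z2 : z2 \in D z1 ->
      #|[set z in S 2%N | G z2 z && ~~ Q z2 z]|%:R <= eps * (p ^+ 2 * n).
    rewrite inE => /andP[_ z2X]; apply: (@le_trans _ _ #|atyp (W z2)|%:R).
      rewrite ler_nat; apply: subset_leq_card; apply/subsetP => z.
      by rewrite inE negbK => /and3P[].
    by apply: atyp1; move: (cW _ z2X) e2; lra.
  have := transfer p0 eps4 ge0 dn' dDS kD bz2.
  have -> : 4 * (eps * (p ^+ 2 * n)) / p = 4 * (eps * (p * n)).
    by field; rewrite gt_eqF.
  rewrite (_ : Num.max _ _ = 4 * (eps * (p * n))); last by apply/max_idPl; lra.
  apply: le_trans; rewrite ler_nat; apply: subset_leq_card.
  apply/subsetP => z; rewrite !inE => /and3P[-> _ nQ] /=.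
  have -> : [set d in D z1 | G d z && Q d z] = set0.
    apply/setP => z2; rewrite in_set in_set0; apply/negP => /andP[z2D H].
    by move/existsP: nQ; apply; exists z2; rewrite z2D.
  by rewrite cards0 mulr_gt0 ?divr_gt0 //; move: cD1 e3 en0; lra.
have dZS : [disjoint Z1 & S 2%N] by apply: (disjointWl Z1S (Sdis (isT : 0%N != 2%N))).
have ge0 : 0 <= eps * (p * n) by rewrite mulr_ge0 // ltW.
have kZ : eps * (p ^+ 2 * n) <= #|Z1|%:R by move: cZ1 e3 en0; lra.
(* Exceptional sets of [z3] grow from [eps p^2 n] for one [z2] through [eps p n] for one [z1] to
   [eps n], which is still small against [S 2]. *)
have := transfer p0 eps4 ge0 dn' dZS kZ T1.
have -> : 4 * (4 * (eps * (p * n))) / p = 16 * (eps * n) by field; rewrite gt_eqF.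
rewrite (_ : Num.max _ _ = 16 * (eps * n)); last by apply/max_idPl; move: e1' en0 e2'; lra.
set BJ := [set z in S 2%N | _] => cBJ.
pose J := S 2%N :\: BJ.
have cJ : c * n / 2 <= #|J|%:R.
  by have := card_rem R (S 2%N) BJ; rewrite -/J; move: cBJ e1 S2; lra.
have cU z3 : z3 \in J -> c * (p ^+ 2 * n) / 8 <=
    #|[set z4 in S3' | [exists z1, exists z2, mid z1 z2 z3 z4]]|%:R.
  rewrite inE andbC => /andP[z3S]; rewrite inE z3S /= -leNgt => H.
  have : 0 < #|[set z1 in Z1 | G z1 z3 && Q2 z1 z3]|%:R :> R.
    apply: lt_le_trans H; rewrite mulr_gt0 ?divr_gt0 //; move: cZ1 e3 en0; lra.
  rewrite ltr0n => /card_gt0P[z1]; rewrite inE => /and3P[z1Z z13 /existsP[z2]].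
  move=> /and3P[z2D z23 /natypP Hz3].
  move: (z2D); rewrite inE => /andP[z12 z2X].
  rewrite inE in z12.
  have cW2 := cW _ z2X.
  apply: (@le_trans _ _ (p / 2 * #|W z2|%:R)).
    by have := ler_wpM2l (ltW p0) cW2; rewrite expr2; lra.
  apply: (le_trans Hz3); rewrite ler_nat; apply: subset_leq_card.
  apply/subsetP => z4; rewrite !inE => /andP[z34 /andP[z24 z4S]].
  rewrite z4S /=.
  apply/existsP; exists z1; apply/existsP; exists z2.
  move: z1Z z2X; rewrite !inE /= andbT => /andP[_ /andP[/andP[x0z x1z] z1S]].
  move=> /andP[_ /andP[x1z2 z2S]].
  by rewrite /mid z1S z2S z3S x0z x1z x1z2 z12 z13 z23 z24 z34.
(* Counting pairs [(z3, z4)]: at least [(c n / 2) (c p^2 n / 8)] of them are distributed over at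
   most [n] vertices [z4]. Both factors [c] enter, so [eps] is compared with [c ^+ 2]. *)
have [z4 z4S Hz4] : exists2 z4, z4 \in S3' & eps * (p ^+ 2 * n) <=
    #|[set z3 in J | [exists z1, exists z2, mid z1 z2 z3 z4]]|%:R.
  apply: contrapT => N.
  have ub : \sum_(z3 in J) #|[set z4 in S3' | [exists z1, exists z2, mid z1 z2 z3 z4]]|%:R
     <= n * (eps * (p ^+ 2 * n)).
    rewrite (exchange_card R S3' J (fun z4 z3 => [exists z1, exists z2, mid z1 z2 z3 z4])).
    apply: (@le_trans _ _ (#|S3'|%:R * (eps * (p ^+ 2 * n)))).
      rewrite mulr_natl -sumr_const; apply: ler_sum => z4 z4S.
      by rewrite leNgt; apply/negP => /ltW H; apply: N; exists z4.
    by rewrite ler_wpM2r ?(ltW en0) // ler_nat max_card.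
  have lb : #|J|%:R * (c * (p ^+ 2 * n) / 8) <=
     \sum_(z3 in J) #|[set z4 in S3' | [exists z1, exists z2, mid z1 z2 z3 z4]]|%:R.
    by rewrite mulr_natl -sumr_const; apply: ler_sum => z3; apply: cU.
  have : c * n / 2 * (c * (p ^+ 2 * n) / 8) <= n * (eps * (p ^+ 2 * n)).
    apply: le_trans ub; apply: le_trans lb; rewrite ler_wpM2r //.
    by rewrite divr_ge0 // mulr_ge0 // ltW.
  have q0 : 0 < n * (p ^+ 2 * n) by rewrite mulr_gt0.
  have := ler_wpM2r (ltW q0) Hc.
  have -> : n * (eps * (p ^+ 2 * n)) = eps * (n * (p ^+ 2 * n)) by ring.
  have -> : c * n / 2 * (c * (p ^+ 2 * n) / 8) = c ^+ 2 * (n * (p ^+ 2 * n)) / 16 by field.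
  have : 0 < eps * (n * (p ^+ 2 * n)) by rewrite mulr_gt0.
  by lra.
move: (z4S); rewrite !inE => /andP[a5 /andP[a4 z43]]; exists z4; split => //;
  rewrite ?inE //.
apply: (le_trans Hz4); rewrite ler_nat; apply: subset_leq_card.
by apply/subsetP => z; rewrite !inE => /andP[/andP[_ ->] ->].
Qed.

End Core.
End Reach2.

Section Reach2b.
Variables (R : realFieldType) (T : finType) (G : sgraph T) (eps p : R).
Variables (t0 : T).
Local Notation n := (#|T|%:R : R).

Lemma reached_fork (S : nat -> {set T}) x0 x1 z1 z2 z3 z4 z5 z6 h :
  G x0 x1 -> mid G S x0 x1 z1 z2 z3 z4 -> z4 \in S 3%N ->
  z5 \in S 4%N -> z6 \in S 5%N -> G z3 z5 -> G z4 z5 -> G z4 z6 -> G z5 z6 ->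
  (4%N, z5) \in h -> (5%N, z6) \in h -> reached G 2 t0 S [:: x0; x1] 4 h.
Proof.
move=> x01 /and5P[s1 s2 s3 x0z /and5P[x1z x1z2 z12 z13 /and3P[z23 z24 z34]]] s4 s5 s6.
move=> z35 z45 z46 z56 h5 h6.
exists [:: z1; z2; z3; z4], [:: z5; z6]; split=> //.
- by rewrite /= x01 x0z x1z x1z2 z12 z13 z23 z24 z34 z35 z45 z46 z56.
- by case=> [|[|[|[|j]]]].
- by case=> [|[|j]].
Qed.

Hypotheses (p0 : 0 < p) (p1 : p <= 1) (eps0 : 0 < eps) (eps4 : eps <= 1 / 4).

(** With [z4] fixed by [fork], its neighbours form the candidates for the fifth and sixth vertices
    and play the part of the sets [F j]. The window therefore starts at position 4 and is generic
    from position [4 + 2] on. *)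
Lemma reach2 (c : R) (S : nat -> {set T}) x :
  dense G eps p (eps * p ^+ 2 * n) (eps * p * n) ->
  few_atypical G eps p (1 / 2) 1 ->
  512 * eps <= c ^+ 2 -> 0 < c -> c <= 1 -> 0 < n ->
  (forall i j, i != j -> [disjoint S i & S j]) ->
  size x = 2%N -> pw G 2 x ->
  (forall q, (q < 6)%N -> rich G p 2 c (rev x) (S q)) ->
  generic_reach G eps p 2 t0 S x 6.
Proof.
move=> dn fa Hc c0 c1 n0 Sdis; case: x => [|x0 [|x1 []]] // _ /=.
rewrite !andbT => x01 HS.
have Scard q : (q < 6)%N -> c * n <= #|S q|%:R.
  by move=> q6; have := HS q q6 0%N isT; rewrite take0 cN_nil setTI expr0 mulr1.
have Sx1 : c * p * n <= #|nb G x1 :&: S 1%N|%:R.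
  by have := HS 1%N isT 1%N isT; rewrite /= cN_cons cN_nil setIT expr1.
have Sx2 : c * p ^+ 2 * n <= #|cN G [:: x0; x1] :&: S 0%N|%:R.
  by have := HS 0%N isT 2%N isT; rewrite take_oversize // cN_rev.
have [z4 [z4S a4 a5 HT]] := fork p0 p1 eps0 eps4 dn fa n0 c1 c0 Hc Sdis Scard Sx1 Sx2.
have epsc := eps_c c1 c0 Hc.
have pn0 : 0 < p * n by rewrite mulr_gt0.
have e2 : 512 * (eps * (p * n)) <= c * (p * n) by rewrite mulrA ler_wpM2r // ltW.
have ep0 : 0 < eps * (p * n) by rewrite mulr_gt0.
pose F j := if (j < 2)%N then nb G z4 :&: S (4 + j)%N else S (4 + j)%N.
have FS j : F j \subset S (4 + j)%N by rewrite /F; case: ifP => // _; apply: subsetIr.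
have cF j : (j < 2)%N -> c / 2 * (p * n) <= #|F j|%:R.
  rewrite /F => j2; rewrite j2.
  have : z4 \notin atyp G p (S (4 + j)%N) by case: j j2 => [|[|//]] _.
  move/natypP; apply: le_trans.
  have : c * n <= #|S (4 + j)%N|%:R by apply: Scard; case: j j2 => [|[|//]].
  by move/(ler_wpM2l (ltW p0)); lra.
have F0 := cF 0%N isT.
pose Tz := [set z3 in S 2%N | [exists z1, exists z2, mid G S x0 x1 z1 z2 z3 z4]].
(* The third vertex is left open: a fifth vertex is bad only if it has no neighbour at all among the
   candidates for the third, and density bounds the number of such vertices. *)
pose B := [set z5 in S 4%N | [disjoint nb G z5 & Tz]].
have cB : #|B|%:R <= eps * p * n.
  rewrite leNgt; apply/negP => HB.
  have dTB : [disjoint Tz & B].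
    apply: disjointW (Sdis 2%N 4%N isT); apply/subsetP => z; rewrite inE => /andP[] //.
  have HT' : eps * p ^+ 2 * n <= #|Tz|%:R by rewrite -mulrA.
  have := dn _ _ dTB HT' (ltW HB); rewrite big1 => [|z].
    rewrite leNgt; apply/negP; rewrite negbK.
    have B0 : 0 < #|B|%:R :> R by apply: lt_trans HB; rewrite -mulrA.
    have T0 : 0 < #|Tz|%:R :> R by apply: lt_le_trans HT; rewrite !mulr_gt0 // exprn_gt0.
    by rewrite !mulr_gt0 // subr_gt0; move: eps4; lra.
  by rewrite inE => /andP[_ /disjoint_setI0 ->]; rewrite cards0.
have dn' : dense G eps p (eps * p ^+ (2 * 2 - 2) * n) (eps * p ^+ 1 * n).
  by rewrite expr1.
rewrite /generic_reach.
apply: (@stages_generic R T G eps p 2 t0 p0 p1 eps0 eps4 isT S F [:: x0; x1] 4 FS Sdis (c / 2)) => //.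
- rewrite (_ : 4 ^+ 3 = 64 :> R); first by move: epsc; lra.
  by rewrite -natrX.
- case=> [|[|j]] // _ _; have := cF 1%N isT; apply: le_trans.
  by rewrite expr1 mulrA.
apply: (@stage_step R T G eps p 2 t0 p0 p1 eps0 eps4 isT S F [:: x0; x1] 4 FS Sdis 0
   _ (eps * p * n) _ dn') => //.
- by rewrite !mulr_gt0 // exprn_gt0.
- have : eps * (p * n) * 8 <= #|F 0%N|%:R by move: F0 e2 ep0; lra.
  move/(ler_wpM2r (ltW (exprn_gt0 2 p0))); rewrite /=.
  have -> : (2 * 2 - 2 = 2)%N by [].
  rewrite (_ : 2 ^+ 2 = 4 :> R); last by rewrite -natrX.
  by lra.
- by move: F0 e2 ep0; lra.
rewrite /=; exists B => // z5 z5F z5B _.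
exists set0; first by rewrite cards0; apply: thr_ge0.
move=> z6 z6F _ /andP[z56 _].
move: z5F z6F; rewrite /F /= !inE => /andP[z45 z5S] /andP[z46 z6S].
move: z5B; rewrite inE z5S /= => /pred0Pn[z3 /=]; rewrite !inE.
move=> /and3P[z53 z3S /existsP[z1 /existsP[z2 Hm]]].
apply: (@reached_fork S x0 x1 z1 z2 z3 z4 z5 z6) => //.
- by rewrite (adj_sym G).
- by rewrite !inE eqxx orbT.
- by rewrite mem_head.
Qed.

End Reach2b.

Lemma all2_map_cat (I A : Type) (r : rel A) (f g : I -> A) (s : seq I) L L' :
  all (fun i => r (f i) (g i)) s -> all2 r L L' -> all2 r (map f s ++ L) (map g s ++ L').
Proof. by elim: s => [|i s IH] //= /andP[-> H] HL; apply: IH. Qed.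

(** * Reversing the order of choice in a window *)

Section Reverse.
Variables (R : realFieldType) (T : finType) (G : sgraph T) (eps p : R).
Variables (k : nat) (t0 : T).
Local Notation n := (#|T|%:R : R).
Local Notation almost_all := (@almost_all R T G k).
Local Notation reached := (reached G k t0).
Variables (S : nat -> {set T}) (x : seq T) (l : nat).

(* The window of the last [k] positions is moved on by [k], now by removing its vertices with the two
   density thresholds exchanged; then its vertices may also be chosen from the last to the first,
   and a search from the other end can meet it. *)
Definition thG i j : R := 4 ^+ (k + i) * eps * p ^+ (j - i) * n.
Definition thH i m : R := 4 ^+ i * eps * p ^+ (2 * k - 1 + m - i) * n.
Definition Lg i := [seq ((l + j)%N, S (l + j)%N, thG i j) | j <- iota i (k - i)].
Definition Lh i := [seq ((l + k + m)%N, S (l + k + m)%N, thH i m) | m <- rev (iota 0 k)].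

(** Position [l + i] sees the [k - i - 1] later positions of its own window and, in the next one,
    only those with [m <= i]. The sum [k] keeps the loss during the removal at [p^k]. *)
Lemma nearc_step i : (i < k)%N ->
  (nearc k (l + i) ([seq ((l + j)%N, S (l + j)%N, thG i j) | j <- iota i.+1 (k - i.+1)] ++ Lh i) <= k)%N.
Proof.
move=> ik; rewrite /nearc count_cat.
have H1 : (count (fun a : nat * {set T} * R => near k (l + i) a.1.1)
    [seq ((l + j)%N, S (l + j)%N, thG i j) | j <- iota i.+1 (k - i.+1)] <= k - i.+1)%N.
  by apply: leq_trans (count_size _ _) _; rewrite size_map size_iota.
have H2 : (count (fun a : nat * {set T} * R => near k (l + i) a.1.1) (Lh i) <= i.+1)%N.
  rewrite /Lh count_map.
  rewrite count_rev -size_filter -[X in (_ <= X)%N](size_iota 0).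
  apply: uniq_leq_size; first by rewrite filter_uniq // iota_uniq.
  move=> m; rewrite mem_filter !mem_iota /near /=; lia.
by move: H1 H2 ik; clear; lia.
Qed.

Hypotheses (p0 : 0 < p) (p1 : p <= 1) (eps0 : 0 < eps) (eps4 : eps <= 1 / 4).
Hypothesis (k2 : (2 <= k)%N).
Hypothesis Sdis : forall i j, i != j -> [disjoint S i & S j].

Lemma thH_ge0 i j : 0 <= thH i j.
Proof. by rewrite /thH !mulr_ge0 ?exprn_ge0 // ltW. Qed.

Let pw_le a b : (b <= a)%N -> p ^+ a <= p ^+ b.
Proof. by move=> ba; rewrite ler_wiXn2l // ltW. Qed.

Let fourS i a b : (b <= a)%N -> eps * p ^+ a * n <= 4 ^+ i * eps * p ^+ b * n.
Proof.
move=> ba; rewrite ler_wpM2r //; apply: ler_pM.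
- exact: ltW.
- by rewrite exprn_ge0 // ltW.
- by rewrite ler_peMl ?(ltW eps0) // exprn_ege1 // ler1n.
- exact: pw_le.
Qed.

(** The removed vertex ranges over a whole set [S (l + i)] of order [c n], which survives [k - 1]
    factors [p] above [eps p^(k-1) n]. This frees the stronger exponent [2k-2] for the other side.
    Position [l + k + m] is first affected at step [i = m], when [thH] becomes a constant times
    [eps p^(2k-2) n]. *)
Lemma reverse_step i (c : R) : (i < k)%N ->
  dense G eps p (eps * p ^+ k.-1 * n) (eps * p ^+ (2 * k - 2) * n) ->
  4 ^+ (2 * k).+1 * eps <= c -> 0 < n -> c * n <= #|S (l + i)%N|%:R ->
  almost_all [::] (Lg i ++ Lh i) (reached S x (l + k)) ->
  almost_all [::] (Lg i.+1 ++ Lh i.+1) (reached S x (l + k)).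
Proof.
move=> ik dn Hc n0 Sc.
have -> : Lg i ++ Lh i = ((l + i)%N, S (l + i)%N, thG i i) ::
  ([seq ((l + j)%N, S (l + j)%N, thG i j) | j <- iota i.+1 (k - i.+1)] ++ Lh i).
  by rewrite /Lg -(subnSK ik).
set L := (X in _ :: X).
have Lsz : (size L <= 2 * k)%N.
  by rewrite size_cat !size_map size_rev !size_iota; clear; lia.
have nc : (nearc k (l + i) L <= k)%N by apply: nearc_step.
have eta0 : 0 <= eps * p ^+ (2 * k - 2) * n by rewrite !mulr_ge0 ?exprn_ge0 // ltW.
have ka0 : 0 < eps * p ^+ k.-1 * n by rewrite !mulr_gt0 // exprn_gt0.
move=> H.
have H2 : almost_all [::] (relax p k (eps * p ^+ k.-1 * n) (eps * p ^+ (2 * k - 2) * n) (l + i) L)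
    (reached S x (l + k)).
  apply: (almost_all_remove p0 eps4 p1 dn ka0 eta0 _ _ _ _ _ _ H).
  - exact: reached_eqi.
  - by move=> d h; apply: reached_drop; rewrite ltn_add2l.
  - move=> q E th; rewrite mem_cat => /orP[] /mapP[j].
      rewrite mem_iota => ij [_ -> _]; apply: Sdis.
      by move: ij; clear; lia.
    rewrite mem_rev mem_iota => jk [_ -> _]; apply: Sdis.
    by move: jk ik; clear; lia.
  - by [].
  - apply: (@le_trans _ _ (c * n / 2)); last by rewrite ler_wpM2r // invr_ge0.
    rewrite /thG subnn expr0 mulr1 [leRHS]mulrAC ler_wpM2r //.
    rewrite ler_pdivlMr //; apply: le_trans Hc.
    rewrite mulrAC ler_wpM2r ?(ltW eps0) //.
    apply: (@le_trans _ _ (4 ^+ (k + i) * 4)); first by rewrite ler_wpM2l ?exprn_ge0 // ler_nat.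
    rewrite -exprSr ler_weXn2l ?ler1n //; move: ik; clear; lia.
  apply: (@le_trans _ _ (#|S (l + i)%N|%:R / 2 * p ^+ k)); last first.
    by rewrite ler_wpM2l ?divr_ge0 //; apply: pw_le.
  apply: (@le_trans _ _ (c * n / 2 * p ^+ k)); last first.
    by rewrite ler_wpM2r ?exprn_ge0 ?(ltW p0) // ler_wpM2r // invr_ge0.
  have -> : eps * p ^+ k.-1 * n * 2 ^+ size L * p = (2 * 2 ^+ size L * eps) * (p ^+ k.-1.+1 * n / 2).
    by rewrite exprS; field.
  rewrite (ltn_predK k2).
  have -> : c * n / 2 * p ^+ k = c * (p ^+ k * n / 2) by ring.
  rewrite ler_wpM2r ?divr_ge0 ?mulr_ge0 ?exprn_ge0 ?(ltW p0) //.
  apply: le_trans Hc; rewrite ler_wpM2r ?(ltW eps0) // -exprS.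
  apply: (@le_trans _ _ (2 ^+ (2 * k).+1)); first by rewrite ler_weXn2l ?ler1n // ltnS.
  by rewrite lerXn2r ?nnegrE // ler_nat.
move: H2; rewrite /relax /L map_cat -!map_comp; apply: almost_all_le.
apply: all2_map_cat.
  apply/allP => j; rewrite mem_iota => ij /=; rewrite !eqxx /=.
  have -> : near k (l + i) (l + j) by rewrite /near; move: ij ik; clear; lia.
  have E : (j - i = (j - i.+1).+1)%N by move: ij; clear; lia.
  rewrite ge_max; apply/andP; split; last by apply: fourS; move: ij ik; clear; lia.
  by rewrite ler_pdivrMr // /thG E addnS !exprS; lra.
rewrite -[X in all2 _ X _]cats0 -[X in all2 _ _ X]cats0; apply: all2_map_cat => //.
apply/allP => m; rewrite mem_rev mem_iota => mk /=; rewrite !eqxx /=.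
have E : (2 * k - 1 + m - i = (2 * k - 1 + m - i.+1).+1)%N by move: mk ik; clear; lia.
case: ifP => nm.
  rewrite ge_max; apply/andP; split.
    by rewrite ler_pdivrMr // /thH E !exprS; lra.
  by apply: fourS; move: nm mk ik; rewrite /near; clear; lia.
apply: (@le_trans _ _ (4 * thH i m)).
  by rewrite ler_wpM2r ?thH_ge0 // ler_nat.
rewrite /thH exprS !mulrA ler_wpM2r // ler_wpM2l //.
  by rewrite !mulr_ge0 ?exprn_ge0 // ltW.
by apply: pw_le; clear; lia.
Qed.

(** The list is reversed: the position farthest from [x] is chosen first, as in a search from the
    opposite end. *)
Definition reversed_reach :=
  almost_all [::] [seq ((l + k + m)%N, S (l + k + m)%N, 4 ^+ k * eps * p ^+ (k - 1 + m) * n)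
          | m <- rev (iota 0 k)] (reached S x (l + k)).

Lemma reverse_reach (c : R) :
  dense G eps p (eps * p ^+ k.-1 * n) (eps * p ^+ (2 * k - 2) * n) ->
  4 ^+ (2 * k).+1 * eps <= c -> 0 < n ->
  (forall q, (q < k)%N -> c * n <= #|S (l + q)%N|%:R) ->
  generic_reach G eps p k t0 S x l -> reversed_reach.
Proof.
move=> dn Hc n0 Sc H.
have H0 : almost_all [::] (Lg 0 ++ Lh 0) (reached S x (l + k)).
  rewrite /Lg subn0.
  have -> : [seq ((l + j)%N, S (l + j)%N, thG 0 j) | j <- iota 0 k] =
     [seq ((l + j)%N, S (l + j)%N, 4 ^+ k * eps * p ^+ j * n) | j <- iota 0 k].
    by apply: eq_map => j; rewrite /thG addn0 subn0.
  apply: almost_all_cat; move/almost_all_coh : H => /(_ (@coh_nil _ _ _)); apply: almost_all_impl => h [ch Hr].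
  apply: almost_all_all => //.
    by move=> q E th /mapP[m _ [_ _ ->]]; apply: thH_ge0.
  move=> h' hh ch' H'; apply: reached_steps => //; first by move: k2; clear; lia.
    case: Hr => w [s [sw ss Hp Hw Hs]]; exists w, s; split => // j /Hs [? jh].
    by split => //; apply: hh.
  move=> j jk; apply: (H' (l + k + j)%N (S (l + k + j)%N) (thH 0 j)).
  by apply/mapP; exists j; rewrite // mem_rev mem_iota.
have Hi i : (i <= k)%N -> almost_all [::] (Lg i ++ Lh i) (reached S x (l + k)).
  elim: i => [//|i IH] ik; apply: (reverse_step ik dn Hc n0 (Sc i ik)).
  by apply: IH; apply: ltnW.
have := Hi k (leqnn k); rewrite /Lg subnn /= /reversed_reach /Lh.
congr (almost_all _ _ _); apply: eq_map => m; rewrite /thH; do 4 f_equal.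
by move: k2; clear; lia.
Qed.

End Reverse.

Lemma avoid (R : realFieldType) (T : finType) (A : {set T}) (Bs : seq {set T}) (b : R) :
  (forall B, B \in Bs -> #|B|%:R <= b) -> (size Bs)%:R * b < #|A|%:R ->
  exists2 z, z \in A & forall B, B \in Bs -> z \notin B.
Proof.
elim: Bs A => [|B Bs IH] A /= H.
  by rewrite mul0r ltr0n => /card_gt0P[z zA]; exists z.
rewrite -natr1 mulrDl mul1r => HA.
have [||z] := IH (A :\: B).
- by move=> B' HB'; apply: H; rewrite inE HB' orbT.
- have := card_rem R A B; have := H B (mem_head _ _); move: HA; lra.
rewrite inE => /andP[zB zA] Hz; exists z => // B'.
by rewrite inE => /orP[/eqP -> //|]; apply: Hz.
Qed.

(** * Connecting two ends *)

Section Connect.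
Variables (R : realFieldType) (T : finType) (G : sgraph T) (eps p : R).
Variables (k : nat) (t0 : T).
Local Notation n := (#|T|%:R : R).
Local Notation almost_all := (@almost_all R T G k).
Local Notation reached := (reached G k t0).

Hypotheses (p0 : 0 < p) (p1 : p <= 1) (eps0 : 0 < eps) (eps4 : eps <= 1 / 4).
Hypotheses (k2 : (2 <= k)%N) (n0 : 0 < n).
Hypothesis fa : few_atypical G eps p (1 / 2) k.-1.

Let pw_le a b : (b <= a)%N -> p ^+ a <= p ^+ b.
Proof. by move=> ba; rewrite ler_wiXn2l // ltW. Qed.

(** A vertex outside both exceptional sets serves both searches at once. Avoiding the atypical
    vertices as well keeps a fraction [p / 2] of each later candidate set inside the common
    neighbourhood [cN G vs], so that any vertex picked there is compatible with both histories. *)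
Lemma common_choice (c : R) (q1 q2 : nat -> nat) (E : nat -> {set T}) P1 P2 :
  4 ^+ (2 * k).+1 * eps <= c ->
  forall m t h1 h2 vs, (t + m = k)%N ->
  {in h1, forall a, a.2 \in vs} -> {in h2, forall a, a.2 \in vs} ->
  (forall j, (t <= j < k)%N -> c * (p / 2) ^+ t * n <= #|cN G vs :&: E j|%:R) ->
  almost_all h1 [seq (q1 j, E j, 4 ^+ k * eps * p ^+ j * n) | j <- iota t m] P1 ->
  almost_all h2 [seq (q2 j, E j, 4 ^+ k * eps * p ^+ j * n) | j <- iota t m] P2 ->
  exists f : nat -> T,
    P1 (rev [seq (q1 j, f j) | j <- iota t m] ++ h1) /\
    P2 (rev [seq (q2 j, f j) | j <- iota t m] ++ h2).
Proof.
move=> Hc; elim=> [|m IH] t h1 h2 vs tm hv1 hv2 HE /=; first by exists (fun _ => t0).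
move=> [B1 cB1 H1] [B2 cB2 H2].
pose Bs := B1 :: B2 :: [seq atyp G p (cN G vs :&: E j) | j <- iota t.+1 m].
have tk : (t < k)%N by lia.
have e4 : 0 < 4 ^+ k * eps by rewrite mulr_gt0 // exprn_gt0.
have Hc' : (k.+1)%:R * (4 ^+ k * eps) * 2 ^+ t < c.
  apply: lt_le_trans Hc.
  apply: (@le_lt_trans _ _ (4 ^+ (2 * k) * eps)); last first.
    by rewrite ltr_pM2r // ltr_eXn2l // ltr1n.
  have -> : k.+1%:R * (4 ^+ k * eps) * 2 ^+ t = (k.+1%:R * 2 ^+ t) * (4 ^+ k * eps) by ring.
  rewrite mul2n -addnn exprD -[leRHS]mulrA ler_wpM2r ?(ltW e4) //.
  apply: (@le_trans _ _ (2 ^+ k * 2 ^+ k)).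
    apply: ler_pM; rewrite ?exprn_ge0 //.
      by rewrite -natrX ler_nat; apply: ltn_expl.
    by rewrite ler_weXn2l ?ler1n // ltnW.
  by rewrite -exprMn; have -> : 2 * 2 = 4 :> R by ring.
have pt0 : 0 < p ^+ t * n by rewrite mulr_gt0 // exprn_gt0.
have E2 : c * (p / 2) ^+ t * n = c / 2 ^+ t * (p ^+ t * n).
  by rewrite expr_div_n; ring.
have [||z] := @avoid R T (cN G vs :&: E t) Bs (4 ^+ k * eps * p ^+ t * n).
- move=> B; rewrite !inE => /orP[/eqP -> //|/orP[/eqP -> //|/mapP[j]]].
  rewrite mem_iota => tj ->.
  apply: (@le_trans _ _ (eps * p ^+ k.-1.+1 * n)).
    apply: (atyp_le fa); apply: le_trans (HE j _); last by move: tj tm; clear; lia.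
    rewrite E2; apply: (@le_trans _ _ (20 * eps * (p ^+ t * n))).
      rewrite -!mulrA !ler_wpM2l ?(ltW eps0) // ler_wpM2r //; apply: pw_le.
      by move: tk; clear; lia.
    rewrite ler_wpM2r ?(ltW pt0) // ler_pdivlMr ?exprn_gt0 //; apply: le_trans (ltW Hc').
    rewrite ler_wpM2r ?exprn_ge0 // mulrA ler_wpM2r ?(ltW eps0) //.
    have h16 : 16 <= 4 ^+ k :> R.
      by rewrite (_ : 16 = 4 ^+ 2); [rewrite ler_weXn2l ?ler1n|rewrite -natrX].
    have h3 : 3 <= k.+1%:R :> R by rewrite ler_nat.
    by have := ler_pM _ _ h3 h16; rewrite !ler0n => /(_ isT isT); lra.
  rewrite (ltn_predK k2) ler_wpM2r //; apply: ler_pM; rewrite ?(ltW eps0) ?exprn_ge0 ?(ltW p0) //.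
    by rewrite ler_peMl ?(ltW eps0) // exprn_ege1 // ler1n.
  by apply: pw_le; apply: ltnW.
- apply: lt_le_trans (HE t _); last by rewrite leqnn.
  rewrite E2 /= size_map size_iota.
  have -> : m.+2%:R * (4 ^+ k * eps * p ^+ t * n) = m.+2%:R * (4 ^+ k * eps) * (p ^+ t * n) by ring.
  rewrite ltr_pM2r // ltr_pdivlMr ?exprn_gt0 //; apply: le_lt_trans Hc'.
  rewrite ler_wpM2r ?exprn_ge0 // ler_wpM2r ?(ltW e4) // ler_nat.
  by move: tm; clear; lia.
rewrite inE => /andP[zvs zE] zB.
have comp h q : {in h, forall a, a.2 \in vs} -> compat G k h q z.
  move=> hv; apply/compatP => a /hv av _; move: zvs; rewrite inE => /allP; exact.
have H1' := H1 z zE (zB _ (mem_head _ _)) (comp _ _ hv1).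
have B2s : B2 \in Bs by rewrite !inE eqxx orbT.
have H2' := H2 z zE (zB _ B2s) (comp _ _ hv2).
have [||||f [Hf1 Hf2]] := IH t.+1 _ _ (z :: vs) _ _ _ _ H1' H2'.
- by rewrite addSn -addnS.
- by move=> a; rewrite !inE => /orP[/eqP -> /=|/hv1 ->]; rewrite ?eqxx ?orbT.
- by move=> a; rewrite !inE => /orP[/eqP -> /=|/hv2 ->]; rewrite ?eqxx ?orbT.
- move=> j tj; rewrite cN_cons -setIA.
  have : z \notin atyp G p (cN G vs :&: E j).
    apply: zB; rewrite !inE; apply/orP; right; apply/orP; right.
    by apply/mapP; exists j; rewrite // mem_iota; move: tj tm; clear; lia.
  move/natypP; apply: le_trans.
  have -> : c * (p / 2) ^+ t.+1 * n = p / 2 * (c * (p / 2) ^+ t * n) by rewrite exprS; ring.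
  by rewrite ler_wpM2l ?divr_ge0 ?(ltW p0) //; apply: HE; move: tj; clear; lia.
exists (fun j => if j == t then z else f j); rewrite eqxx !rev_cons !cat_rcons.
have E' (q : nat -> nat) : [seq (q j, if j == t then z else f j) | j <- iota t.+1 m] =
    [seq (q j, f j) | j <- iota t.+1 m].
  apply/eq_in_map => j; rewrite mem_iota => tj.
  by have -> : (j == t) = false by move: tj; clear; lia.
by rewrite !E'.
Qed.

Hypothesis d1 : dense G eps p (eps * p ^+ (2 * k - 2) * n) (eps * p ^+ k.-1 * n).
Hypothesis d2 : (2 < k)%N ->
  dense G eps p (eps * p ^+ (2 * k - 1) * n) (eps * p ^+ k.-1 * n).

(** The number of positions before the first generic window: four vertices of [fork] and two more
    when [k = 2], and one window otherwise. *)
Definition ell := if k == 2%N then 6%N else k.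

Lemma reach (c : R) (S : nat -> {set T}) x :
  4 ^+ k.+3 * eps <= c ^+ 2 -> 0 < c -> c <= 1 ->
  (forall i j, i != j -> [disjoint S i & S j]) ->
  size x = k -> pw G k x ->
  (forall q, (q < ell)%N -> rich G p k c (rev x) (S q)) ->
  generic_reach G eps p k t0 S x ell.
Proof.
move=> Hc c0 c1 Sdis sx px; rewrite /ell; case: eqP => [E|/eqP kn2] HS.
  rewrite E in sx px HS *; apply: (@reach2 _ _ _ _ _ _ p0 p1 eps0 eps4 c) => //.
    by have := d1; rewrite E /= expr1.
    by have := fa; rewrite E.
  apply: le_trans Hc; rewrite E; rewrite ler_wpM2r ?(ltW eps0) //.
  by rewrite -natrX ler_nat.
have k3 : (2 < k)%N by rewrite ltn_neqAle eq_sym kn2.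
apply: (@reach3 _ _ _ _ _ _ _ p0 p1 eps0 eps4 k2 c) => //; first exact: d2.
apply: (@le_trans _ _ (c ^+ 2)); last by rewrite expr2 ler_piMl // ltW.
apply: le_trans Hc; rewrite ler_wpM2r ?(ltW eps0) //.
by rewrite ler_weXn2l ?ler1n //; apply/leqW/leqW.
Qed.

(** Only one of the two searches is reversed, at the cost of one further window: [ell + k] vertices
    come from its side, then the shared window of [k], then [ell] from the other side. *)
Definition mlen := (2 * ell + 2 * k)%N.

Lemma rev_mkseq A (f : nat -> A) m : rev (mkseq f m) = mkseq (fun j => f (m - j.+1)%N) m.
Proof.
apply: (@eq_from_nth _ (f 0%N)); rewrite size_rev !size_mkseq // => i im.
by rewrite nth_rev size_mkseq // !nth_mkseq //; move: im; clear; lia.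
Qed.

(** The searches number the positions from opposite ends, so the shared window is [s] for one and
    [rev s] for the other. It has [k] vertices, which is enough to glue. *)
Lemma join_reached (S S' : nat -> {set T}) x y l (f : nat -> T) : size x = k -> size y = k ->
  (forall q, (q < 2 * l + 2 * k)%N -> S' q = S (2 * l + 2 * k - q.+1)%N) ->
  reached S x (l + k) (rev [seq ((2 * l + 2 * k - (l + j).+1)%N, f j) | j <- iota 0 k] ++ [::]) ->
  reached S' (rev y) l (rev [seq ((l + j)%N, f j) | j <- iota 0 k] ++ [::]) ->
  exists z, [/\ size z = (2 * l + 2 * k)%N, pw G k (x ++ z ++ y) &
    forall q, (q < 2 * l + 2 * k)%N -> nth t0 z q \in S q].
Proof.
move=> sx sy SS [w [s [sw ss pws Hw Hs]]] [w' [s' [sw' ss' pws' Hw' Hs']]].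
have sf j : (j < k)%N -> nth t0 s j = f (k - j.+1)%N.
  move=> jk; have [_] := Hs j jk; rewrite cats0 mem_rev => /mapP[i].
  by rewrite mem_iota => ik [E ->]; congr f; move: ik jk E; clear; lia.
have sf' j : (j < k)%N -> nth t0 s' j = f j.
  move=> jk; have [_] := Hs' j jk; rewrite cats0 mem_rev => /mapP[i].
  by rewrite mem_iota => ik [E ->]; congr f; move: ik jk E; clear; lia.
have E : s' = rev s.
  apply: (@eq_from_nth _ t0); first by rewrite size_rev ss ss'.
  rewrite ss' => j jk.
  rewrite nth_rev ?ss // sf' // sf; last by move: jk; clear; lia.
  by congr f; move: jk; clear; lia.
exists (w ++ s ++ rev w'); split.
- by rewrite !size_cat size_rev sw ss sw'; clear; lia.
- rewrite -!catA (catA x); apply: pw_glue; rewrite ?ss //; first by rewrite -catA.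
  by have := pw_rev (adj_sym G) pws'; rewrite !rev_cat revK E revK -catA.
move=> q qM; rewrite nth_cat sw; case: ltnP => q1; first exact: Hw.
rewrite nth_cat ss; case: ltnP => q2.
  by have [+ _] := Hs _ q2; rewrite subnKC.
rewrite nth_rev sw'; last by move: q1 q2 qM; clear; lia.
have := Hw' (l - (q - (l + k) - k).+1)%N; rewrite SS; last by move: q1 q2 qM; clear; lia.
have -> : (2 * l + 2 * k - (l - (q - (l + k) - k).+1).+1 = q)%N by move: q1 q2 qM; clear; lia.
by apply; move: q1 q2 qM; clear; lia.
Qed.

(** Forward searches from both ends choose the shared window in opposite orders; reversing the
    search from [x] makes the orders agree, so that [common_choice] applies. *)
Lemma connect (c : R) (S : nat -> {set T}) x y :
  4 ^+ (2 * k + 3) * eps <= c ^+ 2 -> 0 < c -> c <= 1 ->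
  (forall i j, (i < mlen)%N -> (j < mlen)%N -> i != j -> [disjoint S i & S j]) ->
  size x = k -> size y = k -> pw G k x -> pw G k y ->
  (forall q, (q < mlen)%N -> rich G p k c (rev x) (S q)) ->
  (forall q, (q < mlen)%N -> rich G p k c y (S q)) ->
  exists z, [/\ size z = mlen, pw G k (x ++ z ++ y) &
    forall q, (q < mlen)%N -> nth t0 z q \in S q].
Proof.
move=> Hc c0 c1 Sdis sx sy px py Sx Sy.
have Hc1 : 4 ^+ k.+3 * eps <= c ^+ 2.
  apply: le_trans Hc; rewrite ler_wpM2r ?(ltW eps0) // ler_weXn2l ?ler1n //.
  by move: k2; clear; lia.
have Hc2 : 4 ^+ (2 * k).+1 * eps <= c.
  apply: (@le_trans _ _ (c ^+ 2)); last by rewrite expr2 ler_piMl // ltW.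
  apply: le_trans Hc; rewrite ler_wpM2r ?(ltW eps0) // ler_weXn2l ?ler1n //.
  by clear; lia.
have Scard q : (q < mlen)%N -> c * n <= #|S q|%:R.
  by move/Sx/(_ 0%N isT); rewrite take0 cN_nil setTI expr0 mulr1.
(* Padding with empty sets makes disjointness hold for all indices, as the lemmas on single searches
   require. *)
pose S1 q := if (q < mlen)%N then S q else set0.
pose S2 q := if (q < mlen)%N then S (mlen - q.+1)%N else set0.
have S1dis i j : i != j -> [disjoint S1 i & S1 j].
  rewrite /S1 => ij; case: ifP => im; last by rewrite -setI_eq0 set0I.
  by case: ifP => jm; [apply: Sdis|rewrite -setI_eq0 setI0].
have S2dis i j : i != j -> [disjoint S2 i & S2 j].
  rewrite /S2 => ij; case: ifP => im; last by rewrite -setI_eq0 set0I.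
  case: ifP => jm; last by rewrite -setI_eq0 setI0.
  by apply: Sdis; move: ij im jm; clear; lia.
have em : (ell + 2 * k <= mlen)%N by rewrite /mlen; clear; lia.
have R1 : generic_reach G eps p k t0 S1 x ell.
  apply: (reach Hc1) => // q ql; rewrite /S1.
  have qm : (q < mlen)%N by move: em ql; clear; lia.
  by rewrite qm; apply: Sx.
have R2 : generic_reach G eps p k t0 S2 (rev y) ell.
  apply: (reach Hc1) => //; rewrite ?size_rev //; first exact: (pw_rev (adj_sym G)).
  move=> q ql; rewrite /S2 revK.
  have qm : (q < mlen)%N by move: em ql; clear; lia.
  by rewrite qm; apply: Sy; move: qm; clear; lia.
have R3 : reversed_reach G eps p k t0 S1 x ell.
  apply: (reverse_reach p0 p1 eps0 eps4 k2 S1dis (dense_sym d1) Hc2 n0) => // q qk.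
  have qm : (ell + q < mlen)%N by move: em qk; clear; lia.
  by rewrite /S1 qm; apply: Scard.
pose E j := S2 (ell + j)%N.
have mE : mlen = (2 * ell + 2 * k)%N by [].
have R1' : almost_all [::] [seq ((2 * ell + 2 * k - (ell + j).+1)%N, E j, 4 ^+ k * eps * p ^+ j * n) | j <- iota 0 k]
    (reached S1 x (ell + k)).
  move: R3; rewrite /reversed_reach.
  have -> : rev (iota 0 k) = [seq (k - j.+1)%N | j <- iota 0 k].
    by have := rev_mkseq id k; rewrite /mkseq map_id.
  rewrite -map_comp.
  have -> : [seq ((2 * ell + 2 * k - (ell + j).+1)%N, E j, 4 ^+ k * eps * p ^+ j * n) | j <- iota 0 k]
     = [seq ((ell + k + (k - j.+1))%N, S1 (ell + k + (k - j.+1))%N, 4 ^+ k * eps * p ^+ j * n) | j <- iota 0 k].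
    apply/eq_in_map => j; rewrite mem_iota => jk.
    have -> : (2 * ell + 2 * k - (ell + j).+1 = ell + k + (k - j.+1))%N by move: jk; clear; lia.
    congr (_, _, _); rewrite /E /S1 /S2.
    have -> : (ell + j < mlen)%N by move: em jk; clear; lia.
    have -> : (ell + k + (k - j.+1) < mlen)%N by move: em jk; clear; lia.
    by congr S; rewrite mE; move: jk; clear; lia.
  apply: almost_all_le_map => j; rewrite mem_iota => jk.
  rewrite ler_wpM2r // ler_wpM2l //; first by rewrite mulr_ge0 ?exprn_ge0 // ltW.
  by apply: pw_le; move: jk; clear; lia.
have nilv : {in [::] : seq (nat * T), forall a : nat * T, a.2 \in ([::] : seq T)} by [].
have HE j : (0 <= j < k)%N -> c * (p / 2) ^+ 0 * n <= #|cN G [::] :&: E j|%:R.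
  move=> jk; rewrite cN_nil setTI expr0 mulr1 /E /S2.
  have -> : (ell + j < mlen)%N by move: em jk; clear; lia.
  by apply: Scard; rewrite mE; move: jk; clear; lia.
have [f [F1 F2]] := @common_choice c (fun j => 2 * ell + 2 * k - (ell + j).+1)%N (fun j => ell + j)%N E
  _ _ Hc2 k 0%N [::] [::] [::] (add0n k) nilv nilv HE R1' R2.
have := join_reached sx sy _ F1 F2; rewrite -mE.
have SS q : (q < mlen)%N -> S2 q = S1 (mlen - q.+1)%N.
  by move=> qm; rewrite /S1 /S2 qm; have -> : (mlen - q.+1 < mlen)%N by move: qm; clear; lia.
case/(_ SS) => z [sz pz Hz]; exists z; split => // q qm.
by have := Hz q qm; rewrite /S1 qm.
Qed.

End Connect.

(** * Absorbers *)

Section Greedy.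
Variables (R : realFieldType) (T : finType) (G : sgraph T) (eps p : R).
Variables (k : nat).
Local Notation n := (#|T|%:R : R).

Hypotheses (p0 : 0 < p) (p1 : p <= 1) (eps0 : 0 < eps) (n0 : 0 < n).
Hypothesis k2 : (2 <= k)%N.

Let pw_le a b : (b <= a)%N -> p ^+ a <= p ^+ b.
Proof. by move=> ba; rewrite ler_wiXn2l // ltW. Qed.

Let ph0 : 0 <= p / 2. Proof. by rewrite divr_ge0 // ltW. Qed.
Let ph1 : p / 2 <= 1. Proof. by move: p1 p0; lra. Qed.

(** The factors account for the number of sets to be avoided, the vertices already used (in units of
    [eps p^(d+1) n], at least [1 / 4]), the halving of [p] at most [d] times, and the [20] of
    [atyp_le]. *)
Definition greedy_const (d m f : nat) : nat :=
  ((1 + d + k * f) * (4 * m.+1) * 2 ^ d * 20)%N.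

(** [Y] lies in a neighbourhood and so has order [p n], unlike the sets of [fam]. Vertices are added
    at the front; the condition on every suffix [drop i w] makes both ends of the result rich, as
    [infix_rich] extracts. *)
Definition greedy_inv (c : R) d (Y : {set T}) (fam : seq {set T}) (w : seq T) :=
  [/\ uniq w, {subset w <= Y}, pw G d w,
    forall l, (l <= d)%N -> c * (p / 2) ^+ l * (p * n) <= #|cN G (take l w) :&: Y|%:R &
    forall S, S \in fam -> forall i l, (l <= k)%N ->
      c * (p / 2) ^+ l * n <= #|cN G (take l (drop i w)) :&: S|%:R].

Lemma cN_takeS v (w : seq T) l (Y : {set T}) :
  cN G (take l.+1 (v :: w)) :&: Y = nb G v :&: (cN G (take l w) :&: Y).
Proof. by rewrite /= cN_cons setIA. Qed.

Lemma half_step (c : R) l (v : T) (X : {set T}) (q : R) :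
  v \notin atyp G p X -> c * (p / 2) ^+ l * q <= #|X|%:R ->
  c * (p / 2) ^+ l.+1 * q <= #|nb G v :&: X|%:R.
Proof.
move/natypP => H HX; apply: le_trans H.
have -> : c * (p / 2) ^+ l.+1 * q = p / 2 * (c * (p / 2) ^+ l * q) by rewrite exprS; ring.
by rewrite ler_wpM2l.
Qed.

(** The next vertex comes from about [p^(d+1) n] candidates in [Y], and each exceptional set has at
    most [eps p^(d+1) n] vertices. The used vertices count as one more set of this order. *)
Lemma greedy_step (c : R) d m (Y : {set T}) (fam : seq {set T}) w :
  few_atypical G eps p (1 / 2) d -> (k.-1 <= d)%N ->
  1 <= 4 * (eps * p ^+ d.+1 * n) ->
  (greedy_const d m (size fam))%:R * eps <= c -> (size w <= m)%N ->
  greedy_inv c d Y fam w -> exists v, greedy_inv c d Y fam (v :: w).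
Proof.
move=> fa kd H3 Hc wm [uw wY pww HY Hf].
pose Bs := [set x in w] :: [seq atyp G p (cN G (take l w) :&: Y) | l <- iota 0 d] ++
  [seq atyp G p (cN G (take l w) :&: X) | X <- fam, l <- iota 0 k].
have sBs : size Bs = (1 + d + k * size fam)%N.
  by rewrite /= size_cat size_map size_iota size_allpairs size_iota mulnC add1n addSn.
have c0 : 0 < c.
  by apply: lt_le_trans Hc; rewrite mulr_gt0 // ltr0n /greedy_const !muln_gt0 expn_gt0.
have c20 l : (l <= d)%N -> 20 * eps * 2 ^+ l <= c.
  move=> ld; apply: le_trans Hc; rewrite mulrAC ler_wpM2r ?(ltW eps0) //.
  rewrite -natrX -natrM ler_nat /greedy_const [leqRHS]mulnC leq_mul2l /=.
  apply: (@leq_trans (2 ^ d)); first by rewrite leq_exp2l.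
  by rewrite leq_pmull // muln_gt0 /=.
have small l : (l < d.+1)%N -> forall X : {set T}, c * (p / 2) ^+ l * n <= #|X|%:R ->
    #|atyp G p X|%:R <= eps * p ^+ d.+1 * n.
  move=> ld X HX; apply: (atyp_le fa); apply: le_trans HX.
  rewrite mulrA ler_wpM2r // expr_div_n.
  have -> : c * (p ^+ l / 2 ^+ l) = c / 2 ^+ l * p ^+ l by ring.
  rewrite mulrA; apply: ler_pM; rewrite ?exprn_ge0 ?mulr_ge0 ?(ltW p0) ?(ltW eps0) //.
    by rewrite ler_pdivlMr ?exprn_gt0 //; apply: c20.
  exact: pw_le.
have en0 : 0 < eps * p ^+ d.+1 * n by rewrite !mulr_gt0 // exprn_gt0.
have [||v] := @avoid R T (cN G (take d w) :&: Y) Bs ((4 * m.+1)%:R * (eps * p ^+ d.+1 * n)).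
- move=> B; rewrite inE mem_cat => /orP[/eqP -> |].
    apply: (@le_trans _ _ m%:R).
      by rewrite ler_nat cardsE; apply: leq_trans (card_size _) wm.
    rewrite natrM mulrAC; apply: (@le_trans _ _ (1 * m.+1%:R)).
      by rewrite mul1r ler_nat.
    by rewrite ler_wpM2r.
  move=> HB; apply: (@le_trans _ _ (eps * p ^+ d.+1 * n)); last first.
    by rewrite ler_peMl ?(ltW en0) // ler1n.
  case/orP: HB => [/mapP[l]|/allpairsP[[S l] /= [SF]]].
    rewrite mem_iota add0n => /andP[_ ld] ->; apply: (small l.+1 ld).
    apply: le_trans (HY l (ltnW ld)).
    have -> : c * (p / 2) ^+ l.+1 * n = c * (p / 2) ^+ l * (p / 2 * n) by rewrite exprS; ring.
    rewrite ler_wpM2l ?mulr_ge0 ?exprn_ge0 ?(ltW c0) //.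
    have : 0 <= p * n by rewrite mulr_ge0 // ltW.
    by lra.
  rewrite mem_iota add0n => /andP[_ lk] ->; apply: (small l).
    by move: lk kd; clear; lia.
  by have := Hf S SF 0%N l (ltnW lk); rewrite drop0.
- apply: lt_le_trans (HY d (leqnn d)).
  have -> : c * (p / 2) ^+ d * (p * n) = c / 2 ^+ d * (p ^+ d.+1 * n).
    by rewrite expr_div_n exprS; ring.
  have -> : (size Bs)%:R * ((4 * m.+1)%:R * (eps * p ^+ d.+1 * n)) =
     ((size Bs * (4 * m.+1))%N%:R * eps) * (p ^+ d.+1 * n) by rewrite [in RHS]natrM; ring.
  rewrite ltr_pM2r ?mulr_gt0 ?exprn_gt0 // ltr_pdivlMr ?exprn_gt0 //.
  apply: lt_le_trans Hc; rewrite mulrAC ltr_pM2r // -natrX -natrM ltr_nat sBs.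
  rewrite /greedy_const -[ltnLHS]muln1 ltn_pmul2l //.
  by rewrite !muln_gt0 expn_gt0.
rewrite inE => /andP[vc vY] vB; exists v.
have vw : v \notin w by have := vB _ (mem_head _ _); rewrite inE.
split.
- by rewrite /= vw.
- by move=> y; rewrite inE => /orP[/eqP ->|/wY].
- rewrite /= pww andbT; apply/allP => y yw; rewrite (adj_sym G).
  by move: vc; rewrite inE => /allP; apply.
- case=> [|l] ld.
    by have := HY 0%N isT; rewrite !take0.
  rewrite cN_takeS; apply: half_step; last exact: HY (ltnW ld).
  apply: vB; rewrite inE mem_cat; apply/orP; right; apply/orP; left.
  by apply/mapP; exists l; rewrite // mem_iota.
move=> S SF [|i] [|l] lk.
- by have := Hf S SF 0%N 0%N isT; rewrite !take0.
- rewrite drop0 cN_takeS; apply: half_step; last first.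
    by have := Hf S SF 0%N l (ltnW lk); rewrite drop0.
  apply: vB; rewrite inE mem_cat; apply/orP; right; apply/orP; right.
  by apply/allpairsP; exists (S, l); split; rewrite // mem_iota.
- exact: Hf S SF i 0%N lk.
- exact: Hf S SF i l.+1 lk.
Qed.

Lemma greedy (c : R) d m (Y : {set T}) (fam : seq {set T}) :
  few_atypical G eps p (1 / 2) d -> (k.-1 <= d)%N ->
  1 <= 4 * (eps * p ^+ d.+1 * n) ->
  (greedy_const d m (size fam))%:R * eps <= c ->
  c * (p * n) <= #|Y|%:R -> (forall S, S \in fam -> c * n <= #|S|%:R) ->
  exists w, size w = m /\ greedy_inv c d Y fam w.
Proof.
move=> fa kd H3 Hc HY HF.
have c0 : 0 < c.
  by apply: lt_le_trans Hc; rewrite mulr_gt0 // ltr0n /greedy_const !muln_gt0 expn_gt0.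
have H j : (j <= m)%N -> exists w, size w = j /\ greedy_inv c d Y fam w.
  elim: j => [_|j IH jm].
    exists [::]; split=> //; split=> // [l _|S SF i l _].
      rewrite cN_nil setTI; apply: le_trans HY.
      rewrite ler_wpM2r ?mulr_ge0 ?(ltW p0) // ler_piMr ?(ltW c0) //.
      by rewrite exprn_ile1.
    rewrite cN_nil setTI; apply: le_trans (HF S SF).
    by rewrite ler_wpM2r // ler_piMr ?(ltW c0) // exprn_ile1.
  have [w [sw Hw]] := IH (ltnW jm).
  have [|v Hv] := greedy_step fa kd H3 Hc _ Hw; first by rewrite sw ltnW.
  by exists (v :: w); rewrite /= sw.
exact: H.
Qed.

Lemma infix_rich (c : R) w S : 0 <= c ->
  (forall i l, (l <= k)%N -> c * (p / 2) ^+ l * n <= #|cN G (take l (drop i w)) :&: S|%:R) ->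
  rich G p k (c / 2 ^+ k) w S /\ ((k <= size w)%N -> rich G p k (c / 2 ^+ k) (rev w) S).
Proof.
move=> c0 Hf.
have H i l : (l <= k)%N -> c / 2 ^+ k * p ^+ l * n <= #|cN G (take l (drop i w)) :&: S|%:R.
  move=> lk; apply: le_trans (Hf i l lk); rewrite expr_div_n.
  have -> : c * (p ^+ l / 2 ^+ l) * n = c / 2 ^+ l * p ^+ l * n by ring.
  rewrite !ler_wpM2r ?exprn_ge0 ?(ltW p0) // ler_wpM2l // lef_pV2 ?posrE ?exprn_gt0 //.
  by rewrite ler_weXn2l ?ler1n.
split=> [l /(H 0%N)|kw l lk]; first by rewrite drop0.
have := H (size w - l)%N l lk; rewrite take_rev cN_rev take_oversize // size_drop.
by move: lk kw; clear; lia.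
Qed.

End Greedy.

(** * Absorbing paths *)

Section Absorbing.
Variables (T : finType) (G : sgraph T) (k : nat).
Implicit Types (A a z s : seq T) (D W : {set T}).

Definition lastk s := drop (size s - k) s.

(** Keeping the first and last [k] vertices lets [A'] replace [A] inside any longer path or
    cycle. *)
Definition absorbing A D :=
  [/\ uniq A, pw G k A, (k <= size A)%N, {in A, forall x, x \notin D} &
   forall W, W \subset D -> exists A', [/\ uniq A', pw G k A',
     A' =i [predU A & W], take k A' = take k A & lastk A' = lastk A]].

Lemma lastk_cat s a : (k <= size a)%N -> lastk (s ++ a) = lastk a.
Proof.
move=> ka; rewrite /lastk size_cat drop_cat ltnNge.
have -> : (size s <= size s + size a - k)%N by lia.
by congr (drop _ _); lia.
Qed.

Lemma size_takek A A' : (k <= size A)%N -> take k A' = take k A -> (k <= size A')%N.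
Proof.
by move=> kA /(congr1 size); rewrite (size_takel kA) size_take_min; lia.
Qed.

Lemma pw_join A z a : (k <= size A)%N -> (k <= size z)%N -> (k <= size a)%N ->
  pw G k A -> pw G k a -> pw G k (lastk A ++ z ++ take k a) -> pw G k (A ++ z ++ a).
Proof.
move=> kA kz ka pA pa pz.
have H1 : pw G k (A ++ z ++ take k a).
  rewrite -{1}(cat_take_drop (size A - k) A) -catA; apply: pw_glue => //.
    by rewrite size_drop subKn.
  by rewrite cat_take_drop.
rewrite -[X in _ ++ _ ++ X](cat_take_drop k a) catA.
apply: pw_glue; rewrite ?size_takel ?cat_take_drop //.
by rewrite -catA.
Qed.

(** A set [W] splits into its parts in [D] and in [Da], absorbed independently; the connection [z]
    remains valid because it only sees ends that do not change. *)
Lemma absorbing_cat A z a D Da : absorbing A D -> absorbing a Da ->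
  (k <= size z)%N -> pw G k (lastk A ++ z ++ take k a) -> uniq (A ++ z ++ a) ->
  {in A ++ z ++ a, forall x, x \notin D :|: Da} -> [disjoint D & Da] ->
  absorbing (A ++ z ++ a) (D :|: Da).
Proof.
move=> [uA pA kA AD HA] [ua pa ka aD Ha] kz pz uz nz dD; split => //.
- exact: pw_join.
- by rewrite size_cat; lia.
move=> W WD.
have [A' [uA' pA' eA' tA' lA']] := HA (W :&: D) (subsetIr _ _).
have [a' [ua' pa' ea' ta' la']] := Ha (W :&: Da) (subsetIr _ _).
have kA' := size_takek kA tA'; have ka' := size_takek ka ta'.
have nW x : x \in A ++ z ++ a -> x \notin W.
  by move/nz; apply: contra => /(subsetP WD).
exists (A' ++ z ++ a'); split.
- move: uz; rewrite !cat_uniq => /and3P[_ hA /and3P[uz ha _]].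
  rewrite uA' ua' uz /= andbT; apply/andP; split.
    apply: contra hA => /hasP[x xz]; rewrite /= eA' inE => /orP[xA|]; last first.
      rewrite inE => /andP[xW xD]; move: xz; rewrite mem_cat => /orP[xz|].
        by have := nW x; rewrite !mem_cat xz orbT => /(_ isT); rewrite xW.
      rewrite ea' !inE => /orP[xa|/andP[_ xDa]].
        by have := nW x; rewrite !mem_cat xa !orbT => /(_ isT); rewrite xW.
      by move/disjoint_setI0/setP: dD => /(_ x); rewrite !inE xD xDa.
    apply/hasP; exists x => //; move: xz; rewrite !mem_cat ea' => /orP[-> //|].
    rewrite !inE => /orP[-> |/andP[xW _]]; first by rewrite orbT.
    by have := nW x; rewrite mem_cat xA => /(_ isT); rewrite xW.
  apply: contra ha => /hasP[x]; rewrite ea' !inE => /orP[xa xz|/andP[xW _] xz].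
    by apply/hasP; exists x.
  by have := nW x; rewrite !mem_cat xz orbT => /(_ isT); rewrite xW.
- by apply: pw_join => //; rewrite ta' lA'.
- move=> x; rewrite !inE !mem_cat eA' ea' !inE -!orbA.
  have := subsetP WD x; rewrite inE.
  by case: (x \in A); case: (x \in z); case: (x \in a); case: (x \in W) => //=;
     case: (x \in D); case: (x \in Da) => //= /(_ isT).
- by rewrite !takel_cat.
rewrite catA lastk_cat // catA lastk_cat // la'.
Qed.

Lemma absorbing_pathP A : uniq A -> pw G k A -> (k <= size A)%N -> absorbing A set0.
Proof.
move=> uA pA kA; split => // [x _|W]; first by rewrite inE.
rewrite subset0 => /eqP ->; exists A; split => // x.
by rewrite !inE orbF.
Qed.

(** A [k.-1]-st power suffices: [v] moves vertices of different halves one step further apart, and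
    each half, having [k] vertices, is a clique. *)
Lemma absorbing_insert (k0 : (0 < k)%N) w v : size w = (2 * k)%N -> uniq w ->
  pw G k.-1 w -> all (G v) w ->
  let a := take k w ++ v :: drop k w in
  [/\ uniq a, pw G k a, take k a = take k w, lastk a = lastk w & a =i v :: w].
Proof.
move=> sw uw pw' vw a.
have vnw : v \notin w.
  by apply/negP => /(allP vw); rewrite (adj_irrefl G).
have st : size (take k w) = k by rewrite size_takel // sw; lia.
have sd : size (drop k w) = k by rewrite size_drop sw; lia.
split.
- by rewrite /a -cat1s uniq_catCA cat1s cons_uniq cat_take_drop vnw.
- rewrite -(prednK k0) /a -[in take _ _](prednK k0) -[in drop _ _](prednK k0).
  rewrite (prednK k0) -{1}(prednK k0).
  apply: pw_insert; rewrite ?cat_take_drop //; first exact: adj_sym.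
  + by apply: (@pw_clique _ _ k.-1); rewrite ?st ?prednK //; apply: pw_take.
  + by apply: (@pw_clique _ _ k.-1); rewrite ?sd ?prednK //; apply: pw_drop.
- by rewrite /a takel_cat ?st // take_oversize ?st.
- rewrite /a -cat_rcons lastk_cat ?sd // /lastk sd subnn drop0.
  by congr (drop _ _); rewrite sw; lia.
move=> x; rewrite /a mem_cat !inE -[in RHS](cat_take_drop k w) mem_cat.
by rewrite orbCA.
Qed.

End Absorbing.

(* What pseudorandomness provides; [ju_h] and [ju_h'] fail only when [G] is complete. *)
Record jumbled (R : realFieldType) (T : finType) (G : sgraph T) (eps p : R) (k : nat) : Prop := {
  ju_k2 : (2 <= k)%N;
  ju_p0 : 0 < p;
  ju_p1 : p <= 1;
  ju_eps0 : 0 < eps;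
  ju_eps4 : eps <= 1 / 4;
  ju_n0 : 0 < (#|T|%:R : R);
  ju_d1 : dense G eps p (eps * p ^+ (2 * k - 2) * #|T|%:R) (eps * p ^+ k.-1 * #|T|%:R);
  ju_d2 : (2 < k)%N ->
    dense G eps p (eps * p ^+ (2 * k - 1) * #|T|%:R) (eps * p ^+ k.-1 * #|T|%:R);
  ju_fa : few_atypical G eps p (1 / 2) k.-1;
  ju_fa' : (2 < k)%N -> few_atypical G eps p (1 / 2) k;
  ju_h : 1 <= 4 * (eps * p ^+ k * #|T|%:R);
  ju_h' : (2 < k)%N -> 1 <= 4 * (eps * p ^+ k.+1 * #|T|%:R)
}.

Section Pieces.
Variables (R : realFieldType) (T : finType) (G : sgraph T) (eps p : R).
Variables (k : nat) (t0 : T).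
Hypothesis J : jumbled G eps p k.
Local Notation n := (#|T|%:R : R).
Local Notation rich := (rich G p k).
Local Notation absorbing := (absorbing G k).
Local Notation M := (mlen k).

Let p0 := ju_p0 J. Let p1 := ju_p1 J. Let eps0 := ju_eps0 J. Let n0 := ju_n0 J.
Let k2 := ju_k2 J.

Lemma rich_take (c : R) s S : rich c (take k s) S <-> rich c s S.
Proof. by split=> H l lk; have := H l lk; rewrite take_takel. Qed.

Lemma rich_cat (c : R) s s' S : (k <= size s)%N -> rich c s S -> rich c (s ++ s') S.
Proof. by move=> ks H; apply/rich_take; rewrite takel_cat //; apply/rich_take. Qed.

Lemma rich_rev_lastk (c : R) s S : rich c (rev (lastk k s)) S <-> rich c (rev s) S.
Proof. by rewrite /lastk -take_rev rich_take. Qed.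

Lemma rich_le (c c' : R) s S : c' <= c -> rich c s S -> rich c' s S.
Proof.
move=> cc H l lk; apply: le_trans (H l lk).
by rewrite !ler_wpM2r ?exprn_ge0 // ltW.
Qed.

Lemma rich_loss (c : R) s (S S' : {set T}) : 0 <= c -> #|S :\: S'|%:R <= c / 2 * p ^+ k * n ->
  rich c s S -> rich (c / 2) s S'.
Proof.
move=> c0 HS H l lk; have := H l lk; set N := cN G _ => HN.
have : #|N :&: S|%:R <= #|N :&: S'|%:R + #|S :\: S'|%:R :> R.
  rewrite -natrD ler_nat -(cardsID S' (N :&: S)); apply: leq_add.
    apply: subset_leq_card; apply/subsetP => x; rewrite !inE.
    by move=> /andP[/andP[-> _] ->].
  apply: subset_leq_card; apply/subsetP => x; rewrite !inE.
  by move=> /andP[-> /andP[_ ->]].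
have pk : c / 2 * p ^+ k * n <= c / 2 * p ^+ l * n.
  rewrite ler_wpM2r // ler_wpM2l ?divr_ge0 //.
  by rewrite ler_wiXn2l // ltW.
by move: HS HN pk; lra.
Qed.

Lemma mlen_ge : (k <= M)%N. Proof. by rewrite /mlen; lia. Qed.

Lemma uniq_parts (S : nat -> {set T}) z :
  (forall i j, (i < size z)%N -> (j < size z)%N -> i != j -> [disjoint S i & S j]) ->
  (forall q, (q < size z)%N -> nth t0 z q \in S q) -> uniq z.
Proof.
move=> Sd Hz; apply/(uniqP t0) => i j; rewrite !inE => iz jz E.
apply/eqP; apply: contraT => ij; have := Sd i j iz jz ij.
by move/disjoint_setI0/setP/(_ (nth t0 z i)); rewrite !inE Hz // E Hz.
Qed.

Lemma extend (c : R) A D a Da (S : nat -> {set T}) :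
  4 ^+ (2 * k + 3) * eps <= c ^+ 2 -> 0 < c -> c <= 1 ->
  absorbing A D -> absorbing a Da ->
  (forall q, (q < M)%N -> rich c (rev A) (S q)) ->
  (forall q, (q < M)%N -> rich c a (S q)) ->
  (forall i j, (i < M)%N -> (j < M)%N -> i != j -> [disjoint S i & S j]) ->
  (forall q x, (q < M)%N -> x \in S q ->
     [/\ x \notin A, x \notin a & x \notin D :|: Da]) ->
  {in A, forall x, (x \notin a) /\ (x \notin Da)} -> {in a, forall x, x \notin D} ->
  [disjoint D & Da] ->
  exists z, [/\ size z = M, forall q, (q < M)%N -> nth t0 z q \in S q &
    absorbing (A ++ z ++ a) (D :|: Da)].
Proof.
move=> Hc c0 c1 HA Ha SA Sa Sd Sn Aa aD dD.
have [uA pA kA AD _] := HA; have [ua pa ka aDa _] := Ha.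
have sl : size (lastk k A) = k by rewrite size_drop subKn.
have st : size (take k a) = k by rewrite size_takel.
have [||q qm|q qm|z [sz pz Hz]] := connect t0 p0 p1 eps0 (ju_eps4 J) k2 n0 (ju_fa J)
  (ju_d1 J) (ju_d2 J) Hc c0 c1 Sd sl st.
- exact: pw_drop.
- exact: pw_take.
- by apply/rich_rev_lastk; apply: SA.
- by apply/rich_take; apply: Sa.
have inz x : x \in z -> [/\ x \notin A, x \notin a & x \notin D :|: Da].
  move=> xz; apply: (Sn (index x z)); first by rewrite -sz index_mem.
  by rewrite -{1}(nth_index t0 xz); apply: Hz; rewrite -sz index_mem.
have uz : uniq z by apply: (uniq_parts (S := S)); rewrite sz.
exists z; split => //; apply: absorbing_cat => //.
- by rewrite sz mlen_ge.
- rewrite !cat_uniq uA uz ua /= andbT; apply/andP; split.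
    apply/hasPn => x; rewrite mem_cat => /orP[/inz[]//|xa].
    by apply: contraL xa => /Aa[].
  by apply/hasPn => x xa; apply: contraL xa => /inz[].
move=> x; rewrite !mem_cat => /or3P[xA|/inz[] //|xa]; rewrite inE negb_or.
  by rewrite AD //; have [] := Aa x xA.
by rewrite aDa // aD.
Qed.

(** Here [v] becomes a permanent vertex of the path, so a [k.-1]-st power in its neighbourhood is
    enough, and this exists for [k = 2] as well. *)
Lemma insert_piece (c : R) v (Y : {set T}) (fam : seq {set T}) :
  (greedy_const k k.-1 (2 * k) (size fam))%:R * eps <= c ->
  Y \subset nb G v -> c * (p * n) <= #|Y|%:R ->
  (forall S, S \in fam -> c * n <= #|S|%:R) ->
  exists a, [/\ absorbing a set0, size a = (2 * k).+1, v \in a,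
    {in a, forall x, x = v \/ x \in Y} &
    forall S, S \in fam -> rich (c / 2 ^+ k) a S /\ rich (c / 2 ^+ k) (rev a) S].
Proof.
move=> Hc Yv HY HF.
have c0 : 0 < c.
  by apply: lt_le_trans Hc; rewrite mulr_gt0 // ltr0n /greedy_const !muln_gt0 expn_gt0.
have k0 : (0 < k)%N by apply: ltn_trans k2.
have kk : k.-1.+1 = k by apply: prednK.
have h : 1 <= 4 * (eps * p ^+ k.-1.+1 * n) by rewrite kk; apply: (ju_h J).
have [w [sw Hw]] := greedy p0 p1 eps0 n0 (ju_fa J) (leqnn _) h Hc HY HF.
have [uw wY pww _ _] := Hw.
have vw : all (G v) w.
  by apply/allP => x /wY /(subsetP Yv); rewrite inE.
have := absorbing_insert k0 sw uw pww vw; set a := take k w ++ _ => /= -[ua pa ta la ea].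
have sa : size a = (2 * k).+1.
  by rewrite /a size_cat /= addnS -size_cat cat_take_drop sw.
exists a; split => //.
- by apply: absorbing_pathP => //; rewrite sa; move: k0; clear; lia.
- by rewrite ea mem_head.
- by move=> x; rewrite ea inE => /orP[/eqP|/wY]; [left|right].
move=> S SF; have [_ _ _ _ /(_ S SF) Hf] := Hw.
have [h1 h2] := infix_rich p0 (ltW c0) Hf; split.
  by apply/rich_take; rewrite ta; apply/rich_take.
apply/rich_rev_lastk; rewrite la; apply/rich_rev_lastk; apply: h2.
by rewrite sw; move: k0; clear; lia.
Qed.

(** The path must also be a [k]-th power without [r]. Inside the neighbourhood of [r] the candidates
    then drop to order [p^(k+1) n], which is where pseudorandomness with exponents [k] and [k + 1]
    enters. *)
Lemma absorber_big (c : R) r (Y : {set T}) (fam : seq {set T}) : (2 < k)%N ->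
  (greedy_const k k (2 * k) (size fam))%:R * eps <= c ->
  Y \subset nb G r -> c * (p * n) <= #|Y|%:R ->
  (forall S, S \in fam -> c * n <= #|S|%:R) ->
  exists a, [/\ absorbing a [set r], size a = (2 * k)%N, {subset a <= Y} &
    forall S, S \in fam -> rich (c / 2 ^+ k) a S /\ rich (c / 2 ^+ k) (rev a) S].
Proof.
move=> k3 Hc Yv HY HF.
have c0 : 0 < c.
  by apply: lt_le_trans Hc; rewrite mulr_gt0 // ltr0n /greedy_const !muln_gt0 expn_gt0.
have k0 : (0 < k)%N by apply: ltn_trans k2.
have [w [sw Hw]] := greedy p0 p1 eps0 n0 (ju_fa' J k3) (leq_pred _) (ju_h' J k3) Hc HY HF.
have [uw wY pww _ _] := Hw.
have vw : all (G r) w.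
  by apply/allP => x /wY /(subsetP Yv); rewrite inE.
have rw : r \notin w by apply/negP => /(allP vw); rewrite (adj_irrefl G).
exists w; split => //.
  split => //; first by rewrite sw; move: k0; clear; lia.
    by move=> x xw; rewrite inE; apply: contraNneq rw => <-.
  move=> W; rewrite subset1 => /orP[]/eqP ->; last first.
    by exists w; split => // x; rewrite !inE orbF.
  have := absorbing_insert k0 sw uw (pw_weak (leq_pred _) pww) vw => -[ua pa ta la ea].
  by exists (take k w ++ r :: drop k w); split => // x; rewrite ea !inE orbC.
move=> S SF; have [_ _ _ _ /(_ S SF) Hf] := Hw.
have [h1 h2] := infix_rich p0 (ltW c0) Hf; split => //; apply: h2.
by rewrite sw; move: k0; clear; lia.
Qed.

End Pieces.

(** * Absorbers for squares *)

Section Absorber2.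
Variables (R : realFieldType) (T : finType) (G : sgraph T) (eps p : R).
Variables (t0 : T).
Hypothesis J : jumbled G eps p 2.
Local Notation n := (#|T|%:R : R).
Local Notation rich := (rich G p 2).
Local Notation absorbing := (absorbing G 2).
Local Notation atyp := (atyp G p).
Local Notation e2 := (eps * (p ^+ 2 * n)).
Local Notation e1 := (eps * (p * n)).

Let p0 := ju_p0 J. Let p1 := ju_p1 J. Let eps0 := ju_eps0 J. Let n0 := ju_n0 J.

Let dn : dense G eps p e2 e1.
Proof. by have := ju_d1 J; rewrite -!mulrA /= expr1. Qed.

Let atyp2 (X : {set T}) : 20 * e1 <= #|X|%:R -> #|atyp X|%:R <= e2.
Proof.
move=> H; rewrite mulrA; apply: (atyp_le (ju_fa J)) => /=.
by apply: le_trans H; rewrite expr1 -[eps * p * n]mulrA.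
Qed.

Let pn0 : 0 < p * n. Proof. by rewrite mulr_gt0. Qed.
Let ppn0 : 0 < p ^+ 2 * n. Proof. by rewrite mulr_gt0 // exprn_gt0. Qed.
Let ppE (x : R) : p * (x * (p * n)) = x * (p ^+ 2 * n). Proof. by rewrite expr2; ring. Qed.
Let pE (x : R) : p * (x * n) = x * (p * n). Proof. by ring. Qed.
Let e20 : 0 < e2. Proof. by rewrite mulr_gt0. Qed.
Let e10 : 0 < e1. Proof. by rewrite mulr_gt0. Qed.
Let e21 : e2 <= e1.
Proof. by rewrite ler_wpM2l ?(ltW eps0) // expr2 -mulrA ler_piMl // ltW. Qed.
Let e1n : e1 <= eps * n.
Proof. by rewrite ler_wpM2l ?(ltW eps0) // ler_piMl. Qed.

(** A set of vertices without neighbours in [X] spans no edge with [X], so density does not allow it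
    to be large. *)
Lemma few_isolated (X W : {set T}) : [disjoint X & W] -> e2 <= #|X|%:R ->
  #|[set w in W | [disjoint nb G w & X]]|%:R <= e1.
Proof.
move=> dXW HX; set B := [set w in W | _]; rewrite leNgt; apply/negP => HB.
have dXB : [disjoint X & B].
  by apply: (disjointWr _ dXW); apply/subsetP => z; rewrite inE => /andP[].
have := dn dXB HX (ltW HB); rewrite big1 => [|z].
  rewrite leNgt; apply/negP; rewrite negbK.
  have B0 : 0 < #|B|%:R :> R by apply: lt_trans HB.
  have X0 : 0 < #|X|%:R :> R by apply: lt_le_trans HX.
  by rewrite !mulr_gt0 // subr_gt0; move: (ju_eps4 J); lra.
by rewrite inE => /andP[_ /disjoint_setI0 ->]; rewrite cards0.
Qed.

Lemma card_has (fam : seq {set T}) (f : {set T} -> {set T}) (b : R) :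
  (forall S, S \in fam -> #|f S|%:R <= b) ->
  #|[set t | has (fun S => t \in f S) fam]|%:R <= (size fam)%:R * b.
Proof.
elim: fam => [|S fam IH] H /=.
  by rewrite mul0r eq_card0 // => t; rewrite inE.
have -> : [set t | (t \in f S) || has (fun S0 => t \in f S0) fam]
   = f S :|: [set t | has (fun S0 => t \in f S0) fam] by apply/setP => t; rewrite !inE.
have H1 := H S (mem_head _ _).
have H2 : #|[set t | has (fun S0 => t \in f S0) fam]|%:R <= (size fam)%:R * b.
  by apply: IH => S' HS'; apply: H; rewrite inE HS' orbT.
have : #|f S :|: [set t | has (fun S0 => t \in f S0) fam]|%:R
  <= #|f S|%:R + #|[set t | has (fun S0 => t \in f S0) fam]|%:R :> R.
  by rewrite -natrD ler_nat cardsU leq_subr.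
by rewrite -natr1 mulrDl mul1r; move: H1 H2; lra.
Qed.

Section Backbone.
Variables (fam : seq {set T}) (c : R).
Local Notation F := ((size fam)%:R : R).
Hypothesis Hc : (16 * size fam + 40)%N%:R * eps <= c.
Hypothesis famc : forall S, S \in fam -> c * n <= #|S|%:R.

(** Together with [unpaired] this is what [paired_rich] needs: a fit [w] and a [t] that is not
    unpaired with [w] form an end from which a square can be continued into every set of [fam]. *)
Definition unfit := [set w | has (fun S => w \in atyp S) fam].
Definition unpaired w := [set t | has (fun S => t \in atyp S :|: atyp (nb G w :&: S)) fam].

Let Fe : 16 * (F * eps) + 40 * eps <= c.
Proof. by move: Hc; rewrite natrD natrM; lra. Qed.
Let F0 : 0 <= F. Proof. by []. Qed.
Let Fe0 : 0 <= F * eps. Proof. by rewrite mulr_ge0 // ltW. Qed.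
Let c0 : 0 < c. Proof. by move: Fe Fe0 eps0; lra. Qed.

Let Fe1 : 16 * (F * e1) + 40 * e1 <= c * (p * n).
Proof. by have := ler_wpM2r (ltW pn0) Fe; rewrite mulrDl; lra. Qed.
Let Fe2 : 16 * (F * e2) + 40 * e2 <= c * (p ^+ 2 * n).
Proof. by have := ler_wpM2r (ltW ppn0) Fe; rewrite mulrDl; lra. Qed.
Let Fen : 16 * (F * (eps * n)) + 40 * (eps * n) <= c * n.
Proof. by have := ler_wpM2r (ltW n0) Fe; rewrite mulrDl; lra. Qed.
Let Fe20 : 0 <= F * e2. Proof. by rewrite mulr_ge0 // ltW. Qed.
Let Fe21 : F * e2 <= F * e1. Proof. by rewrite ler_wpM2l. Qed.
Let Fe1n : F * e1 <= F * (eps * n). Proof. by rewrite ler_wpM2l. Qed.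

Lemma card_unfit : #|unfit|%:R <= F * e2.
Proof.
apply: card_has => S SF; apply: atyp2; apply: le_trans (famc SF).
by move: Fen Fe1n Fe21 Fe20 e1n e10; lra.
Qed.

Lemma unfitP w S : w \notin unfit -> S \in fam -> p / 2 * #|S|%:R <= #|nb G w :&: S|%:R.
Proof.
by rewrite inE => /hasPn H /H /natypP.
Qed.

Lemma card_unpaired w : w \notin unfit -> #|unpaired w|%:R <= 2 * (F * e2).
Proof.
move=> wf; have -> : 2 * (F * e2) = F * (2 * e2) by ring.
apply: card_has => S SF.
have : #|atyp S :|: atyp (nb G w :&: S)|%:R <= #|atyp S|%:R + #|atyp (nb G w :&: S)|%:R :> R.
  by rewrite -natrD ler_nat cardsU leq_subr.
have h1 : #|atyp S|%:R <= e2.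
  by apply: atyp2; apply: le_trans (famc SF); move: Fen Fe1n Fe21 Fe20 e1n e10; lra.
have h2 : #|atyp (nb G w :&: S)|%:R <= e2.
  apply: atyp2; apply: le_trans (unfitP wf SF).
  have := ler_wpM2l (ltW p0) (famc SF); rewrite pE.
  by move: Fe1 Fe21 Fe20 e10; lra.
by move: h1 h2; lra.
Qed.

Lemma paired_rich w t S : w \notin unfit -> t \notin unpaired w -> S \in fam ->
  rich (c / 4) [:: t; w] S.
Proof.
move=> wf; rewrite inE => /hasPn H SF; have := H S SF; rewrite inE negb_or.
move=> /andP[/natypP tS /natypP twS].
have wS := unfitP wf SF; have cS := famc SF.
have cS' := ler_wpM2l (ltW p0) cS; rewrite pE in cS'.
have cn : 0 < c * n by rewrite mulr_gt0.
have cpn : 0 < c * (p * n) by rewrite mulr_gt0.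
case=> [|[|[|//]]] _ /=.
- by rewrite cN_nil setTI expr0; move: cS cn; lra.
- by rewrite cN_cons cN_nil setIT expr1 -mulrA; move: tS cS' cpn; lra.
rewrite !cN_cons cN_nil setIT -setIA -mulrA.
apply: le_trans twS; have := ler_wpM2l (ltW p0) wS.
have := ler_wpM2l (ltW p0) cS'; rewrite ppE; lra.
Qed.

(** One half of the gadget, starting from [w0]: [t1] is joined to [r], [w0], [w1], then [t2] to
    [w0], [w1], [w2], and [t3], still free in [Y w2], to [w1] and [w2]. So many vertices remain
    possible for [w2] that two halves can be joined by an edge. *)
Lemma half_backbone r w0 (W1 W2 T0 T1 T2 : {set T}) :
  w0 \notin unfit -> c * (p * n) <= #|nb G w0 :&: W1|%:R ->
  c * (p * n) <= #|nb G w0 :&: T1|%:R ->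
  e2 <= #|nb G w0 :&: (nb G r :&: T0) :\: unpaired w0|%:R ->
  c * n <= #|T2|%:R -> c * n <= #|W2|%:R ->
  [disjoint T0 & W1] -> [disjoint T1 & W2] -> [disjoint W1 & W2] ->
  exists (F2 : {set T}) (Y : T -> {set T}), [/\ F2 \subset W2, c * n / 2 <= #|F2|%:R &
    forall w2, w2 \in F2 -> [/\ w2 \notin unfit, Y w2 \subset T2, e2 <= #|Y w2|%:R &
     exists w1 t1 t2, [/\ [/\ w1 \in W1, t1 \in T0 & t2 \in T1],
       [/\ w1 \notin unfit, t1 \notin unpaired w0 & t2 \notin unpaired w1],
       [/\ G w0 w1, G w1 w2, G w0 t1, G r t1 & G w1 t1], [/\ G w0 t2, G w1 t2 & G w2 t2] &
       forall t3, t3 \in Y w2 -> [/\ t3 \notin unpaired w2, G w1 t3 & G w2 t3]]]].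
Proof.
move=> w0f HW1 HT1; set X0 := _ :\: _ => HX0 HT2 HW2 d01 d12 dW.
pose iso := [set w1 in W1 | [disjoint nb G w1 & X0]].
have ciso : #|iso|%:R <= e1.
  apply: few_isolated => //; apply: disjointWl d01.
  by apply/subsetP => x; rewrite !inE => /and4P[].
pose A1 := nb G w0 :&: W1 :\: unfit :\: atyp (nb G w0 :&: T1) :\: atyp T2 :\: iso.
have cA1 : c * (p * n) / 2 <= #|A1|%:R.
  have h1 := card_rem R (nb G w0 :&: W1) unfit.
  have h2 := card_rem R (nb G w0 :&: W1 :\: unfit) (atyp (nb G w0 :&: T1)).
  have h3 := card_rem R (nb G w0 :&: W1 :\: unfit :\: atyp (nb G w0 :&: T1)) (atyp T2).
  have h4 := card_rem R (nb G w0 :&: W1 :\: unfit :\: atyp (nb G w0 :&: T1) :\: atyp T2) iso.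
  have a1 : #|atyp (nb G w0 :&: T1)|%:R <= e2.
    by apply: atyp2; move: HT1 Fe1 Fe21 Fe20 e10; lra.
  have a2 : #|atyp T2|%:R <= e2.
    by apply: atyp2; move: HT2 Fen Fe1n Fe21 Fe20 e1n e10; lra.
  have a3 := card_unfit; rewrite -/A1 in h4.
  by move: h1 h2 h3 h4 a1 a2 a3 ciso HW1 Fe1 Fe21 Fe20 e21 e20; lra.
have A1P w1 : w1 \in A1 -> [/\ w1 \in W1, G w0 w1, w1 \notin unfit,
    w1 \notin atyp (nb G w0 :&: T1) /\ w1 \notin atyp T2 & exists2 t, t \in X0 & G w1 t].
  rewrite 4!in_setD in_setI [w1 \in iso]in_set negb_and.
  move=> /andP[h /and4P[h2 h1 h0 /andP[w01 w1W]]]; rewrite in_set in w01.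
  split=> //; move: h; rewrite w1W /= => /pred0Pn[t /= /andP[]].
  by rewrite in_set; exists t.
pose X1 w1 := nb G w1 :&: (nb G w0 :&: T1) :\: unpaired w1.
have cX1 w1 : w1 \in A1 -> e2 <= #|X1 w1|%:R.
  move=> /A1P[_ _ wf [/natypP h _] _].
  have := card_rem R (nb G w1 :&: (nb G w0 :&: T1)) (unpaired w1).
  have := card_unpaired wf; have := ler_wpM2l (ltW p0) HT1; rewrite ppE -/(X1 w1).
  by move: h Fe2 Fe20 e20; lra.
(* The first condition supplies [t2], the second keeps many candidates for [t3]. *)
pose ok w1 w2 := ~~ [disjoint nb G w2 & X1 w1] && (w2 \notin atyp (nb G w1 :&: T2)).
have cN2 w1 : w1 \in A1 -> c * (p * n) / 2 <= #|nb G w1 :&: T2|%:R.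
  move=> /A1P[_ _ _ [_ /natypP h] _]; apply: le_trans h.
  by have := ler_wpM2l (ltW p0) HT2; rewrite pE; lra.
have bad w1 : w1 \in A1 -> #|[set w2 in W2 | G w1 w2 && ~~ ok w1 w2]|%:R <= 2 * e1.
  move=> wA; have i1 : #|[set w in W2 | [disjoint nb G w & X1 w1]]|%:R <= e1.
    apply: few_isolated (cX1 _ wA); apply: disjointWl d12.
    by apply/subsetP => x; rewrite !inE => /and4P[].
  have i2 : #|atyp (nb G w1 :&: T2)|%:R <= e2.
    by apply: atyp2; move: (cN2 _ wA) Fe1 Fe21 Fe20 e10; lra.
  have : #|[set w2 in W2 | G w1 w2 && ~~ ok w1 w2]|%:R <=
      #|[set w in W2 | [disjoint nb G w & X1 w1]]|%:R + #|atyp (nb G w1 :&: T2)|%:R :> R.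
    rewrite -natrD ler_nat; apply: leq_trans (leq_card_setU _ _).
    apply: subset_leq_card; apply/subsetP => w2.
    rewrite in_set negb_and !negbK in_setU [w2 \in [set w in W2 | _]]in_set.
    by case/and3P => -> _ /orP[->|->]; rewrite ?orbT.
  by move: i1 i2 e21; lra.
have dA : [disjoint A1 & W2].
  by apply: disjointWl dW; apply/subsetP => x /A1P[].
have kA : e2 <= #|A1|%:R by move: cA1 Fe1 Fe21 Fe20 e21 e20; lra.
have := transfer p0 (ju_eps4 J) (ltW e10) dn dA kA bad.
have -> : 4 * (2 * e1) / p = 8 * (eps * n) by field; rewrite gt_eqF.
have -> : Num.max (8 * (eps * n)) e1 = 8 * (eps * n).
  by apply/max_idPl; move: e1n e10; lra.
set B := [set z in W2 | _] => cB.
pose F2 := W2 :\: B :\: unfit.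
have cF2 : c * n / 2 <= #|F2|%:R.
  have h1 := card_rem R W2 B; have h2 := card_rem R (W2 :\: B) unfit.
  have a3 := card_unfit; rewrite -/F2 in h2.
  by move: h1 h2 a3 cB HW2 Fen Fe1n Fe21 Fe20 e1n e10; lra.
have F2P w2 : w2 \in F2 -> exists w1, [/\ w1 \in A1, G w1 w2 & ok w1 w2].
  rewrite 2!in_setD => /and3P[_ hB wW]; move: hB; rewrite in_set wW /= -leNgt => h.
  have : 0 < #|[set d in A1 | G d w2 && ok d w2]|%:R :> R.
    apply: lt_le_trans h; rewrite mulr_gt0 ?divr_gt0 //.
    by apply: lt_le_trans kA.
  by rewrite ltr0n => /card_gt0P[w1]; rewrite in_set => /and3P[]; exists w1.
have /choice[f Hf] : forall w2, exists w1, w2 \in F2 -> [/\ w1 \in A1, G w1 w2 & ok w1 w2].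
  by move=> w2; case: (boolP (w2 \in F2)) => [/F2P[w1 H]|_]; [exists w1|exists w0].
pose Y w2 := nb G w2 :&: (nb G (f w2) :&: T2) :\: unpaired w2.
exists F2, Y; split => //.
  by rewrite /F2; apply: subset_trans (subsetDl _ _) (subsetDl _ _).
move=> w2 w2F; have [fA f2 /andP[okd okt]] := Hf w2 w2F.
have wf : w2 \notin unfit by move: w2F; rewrite in_setD => /andP[].
have [fW w0f' ff [h1 _] [ta taX0 fta]] := A1P _ fA.
split => //.
- by apply/subsetP => x; rewrite !inE => /and4P[].
- have := card_rem R (nb G w2 :&: (nb G (f w2) :&: T2)) (unpaired w2).
  have := card_unpaired wf; have := natypP okt; rewrite -/(Y w2).
  have := ler_wpM2l (ltW p0) (cN2 _ fA).
  have -> : p * (c * (p * n) / 2) = c * (p ^+ 2 * n) / 2 by rewrite expr2; field.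
  by move: Fe2 Fe20 e20; lra.
have /pred0Pn[tb /= /andP[]] := okd; rewrite in_set => w2tb tbX.
exists (f w2), ta, tb.
move: taX0; rewrite in_setD => /andP[tau]; rewrite !in_setI.
rewrite [ta \in nb _ _]in_set [ta \in nb _ r]in_set => /and3P[w0ta rta taT].
move: tbX; rewrite in_setD => /andP[tbu]; rewrite !in_setI.
rewrite [tb \in nb _ (f w2)]in_set [tb \in nb _ _]in_set => /and3P[ftb w0tb tbT].
split => //.
move=> t3; rewrite in_setD => /andP[t3u]; rewrite !in_setI.
by rewrite [t3 \in nb _ w2]in_set [t3 \in nb _ _]in_set => /and3P[].
Qed.

End Backbone.
End Absorber2.

Section Assemble.
Variables (T : finType) (G : sgraph T).
Variables (r : T) (s w : nat -> T) (z1 z2 : seq T).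

(* Two orders with the same first two and the same last two vertices, without and with [r]. *)
Definition fullabs := [:: s 0; w 0; w 1; s 1] ++ z1 ++ [:: s 5; w 5; w 4; s 4] ++ z2 ++
  [:: s 2; w 2; w 3; s 3].

Definition fullabs' := [:: s 0; w 0; r; w 5; s 5] ++ rev z1 ++ [:: s 1; w 1; w 2; s 2] ++ rev z2 ++
  [:: s 4; w 4; w 3; s 3].

Lemma perm_abs : perm_eq fullabs' (r :: fullabs).
Proof.
apply/permP => P; rewrite /fullabs /fullabs' !(count_cat, count_rev) /= !(count_cat, count_rev) /= !count_cat /=.
set f := fun x => nat_of_bool (P x); rewrite -!/(f _).
by move: (f r) (f (w 0)) (f (w 1)) (f (w 2)) (f (w 3)) (f (w 4)) (f (w 5))
  (f (s 0)) (f (s 1)) (f (s 2)) (f (s 3)) (f (s 4)) (f (s 5)) (count P z1) (count P z2); clear; lia.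
Qed.

Lemma perm_abs12 : perm_eq fullabs ([:: w 0; w 1; w 2; w 3; w 4; w 5] ++
  [:: s 0; s 1; s 2; s 3; s 4; s 5] ++ z1 ++ z2).
Proof.
apply/permP => P; rewrite /fullabs !count_cat /= ?count_cat /= ?count_cat /=.
set f := fun x => nat_of_bool (P x); rewrite -!/(f _).
by move: (f (w 0)) (f (w 1)) (f (w 2)) (f (w 3)) (f (w 4)) (f (w 5))
  (f (s 0)) (f (s 1)) (f (s 2)) (f (s 3)) (f (s 4)) (f (s 5)) (count P z1) (count P z2); clear; lia.
Qed.

Hypothesis pz1 : pw G 2 ([:: w 1; s 1] ++ z1 ++ [:: s 5; w 5]).
Hypothesis pz2 : pw G 2 ([:: w 4; s 4] ++ z2 ++ [:: s 2; w 2]).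

Lemma pw_glue2 a b c d e1 e2 f1 f2 zz : pw G 2 [:: a; b; e1; e2] ->
  pw G 2 ([:: e1; e2] ++ zz ++ [:: f1; f2]) -> pw G 2 [:: f1; f2; c; d] ->
  pw G 2 ([:: a; b; e1; e2] ++ zz ++ [:: f1; f2; c; d]).
Proof.
move=> H1 H2 H3.
have := @pw_glue _ G 2 [:: a; b] [:: e1; e2] (zz ++ [:: f1; f2]) isT H1 H2.
have := @pw_glue _ G 2 ([:: a; b; e1; e2] ++ zz) [:: f1; f2] [:: c; d] isT.
by rewrite -!catA /= => H /H; apply.
Qed.

Lemma pw_glue4 l b1 b2 b3 b4 e : pw G 2 (l ++ [:: b1; b2; b3; b4]) ->
  pw G 2 ([:: b1; b2; b3; b4] ++ e) -> pw G 2 (l ++ [:: b1; b2; b3; b4] ++ e).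
Proof. by move=> H1 H2; apply: pw_glue. Qed.

Lemma pw_fullabs : pw G 2 [:: s 0; w 0; w 1; s 1] -> pw G 2 [:: s 5; w 5; w 4; s 4] ->
  pw G 2 [:: s 2; w 2; w 3; s 3] -> pw G 2 fullabs.
Proof.
move=> H1 H2 H3; rewrite /fullabs catA; apply: pw_glue4.
  by rewrite -catA; apply: pw_glue2.
exact: pw_glue2.
Qed.

Lemma pw_fullabs' : pw G 2 [:: s 0; w 0; r; w 5; s 5] -> pw G 2 [:: s 1; w 1; w 2; s 2] ->
  pw G 2 [:: s 4; w 4; w 3; s 3] -> pw G 2 fullabs'.
Proof.
move=> H1 H2 H3; rewrite /fullabs' catA; apply: pw_glue4.
  rewrite -catA -cat1s -[s 0 :: _]cat1s.
  have q1 : pw G 2 [:: w 0; r; w 5; s 5] by move: H1 => /andP[].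
  have q2 : pw G 2 ([:: w 5; s 5] ++ rev z1 ++ [:: s 1; w 1]).
    by have := pw_rev (adj_sym G) pz1; rewrite !rev_cat -catA.
  have := pw_glue2 q1 q2 H2; move: H1 => /= /andP[-> _].
  by move=> /= ->.
apply: pw_glue2 => //.
by have := pw_rev (adj_sym G) pz2; rewrite !rev_cat -catA.
Qed.

End Assemble.

Section Absorber2.
Variables (R : realFieldType) (T : finType) (G : sgraph T) (eps p : R).
Variables (t0 : T).
Hypothesis J : jumbled G eps p 2.
Local Notation n := (#|T|%:R : R).
Local Notation rich := (rich G p 2).
Local Notation absorbing := (absorbing G 2).
Local Notation atyp := (atyp G p).
Local Notation e2 := (eps * (p ^+ 2 * n)).
Local Notation e1 := (eps * (p * n)).
Local Notation M := (mlen 2).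

Let p0 := ju_p0 J. Let p1 := ju_p1 J. Let eps0 := ju_eps0 J. Let n0 := ju_n0 J.

(** The vertices [w 0] to [w 5] form a cycle of length six, and [r] is adjacent to [w 0] and [w 5].
    Without [r] the edges of the perfect matching [w 0 w 1], [w 2 w 3], [w 4 w 5] lie in the middle
    of the short pieces; with [r] placed between [w 5] and [w 0], those of the other perfect
    matching do. Each [s i] is adjacent to [w i] and to its two neighbours on the cycle, with [r] in
    place of the far neighbour for [s 0] and [s 5]. *)
Definition backbone (fam : seq {set T}) (A : nat -> {set T}) r (s w : nat -> T) :=
  [/\ pw G 2 [:: s 0; w 0; w 1; s 1], pw G 2 [:: s 5; w 5; w 4; s 4],
      pw G 2 [:: s 2; w 2; w 3; s 3] &
      [/\ pw G 2 [:: s 0; w 0; r; w 5; s 5], pw G 2 [:: s 1; w 1; w 2; s 2] &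
      pw G 2 [:: s 4; w 4; w 3; s 3]]] /\
  forall i, (i < 6)%N -> [/\ w i \in A i, s i \in A (6 + i)%N,
    w i \notin unfit G p fam & s i \notin unpaired G p fam (w i)].

(** The two halves start from adjacent neighbours [w0] and [w5] of [r] and are joined by the edge
    between [w2] and [w3]. No candidate set used is smaller than order [p^2 n], the limit of what
    the hypothesis for [k = 2] controls. *)
Lemma backbone_exists (c : R) (fam : seq {set T}) (A : nat -> {set T}) r :
  (64 * size fam + 160)%N%:R * eps <= c ->
  (forall S, S \in fam -> c * n <= #|S|%:R) ->
  (forall i j, (i < 12)%N -> (j < 12)%N -> i != j -> [disjoint A i & A j]) ->
  (forall i, (i < 12)%N -> c * n <= #|A i|%:R /\ c * (p * n) <= #|nb G r :&: A i|%:R) ->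
  exists s w, backbone fam A r s w.
Proof.
move=> Hc famc Ad HA.
have pn0 : 0 < p * n by rewrite mulr_gt0.
have ppn0 : 0 < p ^+ 2 * n by rewrite mulr_gt0 // exprn_gt0.
have ppE (x : R) : p * (x * (p * n)) = x * (p ^+ 2 * n) by rewrite expr2; ring.
have pE (x : R) : p * (x * n) = x * (p * n) by ring.
have e20 : 0 < e2 by rewrite mulr_gt0.
have e10 : 0 < e1 by rewrite mulr_gt0.
have e21 : e2 <= e1 by rewrite ler_wpM2l ?(ltW eps0) // expr2 -mulrA ler_piMl // ltW.
have e1n : e1 <= eps * n by rewrite ler_wpM2l ?(ltW eps0) // ler_piMl.
have atyp2 (X : {set T}) : 20 * e1 <= #|X|%:R -> #|atyp X|%:R <= e2.
  move=> H; rewrite mulrA; apply: (atyp_le (ju_fa J)) => /=.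
  by apply: le_trans H; rewrite expr1 -[eps * p * n]mulrA.
pose F := (size fam)%:R : R.
have F0 : 0 <= F by [].
have Fe : 64 * (F * eps) + 160 * eps <= c by move: Hc; rewrite natrD natrM -/F; lra.
have Fe0 : 0 <= F * eps by rewrite mulr_ge0 // ltW.
have c0 : 0 < c by move: Fe Fe0 eps0; lra.
have Fe1 : 64 * (F * e1) + 160 * e1 <= c * (p * n).
  by have := ler_wpM2r (ltW pn0) Fe; rewrite mulrDl; lra.
have Fe2 : 64 * (F * e2) + 160 * e2 <= c * (p ^+ 2 * n).
  by have := ler_wpM2r (ltW ppn0) Fe; rewrite mulrDl; lra.
have Fen : 64 * (F * (eps * n)) + 160 * (eps * n) <= c * n.
  by have := ler_wpM2r (ltW n0) Fe; rewrite mulrDl; lra.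
have Fe20 : 0 <= F * e2 by rewrite mulr_ge0 // ltW.
have Fe21 : F * e2 <= F * e1 by rewrite ler_wpM2l.
have Fe1n : F * e1 <= F * (eps * n) by rewrite ler_wpM2l.
have Hc4 : (16 * size fam + 40)%N%:R * eps <= c / 4.
  by rewrite natrD natrM -/F; move: Fe; lra.
have famc4 S : S \in fam -> c / 4 * n <= #|S|%:R.
  by move/famc; have := mulr_gt0 c0 n0; lra.
have cunf := card_unfit J Hc4 famc4; rewrite -/F in cunf.
have cunp := @card_unpaired _ _ _ _ _ J _ _ Hc4 famc4; rewrite -/F in cunp.
have bA i : (i < 12)%N -> #|atyp (A i)|%:R <= e2.
  move=> /HA[h _]; apply: atyp2; move: h Fen Fe1n Fe21 Fe20 e1n e10; lra.
have bN i : (i < 12)%N -> #|atyp (nb G r :&: A i)|%:R <= e2.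
  move=> /HA[_ h]; apply: atyp2; move: h Fe1 Fe21 Fe20 e10; lra.
have bF : F * e2 + e2 >= e2 by move: Fe20; lra.
have b1 : e2 <= F * e2 + e2 by move: Fe20; lra.
have b2 : F * e2 <= F * e2 + e2 by move: e20; lra.
have [HA0 HN0] := HA 0%N isT.
have [||w0] := @avoid R T (nb G r :&: A 0%N) [:: unfit G p fam; atyp (A 1%N); atyp (A 7%N);
   atyp (nb G r :&: A 5%N); atyp (nb G r :&: A 6%N)] (F * e2 + e2).
- move=> B; rewrite !inE => /or4P[/eqP->|/eqP->|/eqP->|/orP[/eqP->|/eqP->]].
  + exact: le_trans cunf b2.
  + exact: le_trans (bA 1%N isT) b1.
  + exact: le_trans (bA 7%N isT) b1.
  + exact: le_trans (bN 5%N isT) b1.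
  + exact: le_trans (bN 6%N isT) b1.
- by rewrite /=; move: HN0 Fe1 Fe21 Fe20 e21 e20; lra.
rewrite in_setI in_set => /andP[rw0 w0A] w0B.
have w0f : w0 \notin unfit G p fam by apply: w0B; rewrite !inE eqxx.
have w01 := natypP (w0B (atyp (A 1%N)) _); rewrite !inE eqxx !orbT in w01.
have w07 := natypP (w0B (atyp (A 7%N)) _); rewrite !inE eqxx !orbT in w07.
have w05 := natypP (w0B (atyp (nb G r :&: A 5%N)) _); rewrite !inE eqxx !orbT in w05.
have w06 := natypP (w0B (atyp (nb G r :&: A 6%N)) _); rewrite !inE eqxx !orbT in w06.
have {}w01 := w01 isT; have {}w07 := w07 isT; have {}w05 := w05 isT; have {}w06 := w06 isT.
have half_n i : (i < 12)%N -> c / 4 * (p * n) <= p / 2 * #|A i|%:R.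
  move=> /HA[h _]; have := ler_wpM2l (ltW p0) h; rewrite pE.
  by have := mulr_gt0 c0 pn0; lra.
have half_pn i : (i < 12)%N -> c / 2 * (p ^+ 2 * n) <= p / 2 * #|nb G r :&: A i|%:R.
  by move=> /HA[_ h]; have := ler_wpM2l (ltW p0) h; rewrite ppE; lra.
have h5 := half_pn 5%N isT.
(* The candidates are common neighbours of [r] and [w0], of order [c p^2 n], against four sets of
   order [eps p^2 n]. *)
have [||w5] := @avoid R T (nb G w0 :&: (nb G r :&: A 5%N)) [:: unfit G p fam; atyp (A 4%N); atyp (A 10%N);
   atyp (nb G r :&: A 11%N)] (F * e2 + e2).
- move=> B; rewrite !inE => /or4P[/eqP->|/eqP->|/eqP->|/eqP->].
  + exact: le_trans cunf b2.
  + exact: le_trans (bA 4%N isT) b1.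
  + exact: le_trans (bA 10%N isT) b1.
  + exact: le_trans (bN 11%N isT) b1.
- by rewrite /=; move: w05 h5 Fe2 Fe20 e20; lra.
rewrite !in_setI ![w5 \in nb _ _]in_set => /and3P[w05e rw5 w5A] w5B.
have w5f : w5 \notin unfit G p fam by apply: w5B; rewrite !inE eqxx.
have w54 := natypP (w5B (atyp (A 4%N)) _); rewrite !inE eqxx !orbT in w54.
have w510 := natypP (w5B (atyp (A 10%N)) _); rewrite !inE eqxx !orbT in w510.
have w511 := natypP (w5B (atyp (nb G r :&: A 11%N)) _); rewrite !inE eqxx !orbT in w511.
have {}w54 := w54 isT; have {}w510 := w510 isT; have {}w511 := w511 isT.
have X0 w i : (i < 12)%N -> w \notin unfit G p fam ->
   p / 2 * #|nb G r :&: A i|%:R <= #|nb G w :&: (nb G r :&: A i)|%:R ->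
   e2 <= #|nb G w :&: (nb G r :&: A i) :\: unpaired G p fam w|%:R.
  move=> i12 wf h; have := card_rem R (nb G w :&: (nb G r :&: A i)) (unpaired G p fam w).
  by move: (cunp _ wf) (half_pn i i12) h Fe2 Fe20 e20; lra.
have An i : (i < 12)%N -> c / 4 * n <= #|A i|%:R.
  by move=> /HA[h _]; have := mulr_gt0 c0 n0; lra.
have [F2 [Y2 [F2S cF2 HF2]]] := half_backbone (r := r) J Hc4 famc4 w0f
  (le_trans (half_n 1%N isT) w01) (le_trans (half_n 7%N isT) w07)
  (X0 _ 6%N isT w0f w06) (An 8%N isT) (An 2%N isT) (Ad 6%N 1%N isT isT isT) (Ad 7%N 2%N isT isT isT)
  (Ad 1%N 2%N isT isT isT).
have [F3 [Y3 [F3S cF3 HF3]]] := half_backbone (r := r) J Hc4 famc4 w5f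
  (le_trans (half_n 4%N isT) w54) (le_trans (half_n 10%N isT) w510)
  (X0 _ 11%N isT w5f w511) (An 9%N isT) (An 3%N isT) (Ad 11%N 4%N isT isT isT) (Ad 10%N 3%N isT isT isT)
  (Ad 4%N 3%N isT isT isT).
clear w01 w07 w05 w06 w54 w510 w511 h5 b1 b2 bF Fe Fe0 Fe2 HA0 HN0.
have dn : dense G eps p e2 e1 by have := ju_d1 J; rewrite -!mulrA /= expr1.
have dF : [disjoint F2 & F3] by apply: disjointW F2S F3S (Ad 2%N 3%N isT isT isT).
have kF : e2 <= #|F2|%:R.
  by move: cF2 Fen Fe1n Fe21 Fe20 e1n e21 e10; lra.
(* First [w3] is chosen so that many of its neighbours [w2] in [F2] leave a common neighbour [s2].
   The symmetric condition for [s3] excludes few of these [w2] and is imposed afterwards. *)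
have bad w2 : w2 \in F2 ->
    #|[set w3 in F3 | G w2 w3 && ~~ ~~ [disjoint nb G w3 & Y2 w2]]|%:R <= e1.
  move=> /HF2[_ Ys cY _]; apply: le_trans (few_isolated J (W := F3) _ cY); last first.
    exact: disjointW Ys F3S (Ad 8%N 3%N isT isT isT).
  rewrite ler_nat; apply: subset_leq_card; apply/subsetP => w3.
  by rewrite !in_set negbK => /and3P[-> _ ->].
have := transfer p0 (ju_eps4 J) (ltW e10) dn dF kF bad.
have -> : 4 * e1 / p = 4 * (eps * n) by field; rewrite gt_eqF.
have -> : Num.max (4 * (eps * n)) e1 = 4 * (eps * n).
  by apply/max_idPl; move: e1n e10; lra.
set B := [set z in F3 | _] => cB.
have : 0 < #|F3 :\: B|%:R :> R.
  by have := card_rem R F3 B; move: cF3 cB Fen Fe1n Fe21 Fe20 e1n e10; lra.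
rewrite ltr0n => /card_gt0P[w3]; rewrite in_setD in_set => /andP[hB w3F].
move: hB; rewrite w3F /= -leNgt => hB.
have [w3f Y3s cY3 [w4 [s5 [s4 [[w4A s5A s4A] [w4f s5p s4p] [g54 g43 g5s5 rs5 g4s5] [g5s4 g4s4 g3s4] HY3]]]]] := HF3 _ w3F.
have [||w2] := @avoid R T [set d in F2 | G d w3 && ~~ [disjoint nb G w3 & Y2 d]]
  [:: [set w in F2 | [disjoint nb G w & Y3 w3]]] e1.
- move=> X; rewrite inE => /eqP ->; apply: (few_isolated J (W := F2) _ cY3).
  exact: disjointW Y3s F2S (Ad 9%N 2%N isT isT isT).
- rewrite /= mul1r; apply: lt_le_trans hB.
  have := ler_wpM2l (ltW p0) cF2.
  have -> : p * (c / 4 * n / 2) = c * (p * n) / 8 by field.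
  by move: Fe1 Fe21 Fe20 e10; lra.
rewrite in_set => /and3P[w2F g23 /pred0Pn[s2 /= /andP[]]]; rewrite in_set => g3s2 s2Y w2X.
have : ~~ [disjoint nb G w2 & Y3 w3].
  by have := w2X _ (mem_head _ _); rewrite in_set w2F.
move=> /pred0Pn[s3 /= /andP[]]; rewrite in_set => g2s3 s3Y.
have [w2f Y2s cY2 [w1 [s0 [s1 [[w1A s0A s1A] [w1f s0p s1p] [g01 g12 g0s0 rs0 g1s0] [g0s1 g1s1 g2s1] HY2]]]]] := HF2 _ w2F.
have [s2p g1s2 g2s2] := HY2 _ s2Y; have [s3p g4s3 g3s3] := HY3 _ s3Y.
exists (nth s0 [:: s0; s1; s2; s3; s4; s5]), (nth w0 [:: w0; w1; w2; w3; w4; w5]).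
have gs := adj_sym G.
split; first split; rewrite /=.
- by rewrite (gs s0 w0) g0s0 (gs s0 w1) g1s0 g01 g0s1 g1s1.
- by rewrite (gs s5 w5) g5s5 (gs s5 w4) g4s5 g54 g5s4 g4s4.
- by rewrite (gs s2 w2) g2s2 (gs s2 w3) g3s2 g23 g2s3 g3s3.
- split.
  + by rewrite (gs s0 w0) g0s0 (gs s0 r) rs0 (gs w0 r) rw0 w05e rw5 rs5 g5s5.
  + by rewrite (gs s1 w1) g1s1 (gs s1 w2) g2s1 g12 g1s2 g2s2.
  + by rewrite (gs s4 w4) g4s4 (gs s4 w3) g3s4 g43 g4s3 g3s3.
case=> [|[|[|[|[|[|//]]]]]] _ /=; split=> //.
- exact: (subsetP F2S).
- exact: (subsetP Y2s).
- exact: (subsetP F3S).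
- exact: (subsetP Y3s).
Qed.

End Absorber2.

Section Absorber2.
Variables (R : realFieldType) (T : finType) (G : sgraph T) (eps p : R).
Variables (t0 : T).
Local Notation n := (#|T|%:R : R).

Lemma absorbing_pair k a a' r : uniq a -> r \notin a -> pw G k a -> (k <= size a)%N ->
  perm_eq a' (r :: a) -> pw G k a' -> take k a' = take k a -> lastk k a' = lastk k a ->
  absorbing G k a [set r].
Proof.
move=> ua ra pa ka pe pa' ta la; split=> //.
  by move=> x xa; rewrite inE; apply: contraNneq ra => <-.
move=> W; rewrite subset1 => /orP[]/eqP ->; last first.
  by exists a; split => // x; rewrite !inE orbF.
exists a'; split => //; first by rewrite (perm_uniq pe) /= ra.
by move=> x; rewrite (perm_mem pe) !inE orbC.
Qed.

Lemma disjoint_mem (A B : {set T}) x : [disjoint A & B] -> x \in A -> x \in B -> False.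
Proof. by move=> d xA xB; move/disjoint_setI0/setP/(_ x): d; rewrite !inE xA xB. Qed.

Local Notation M := (mlen 2).
Hypothesis J : jumbled G eps p 2.
Let p0 := ju_p0 J. Let p1 := ju_p1 J. Let eps0 := ju_eps0 J. Let n0 := ju_n0 J.

Lemma loss1 (c : R) k (S : {set T}) x : 1 <= 4 * (eps * p ^+ k * n) -> 0 < eps ->
  64 * eps <= c -> #|S :\: (S :\ x)|%:R <= c / 2 * p ^+ k * n.
Proof.
move=> h e0 ec; apply: (@le_trans _ _ 1).
  rewrite lern1; apply: leq_trans (_ : #|[set x]| <= 1)%N; last by rewrite cards1.
  by apply: subset_leq_card; apply/subsetP => y; rewrite !inE; case: eqP => // _ /andP[/negP].
have -> : c / 2 * p ^+ k * n = c / 2 * (p ^+ k * n) by ring.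
have pk0 : 0 < p ^+ k * n.
  have : 0 < eps * (p ^+ k * n) by move: h; rewrite mulrA; lra.
  by rewrite pmulr_rgt0.
have := ler_wpM2r (ltW pk0) ec; move: h; rewrite -!mulrA; lra.
Qed.

(** The twelve sets [A i] receive the backbone, and both connecting paths run through the sets
    [S q]. *)
Lemma absorber2 (c : R) (fam : seq {set T}) (A S : nat -> {set T}) r :
  (64 * (size fam + M) + 160)%N%:R * eps <= c -> 4 ^+ (2 * 2 + 3) * eps <= (c / 32) ^+ 2 -> c <= 1 ->
  (forall X, X \in fam -> c * n <= #|X|%:R) ->
  (forall q, (q < M)%N -> c * n <= #|S q|%:R) ->
  (forall i j, (i < 12)%N -> (j < 12)%N -> i != j -> [disjoint A i & A j]) ->
  (forall i j, (i < M)%N -> (j < M)%N -> i != j -> [disjoint S i & S j]) ->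
  (forall i j, (i < 12)%N -> (j < M)%N -> [disjoint A i & S j]) ->
  (forall i, (i < 12)%N -> r \notin A i) -> (forall q, (q < M)%N -> r \notin S q) ->
  (forall i, (i < 12)%N -> c * n <= #|A i|%:R /\ c * (p * n) <= #|nb G r :&: A i|%:R) ->
  exists a, [/\ absorbing G 2 a [set r], size a = (12 + 2 * M)%N,
    {in a, forall x, (exists2 i, (i < 12)%N & x \in A i) \/ (exists2 q, (q < M)%N & x \in S q)} &
    forall X, X \in fam -> rich G p 2 (c / 16) a X /\ rich G p 2 (c / 16) (rev a) X].
Proof.
move=> Hc Hc2 c1 famc Sc Ad Sd ASd rA rS HA.
(* Adding the sets [S q] makes the pairs of the backbone rich in them, so that the connections can
   start there. *)
pose fam' := fam ++ [seq S q | q <- iota 0 M].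
have sf : size fam' = (size fam + M)%N by rewrite size_cat size_map size_iota.
have famc' X : X \in fam' -> c * n <= #|X|%:R.
  rewrite mem_cat => /orP[/famc //|/mapP[q]]; rewrite mem_iota => qM ->.
  by apply: Sc; move: qM; clear; lia.
have Hc' : (64 * size fam' + 160)%N%:R * eps <= c by rewrite sf.
have c64 : 64 * eps <= c / 16.
  have : (64 * 16)%N%:R * eps <= c.
    apply: le_trans Hc; rewrite ler_wpM2r ?(ltW eps0) // ler_nat.
    by rewrite /mlen /ell /=; clear; lia.
  by rewrite natrM; lra.
have c0 : 0 < c by move: c64 eps0; lra.
have [s [w [[b1 b2 b3 [b4 b5 b6]] HB]]] := backbone_exists J Hc' famc' Ad HA.
have Hc4 : (16 * size fam' + 40)%N%:R * eps <= c / 4.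
  have E u v : (u * size fam' + v)%N%:R = u%:R * (size fam')%:R + v%:R :> R.
    by rewrite natrD natrM.
  by move: Hc'; rewrite !E; lra.
have famc4 X : X \in fam' -> c / 4 * n <= #|X|%:R.
  by move/famc'; have := mulr_gt0 c0 n0; lra.
have SF q : (q < M)%N -> S q \in fam'.
  by move=> qM; rewrite mem_cat; apply/orP; right; apply/mapP; exists q; rewrite ?mem_iota.
have pair i X : (i < 6)%N -> X \in fam' -> rich G p 2 (c / 16) [:: s i; w i] X.
  move=> i6 XF; have [_ _ wf sp] := HB i i6.
  have := paired_rich J Hc4 famc4 wf sp XF.
  by have -> : c / 4 / 4 = c / 16 by field.
have pr i : (i < 6)%N -> G (s i) (w i).
  case: i => [|[|[|[|[|[|//]]]]]] _; rewrite ?(adj_sym G (s 3)).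
  - by move: b1 => /= /andP[/andP[]].
  - by move: b5 => /= /andP[/andP[]].
  - by move: b3 => /= /andP[/andP[]].
  - by move: b6 => /= /and4P[_ _ /andP[]].
  - by move: b6 => /= /andP[/andP[]].
  - by move: b2 => /= /andP[/andP[]].
have pr2 i : (i < 6)%N -> pw G 2 [:: s i; w i] by move/pr => /= ->.
have pr3 i : (i < 6)%N -> pw G 2 [:: w i; s i] by move/pr; rewrite (adj_sym G) /= => ->.
have Hc3 : 4 ^+ (2 * 2 + 3) * eps <= (c / 16) ^+ 2.
  by apply: (le_trans Hc2); rewrite !expr2; move: (mulr_gt0 c0 c0); lra.
have [||z1 [sz1 pz1 Hz1]] := @connect R T G eps p 2 t0 p0 p1 eps0 (ju_eps4 J) isT n0 (ju_fa J)
  (ju_d1 J) (ju_d2 J) (c / 16) S [:: w 1; s 1] [:: s 5; w 5] Hc3 _ _ Sd erefl erefl (pr3 1%N isT)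
  (pr2 5%N isT) (fun q qM => pair 1%N _ isT (SF q qM)) (fun q qM => pair 5%N _ isT (SF q qM)).
- by move: c0; lra.
- by move: c1; lra.
(* The path [z1] has exactly one vertex in each [S q]; its removal costs at most half of the
   richness by [loss1]. *)
pose S' q := S q :\ nth t0 z1 q.
have S'S q : S' q \subset S q by apply: subsetDl.
have pair' i q : (i < 6)%N -> (q < M)%N -> rich G p 2 (c / 32) [:: s i; w i] (S' q).
  move=> i6 qM; have -> : c / 32 = c / 16 / 2 by field.
  apply: (rich_loss J) (pair i _ i6 (SF q qM)); first by move: c0; lra.
  exact: loss1 (ju_h J) eps0 c64.
have S'd i j : (i < M)%N -> (j < M)%N -> i != j -> [disjoint S' i & S' j].
  by move=> iM jM ij; apply: disjointW (S'S i) (S'S j) (Sd i j iM jM ij).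
have [||z2 [sz2 pz2 Hz2]] := @connect R T G eps p 2 t0 p0 p1 eps0 (ju_eps4 J) isT n0 (ju_fa J)
  (ju_d1 J) (ju_d2 J) (c / 32) S' [:: w 4; s 4] [:: s 2; w 2] Hc2 _ _ S'd erefl erefl (pr3 4%N isT)
  (pr2 2%N isT) (fun q qM => pair' 4%N q isT qM) (fun q qM => pair' 2%N q isT qM).
- by move: c0; lra.
- by move: c1; lra.
have Pa := pw_fullabs pz1 pz2 b1 b2 b3.
have Pa' := pw_fullabs' pz1 pz2 b4 b5 b6.
pose Ls := [:: w 0; w 1; w 2; w 3; w 4; w 5; s 0; s 1; s 2; s 3; s 4; s 5].
have Lsn i : (i < 12)%N -> nth t0 Ls i \in A i.
  case: i => [|[|[|[|[|[|[|[|[|[|[|[|//]]]]]]]]]]]] _ /=.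
  - by have [] := HB 0%N isT.
  - by have [] := HB 1%N isT.
  - by have [] := HB 2%N isT.
  - by have [] := HB 3%N isT.
  - by have [] := HB 4%N isT.
  - by have [] := HB 5%N isT.
  - by have [] := HB 0%N isT.
  - by have [] := HB 1%N isT.
  - by have [] := HB 2%N isT.
  - by have [] := HB 3%N isT.
  - by have [] := HB 4%N isT.
  - by have [] := HB 5%N isT.
have pe := perm_abs12 s w z1 z2.
have inL x : x \in Ls -> exists2 i, (i < 12)%N & x \in A i.
  by move=> xL; exists (index x Ls); rewrite ?index_mem // -{1}(nth_index t0 xL) Lsn // index_mem.
have inz (z : seq T) (S0 : nat -> {set T}) x : size z = M ->
    (forall q, (q < M)%N -> nth t0 z q \in S0 q) ->
    x \in z -> (index x z < M)%N /\ x \in S0 (index x z).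
  move=> sz Hz xz; have iM : (index x z < M)%N by rewrite -sz index_mem.
  by split => //; have := Hz _ iM; rewrite nth_index.
have inz1 x : x \in z1 -> exists2 q, (q < M)%N & x \in S q.
  by case/(inz z1 S x sz1 Hz1); exists (index x z1).
have inz2 x : x \in z2 -> exists2 q, (q < M)%N & x \in S' q.
  by case/(inz z2 S' x sz2 Hz2); exists (index x z2).
have uL : uniq Ls by apply: (@uniq_parts _ t0 A Ls).
have uz1 : uniq z1 by apply: (@uniq_parts _ t0 S z1); rewrite sz1.
have uz2 : uniq z2 by apply: (@uniq_parts _ t0 S' z2); rewrite sz2.
have ua : uniq (fullabs s w z1 z2).
  rewrite (perm_uniq pe) catA -[_ ++ [:: s 0; _; _; _; _; _]]/Ls !cat_uniq uL uz1 uz2 andbT /=.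
  apply/andP; split.
    apply/hasPn => x; rewrite mem_cat => xz; apply/negP => /inL[i i12 xA].
    have [q qM xS] : exists2 q, (q < M)%N & x \in S q.
      by case/orP: xz => [/inz1//|/inz2[q qM /(subsetP (S'S q))]]; exists q.
    exact: disjoint_mem (ASd i q i12 qM) xA xS.
  apply/hasPn => x xz2; apply/negP => xz1.
  have [q1M x1] := inz z1 S x sz1 Hz1 xz1; have [q2M] := inz z2 S' x sz2 Hz2 xz2.
  rewrite !inE => /andP[xn x2]; case: (eqVneq (index x z1) (index x z2)) => [E|ne].
    by move: xn; rewrite -E nth_index // eqxx.
  exact: disjoint_mem (Sd _ _ q1M q2M ne) x1 x2.
have ina x : x \in fullabs s w z1 z2 ->
    (exists2 i, (i < 12)%N & x \in A i) \/ (exists2 q, (q < M)%N & x \in S q).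
  rewrite (perm_mem pe) catA -[_ ++ [:: s 0; _; _; _; _; _]]/Ls !mem_cat.
  case/or3P => [/inL|/inz1|/inz2[q qM /(subsetP (S'S q))]]; [by left|by right|].
  by right; exists q.
have ra : r \notin fullabs s w z1 z2.
  apply/negP => /ina[[i i12 rAi]|[q qM rSq]]; first by move: (rA i i12); rewrite rAi.
  by move: (rS q qM); rewrite rSq.
have pb := perm_abs r s w z1 z2.
exists (fullabs s w z1 z2); split.
- apply: (absorbing_pair ua ra Pa _ pb Pa') => //.
    by rewrite /fullabs /fullabs' !catA !lastk_cat.
- by rewrite (perm_size pe) !size_cat /= sz1 sz2; clear; lia.
- exact: ina.
move=> X XF; have XF' : X \in fam' by rewrite mem_cat XF.
split.
  have -> : fullabs s w z1 z2 = [:: s 0; w 0] ++ drop 2 (fullabs s w z1 z2) by [].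
  by apply: rich_cat => //; exact: pair.
rewrite /fullabs !catA rev_cat.
have -> : rev [:: s 2; w 2; w 3; s 3] = [:: s 3; w 3] ++ [:: w 2; s 2] by [].
by rewrite -catA; apply: rich_cat => //; exact: pair.
Qed.

End Absorber2.

(** * The absorbing path *)

Definition piece_size k := (12 + 2 * mlen k)%N.

(** An upper bound for all demands on [eps] so far. The factor [16 ^ k] is the square of the loss
    [4 ^ k] in richness, and [1024] is [32 ^ 2] from the square absorber. *)
Definition big_const k f : nat :=
  ((64 * (f + mlen k) + 160) + greedy_const k k (2 * k) f + greedy_const k k.-1 (2 * k) f +
   4 ^ (2 * k + 3) * (1024 * 16 ^ k) + (piece_size k + mlen k) * 16 * 4 ^ k)%N.

Lemma big_const_ge k f : [/\ 64 * (f + mlen k) + 160 <= big_const k f,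
  greedy_const k k (2 * k) f <= big_const k f,
  greedy_const k k.-1 (2 * k) f <= big_const k f,
  4 ^ (2 * k + 3) * (1024 * 16 ^ k) <= big_const k f &
  (piece_size k + mlen k) * 16 * 4 ^ k <= big_const k f]%N.
Proof.
rewrite /big_const; move: (64 * _ + 160)%N (greedy_const _ _ _ _) (greedy_const _ _ _ _)
  (4 ^ (_ + _) * _)%N (_ * 4 ^ k)%N => a b d e g; split; lia.
Qed.

Section Absorber.
Variables (R : realFieldType) (T : finType) (G : sgraph T) (eps p : R).
Variables (k : nat) (t0 : T).
Hypothesis J : jumbled G eps p k.
Local Notation n := (#|T|%:R : R).
Local Notation rich := (rich G p k).
Local Notation absorbing := (absorbing G k).
Local Notation M := (mlen k).

Let p0 := ju_p0 J. Let p1 := ju_p1 J. Let eps0 := ju_eps0 J. Let n0 := ju_n0 J.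
Let k2 := ju_k2 J.

Section Consts.
Variables (c : R) (f : nat).
Hypothesis (c0 : 0 < c) (c1 : c <= 1).
Hypothesis Hc : (big_const k f)%:R * eps <= c ^+ 2.

Lemma big_le m : (m <= big_const k f)%N -> m%:R * eps <= c ^+ 2.
Proof.
by move=> mb; apply: le_trans Hc; rewrite ler_wpM2r ?(ltW eps0) // ler_nat.
Qed.

Lemma big_le1 m : (m <= big_const k f)%N -> m%:R * eps <= c.
Proof.
by move=> /big_le h; apply: (le_trans h); rewrite expr2 ler_piMl // ltW.
Qed.

Lemma big_connect : 4 ^+ (2 * k + 3) * eps <= (c / 4 ^+ k / 2 / 2) ^+ 2.
Proof.
have [_ _ _ /big_le] := big_const_ge k f.
rewrite !natrM !natrX => h _.
have -> : (c / 4 ^+ k / 2 / 2) ^+ 2 = c ^+ 2 / (16 * 16 ^+ k).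
  rewrite !exprMn !exprVn -exprM mulnC exprM; have -> : 4 ^+ 2 = 16 :> R by rewrite -natrX.
  have -> : 2 ^+ 2 = 4 :> R by rewrite -natrX.
  by field; rewrite gt_eqF // exprn_gt0.
have k16 : 0 < 16 ^+ k :> R by rewrite exprn_gt0.
rewrite ler_pdivlMr ?mulr_gt0 //; apply: le_trans h.
have : 0 <= 4 ^+ (2 * k + 3) * eps * 16 ^+ k by rewrite !mulr_ge0 ?exprn_ge0 // ltW.
lra.
Qed.

(** A bounded number of vertices is at most that multiple of [4 * (eps * p ^+ k * n)] by [ju_h],
    which is small against the least candidate sets. *)
Lemma big_loss m : (m <= piece_size k + M)%N -> m%:R <= c / 4 ^+ k / 2 / 2 * p ^+ k * n.
Proof.
move=> mb; have [_ _ _ _ /big_le1] := big_const_ge k f.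
rewrite 2!natrM natrX => h.
have pk0 : 0 < p ^+ k * n by rewrite mulr_gt0 // exprn_gt0.
have k4 : 0 < 4 ^+ k :> R by rewrite exprn_gt0.
apply: (@le_trans _ _ (piece_size k + M)%:R); first by rewrite ler_nat.
set K := (piece_size k + M)%:R in h *.
apply: (@le_trans _ _ (K * (4 * (eps * p ^+ k * n)))).
  by rewrite ler_peMr // ?ler0n // (ju_h J).
have -> : K * (4 * (eps * p ^+ k * n)) = (K * 4 * eps) * (p ^+ k * n) by ring.
rewrite -[leRHS]mulrA ler_wpM2r ?(ltW pk0) //.
have -> : c / 4 ^+ k / 2 / 2 = c / (4 * 4 ^+ k) by field; rewrite gt_eqF.
rewrite ler_pdivlMr ?mulr_gt0 //; apply: le_trans h.
by rewrite le_eqVlt; apply/orP; left; apply/eqP; ring.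
Qed.

End Consts.

Lemma rich_pow (c d : R) s X : 0 <= c -> d <= 4 ^+ k -> 0 < d -> rich (c / d) s X -> rich (c / 4 ^+ k) s X.
Proof.
move=> c0 d4 d0; apply: (rich_le J); rewrite ler_wpM2l // lef_pV2 ?posrE //.
exact: lt_le_trans d4.
Qed.

Lemma absorber (c : R) (fam : seq {set T}) (A S : nat -> {set T}) r :
  0 < c -> c <= 1 -> (big_const k (size fam))%:R * eps <= c ^+ 2 ->
  (forall X, X \in fam -> c * n <= #|X|%:R) ->
  (forall q, (q < M)%N -> c * n <= #|S q|%:R) ->
  (forall i j, (i < 12)%N -> (j < 12)%N -> i != j -> [disjoint A i & A j]) ->
  (forall i j, (i < M)%N -> (j < M)%N -> i != j -> [disjoint S i & S j]) ->
  (forall i j, (i < 12)%N -> (j < M)%N -> [disjoint A i & S j]) ->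
  (forall i, (i < 12)%N -> r \notin A i) -> (forall q, (q < M)%N -> r \notin S q) ->
  (forall i, (i < 12)%N -> c * n <= #|A i|%:R /\ c * (p * n) <= #|nb G r :&: A i|%:R) ->
  exists a, [/\ absorbing a [set r], (size a <= piece_size k)%N,
    {in a, forall x, (exists2 i, (i < 12)%N & x \in A i) \/ (exists2 q, (q < M)%N & x \in S q)} &
    forall X, X \in fam -> rich (c / 4 ^+ k) a X /\ rich (c / 4 ^+ k) (rev a) X].
Proof.
move=> c0 c1 Hc famc Sc Ad Sd ASd rA rS HA.
case: (eqVneq k 2%N) => [E|kn2].
  have J2 : jumbled G eps p 2 by rewrite -E.
  have M2 : mlen 2 = M by rewrite E.
  have [g1 _ _ g4 _] := big_const_ge k (size fam).
  have [||||||a [aa sa ain abt]] := absorber2 t0 J2 (fam := fam) (A := A) (S := S) (r := r) _ _ c1 famc _ Ad _ _ rA _ HA;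
    rewrite ?M2 //.
  - exact: (big_le1 c0 c1 Hc g1).
  - have := big_le Hc g4; rewrite !natrM !natrX => h.
    have -> : (c / 32) ^+ 2 = c ^+ 2 / 1024 by field.
    have -> : (2 * 2 + 3 = 2 * k + 3)%N by rewrite E.
    rewrite ler_pdivlMr //; apply: le_trans h.
    have -> : 4 ^+ (2 * k + 3) * eps * 1024 = 4 ^+ (2 * k + 3) * (1024 * 1) * eps by ring.
    rewrite ler_wpM2r ?(ltW eps0) // ler_wpM2l ?exprn_ge0 // ler_wpM2l //.
    by rewrite exprn_ege1 // ler1n.
  have E4 : 4 ^+ k = 16 :> R by rewrite E -natrX.
  exists a; split.
  - by move: aa; rewrite -E.
  - by rewrite sa /piece_size M2.
  - by move=> x /ain; rewrite M2.
  by move=> X XF; have := abt X XF; rewrite E4 -E.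
have k3 : (2 < k)%N by rewrite ltn_neqAle eq_sym kn2.
have [HA0 HN0] := HA 0%N isT.
have [|a [aa sa ain abt]] := absorber_big J k3 _ (subsetIl _ _) HN0 famc.
  by have [_ g2 _ _ _] := big_const_ge k (size fam); exact: (big_le1 c0 c1 Hc g2).
exists a; split => //.
- by rewrite sa /piece_size /mlen; clear; lia.
- by move=> x /ain; rewrite inE => /andP[_ xA]; left; exists 0%N.
move=> X /abt[h1 h2]; split.
  by apply: (rich_pow (ltW c0) _ _ h1); rewrite ?exprn_gt0 // lerXn2r ?nnegrE // ler_nat.
by apply: (rich_pow (ltW c0) _ _ h2); rewrite ?exprn_gt0 // lerXn2r ?nnegrE // ler_nat.
Qed.

End Absorber.

Section Build.
Variables (R : realFieldType) (T : finType) (G : sgraph T) (eps p : R).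
Variables (k : nat) (t0 : T).
Hypothesis J : jumbled G eps p k.
Local Notation n := (#|T|%:R : R).
Local Notation rich := (rich G p k).
Local Notation absorbing := (absorbing G k).
Local Notation M := (mlen k).

Let p0 := ju_p0 J. Let p1 := ju_p1 J. Let eps0 := ju_eps0 J. Let n0 := ju_n0 J.
Let k2 := ju_k2 J.

Definition mset (s : seq T) : {set T} := [set x in s].

Lemma card_mset s : (#|mset s| <= size s)%N.
Proof. by rewrite cardsE; apply: card_size. Qed.

Lemma in_mset s x : (x \in mset s) = (x \in s).
Proof. by rewrite inE. Qed.

Variables (c : R) (S : nat -> {set T}) (Cf : seq {set T}).
Hypotheses (c0 : 0 < c) (c1 : c <= 1).
Hypothesis Hc : (big_const k (M + size Cf))%:R * eps <= c ^+ 2.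
Hypothesis Sdis : forall i j, (i < M)%N -> (j < M)%N -> i != j -> [disjoint S i & S j].

Local Notation c' := (c / 4 ^+ k).

(* The end of the path can be prolonged through what is left of [S]; the sets in [Cf] are reserved
   for closing the cycle. *)
Definition open_path A D := [/\ absorbing A D,
  forall q, (q < M)%N -> rich (c' / 2) (rev A) (S q :\: mset A) &
  forall X, X \in Cf -> rich c' A X /\ rich c' (rev A) X].

Let c'0 : 0 < c'. Proof. by rewrite divr_gt0 // exprn_gt0. Qed.

Lemma loss_list (l : seq T) (X Y : {set T}) : X :\: Y \subset mset l ->
  (size l <= piece_size k + M)%N -> #|X :\: Y|%:R <= c' / 2 / 2 * p ^+ k * n.
Proof.
move=> sub sl; apply: (big_loss J c0 c1 Hc); apply: leq_trans sl.
by apply: leq_trans (card_mset l); apply: subset_leq_card.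
Qed.

Lemma half_loss : c' / 2 / 2 * p ^+ k * n <= c' / 2 * p ^+ k * n.
Proof. by rewrite !ler_wpM2r ?exprn_ge0 ?(ltW p0) //; move: c'0; lra. Qed.

(** The constant does not deteriorate under iteration: the new end is that of [a], which is rich
    with the full [c'] in what was left of [S], and only the boundedly many vertices of [z] and [a]
    are then lost, leaving [c' / 2]. *)
Lemma attach A D a Da : open_path A D -> absorbing a Da ->
  (forall q, (q < M)%N -> rich c' a (S q :\: mset A) /\ rich c' (rev a) (S q :\: mset A)) ->
  (forall X, X \in Cf -> rich c' a X /\ rich c' (rev a) X) ->
  (size a <= piece_size k)%N ->
  {in A, forall x, (x \notin a) /\ (x \notin Da)} -> {in a, forall x, x \notin D} ->
  [disjoint D & Da] -> (forall q, (q < M)%N -> [disjoint S q & D :|: Da]) ->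
  exists z, [/\ size z = M, forall q, (q < M)%N -> nth t0 z q \in S q :\: mset A :\: mset a &
    open_path (A ++ z ++ a) (D :|: Da)].
Proof.
move=> [HA SA CA] Ha Sa Ca sa Aa aD dD SD.
pose S' q := S q :\: mset A :\: mset a.
have S'S q : S' q \subset S q by rewrite /S' setDDl subsetDl.
have lossA q : #|(S q :\: mset A) :\: S' q|%:R <= c' / 2 / 2 * p ^+ k * n.
  apply: (@loss_list a); last by apply: leq_trans sa _; rewrite leq_addr.
  by apply/subsetP => x; rewrite /S' !inE; case: (x \in A); case: (x \in S q); case: (x \in a).
have [_ _ kA _ _] := HA; have [_ _ ka _ _] := Ha.
have S'A q : (q < M)%N -> rich (c' / 2 / 2) (rev A) (S' q).
  move=> qM; apply: (rich_loss J) (lossA q) (SA q qM); by rewrite divr_ge0 // ltW.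
have S'a q : (q < M)%N -> rich (c' / 2 / 2) a (S' q).
  move=> qM; apply: (rich_le J (c := c' / 2)); first by move: c'0; lra.
  apply: (rich_loss J (ltW c'0) _ (Sa q qM).1); exact: le_trans (lossA q) half_loss.
have Hcon : 4 ^+ (2 * k + 3) * eps <= (c' / 2 / 2) ^+ 2 by exact: (big_connect J Hc).
have cc1 : c' / 2 / 2 <= 1.
  have : c' <= 1.
    rewrite ler_pdivrMr ?exprn_gt0 // mul1r; apply: (le_trans c1).
    by rewrite exprn_ege1 // ler1n.
  by move: c'0; lra.
have cc0 : 0 < c' / 2 / 2 by move: c'0; lra.
have S'd i j : (i < M)%N -> (j < M)%N -> i != j -> [disjoint S' i & S' j].
  by move=> iM jM ij; apply: disjointW (S'S i) (S'S j) (Sdis iM jM ij).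
have [|z [sz Hz Hz']] := extend t0 J Hcon cc0 cc1 HA Ha S'A S'a S'd _ Aa aD dD.
  move=> q x qM; rewrite /S' !inE => /and3P[xa xA xS]; split => //.
  by have /disjoint_setI0/setP/(_ x) := SD q qM; rewrite !inE xS /= => ->.
exists z; split => //; split => //.
- move=> q qM; rewrite !rev_cat; apply: rich_cat; first by rewrite size_cat size_rev (leq_trans ka) // leq_addr.
  apply: rich_cat; first by rewrite size_rev.
  apply: (rich_loss J (ltW c'0) _ (Sa q qM).2); apply: le_trans half_loss.
  apply: (@loss_list (z ++ a)); last by rewrite size_cat sz addnC leq_add2r.
  apply/subsetP => x; rewrite !inE !mem_cat; case: (x \in A) => //=.
  by case: (x \in S q); rewrite ?andbT ?andbF ?negbK.
move=> X XF; split; first by apply: rich_cat => //; have [] := CA X XF.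
rewrite !rev_cat; apply: rich_cat; first by rewrite size_cat size_rev (leq_trans ka) // leq_addr.
by apply: rich_cat; [rewrite size_rev|have [] := Ca X XF].
Qed.

Hypothesis Cfc : forall X, X \in Cf -> c * n <= #|X|%:R.

Lemma fam_split (A : seq T) a : (forall X, X \in [seq S q :\: mset A | q <- iota 0 M] ++ Cf ->
    rich c' a X /\ rich c' (rev a) X) ->
  (forall q, (q < M)%N -> rich c' a (S q :\: mset A) /\ rich c' (rev a) (S q :\: mset A)) /\
  (forall X, X \in Cf -> rich c' a X /\ rich c' (rev a) X).
Proof.
move=> H; split => [q qM|X XF]; apply: H; rewrite mem_cat ?XF ?orbT //.
by apply/orP; left; apply/mapP; exists q; rewrite ?mem_iota.
Qed.

Lemma size_fam A : size ([seq S q :\: mset A | q <- iota 0 M] ++ Cf) = (M + size Cf)%N.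
Proof. by rewrite size_cat size_map size_iota. Qed.

Lemma card_parts A m q : (size A <= m)%N -> c * n + m%:R <= #|S q|%:R ->
  c * n <= #|S q :\: mset A|%:R.
Proof.
move=> sA h; have := card_rem R (S q) (mset A).
have : #|mset A|%:R <= m%:R :> R by rewrite ler_nat (leq_trans (card_mset A)).
by move: h; lra.
Qed.

Lemma fam_card A : (forall q, (q < M)%N -> c * n <= #|S q :\: mset A|%:R) ->
  forall X, X \in [seq S q :\: mset A | q <- iota 0 M] ++ Cf -> c * n <= #|X|%:R.
Proof.
move=> Sc X; rewrite mem_cat => /orP[/mapP[q]|/Cfc //].
by rewrite mem_iota add0n => /andP[_ qM] ->; apply: Sc.
Qed.

Lemma insert_piece' A v (Y : {set T}) :
  (forall q, (q < M)%N -> c * n <= #|S q :\: mset A|%:R) ->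
  Y \subset nb G v -> c * (p * n) <= #|Y|%:R ->
  exists a, [/\ absorbing a set0, size a = (2 * k).+1, v \in a,
    {in a, forall x, x = v \/ x \in Y} &
   (forall q, (q < M)%N -> rich c' a (S q :\: mset A) /\ rich c' (rev a) (S q :\: mset A)) /\
   (forall X, X \in Cf -> rich c' a X /\ rich c' (rev a) X)].
Proof.
move=> Sc Yv HY; have fc := fam_card Sc.
have [_ _ g3 _ _] := big_const_ge k (M + size Cf).
have [|a [aa sa va ain abt]] := insert_piece J (fam := [seq S q :\: mset A | q <- iota 0 M] ++ Cf) _ Yv HY fc.
  by rewrite size_fam; apply: (big_le1 J c0 c1 Hc g3).
exists a; split => //; apply: fam_split => X /abt[h1 h2].
by split; [apply: (rich_pow J (ltW c0) _ _ h1)|apply: (rich_pow J (ltW c0) _ _ h2)];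
  rewrite ?exprn_gt0 // lerXn2r ?nnegrE // ler_nat.
Qed.

Lemma size_piece_insert : ((2 * k).+1 <= piece_size k)%N.
Proof. by rewrite /piece_size /mlen; clear; lia. Qed.

Lemma insert_one A v (Y : {set T}) D : open_path A D ->
  (forall q, (q < M)%N -> c * n <= #|S q :\: mset A|%:R) ->
  Y \subset nb G v -> c * (p * n) <= #|Y|%:R -> v \notin A -> v \notin D ->
  (forall x, x \in Y -> x \notin A /\ x \notin D) ->
  (forall q, (q < M)%N -> [disjoint S q & D]) ->
  exists z a, [/\ size z = M, forall q, (q < M)%N -> nth t0 z q \in S q :\: mset A :\: mset a,
    size a = (2 * k).+1 /\ v \in a, {in a, forall x, x = v \/ x \in Y} &
    open_path (A ++ z ++ a) D].
Proof.
move=> HA Sc Yv HY vA vD YA SD.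
have [a [aa sa va ain [a1 a2]]] := insert_piece' Sc Yv HY.
have [|||||z [sz Hz HO]] := attach HA aa a1 a2 _ _ _ _ _.
- by rewrite sa size_piece_insert.
- move=> x xA; rewrite inE; split => //; apply/negP => /ain[E|/YA[]]; last by rewrite xA.
  by move: vA; rewrite -E xA.
- by move=> x /ain[->|/YA[]].
- by rewrite -setI_eq0 setI0.
- by move=> q qM; rewrite setU0; apply: SD.
by rewrite setU0 in HO; exists z, a; split.
Qed.

Lemma open_start v : c * (p * n) <= #|nb G v|%:R ->
  (forall q, (q < M)%N -> c * n <= #|S q|%:R) ->
  exists a, open_path a set0 /\ size a = (2 * k).+1.
Proof.
move=> Hv Sc.
have [|a [aa sa va ain [a1 a2]]] := @insert_piece' [::] v _ _ (subxx (nb G v)) Hv.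
  by move=> q qM; rewrite (_ : mset [::] = set0) ?setD0; [apply: Sc|apply/setP => x; rewrite !inE].
exists a; split => //; split => // q qM.
apply: (rich_loss J (ltW c'0) _ (a1 q qM).2); apply: le_trans half_loss.
apply: (@loss_list a).
  by apply/subsetP => x; rewrite !inE; case: (x \in S q); rewrite ?andbF ?andbT ?negbK //.
by apply: leq_trans (leq_addr _ _); rewrite sa size_piece_insert.
Qed.

End Build.

Section Phases.
Variables (R : realFieldType) (T : finType) (G : sgraph T) (eps p : R).
Variables (k : nat) (t0 : T).
Hypothesis J : jumbled G eps p k.
Local Notation n := (#|T|%:R : R).
Local Notation rich := (rich G p k).
Local Notation M := (mlen k).

Let p0 := ju_p0 J. Let p1 := ju_p1 J. Let eps0 := ju_eps0 J. Let n0 := ju_n0 J.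
Let k2 := ju_k2 J.

Variables (c : R) (S : nat -> {set T}) (Cf : seq {set T}).
Hypotheses (c0 : 0 < c) (c1 : c <= 1).
Hypothesis Hc : (big_const k (M + size Cf))%:R * eps <= c ^+ 2.
Hypothesis Sdis : forall i j, (i < M)%N -> (j < M)%N -> i != j -> [disjoint S i & S j].
Hypothesis Cfc : forall X, X \in Cf -> c * n <= #|X|%:R.

Local Notation open_path := (open_path G p k c S Cf).

Definition ins_size := ((2 * k).+1 + M)%N.

(** This serves the vertices that the reservoir could not handle later; each is inserted through its
    own whole neighbourhood, which the minimum degree makes large. *)
Lemma insert_all (B : {set T}) :
  (forall q, (q < M)%N -> c * n + ((#|B|.+1) * ins_size)%N%:R <= #|S q|%:R) ->
  (forall v, c * (p * n) + ((#|B|.+1) * ins_size)%N%:R <= #|nb G v|%:R) ->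
  exists A, [/\ open_path A set0, B \subset mset A & (size A <= #|B|.+1 * ins_size)%N].
Proof.
set L := (#|B|.+1 * ins_size)%N => Sc Hv.
have H m : (m <= #|B|)%N -> exists A, [/\ open_path A set0, (m <= #|B :&: mset A|)%N &
    (size A <= m.+1 * ins_size)%N].
  elim: m => [_|m IH mB].
    have h1 : c * (p * n) <= #|nb G t0|%:R by apply: le_trans (Hv t0); rewrite lerDl ler0n.
    have h2 q : (q < M)%N -> c * n <= #|S q|%:R.
      by move=> /Sc; apply: le_trans; rewrite lerDl ler0n.
    have [a [Ha sa]] := open_start J c0 c1 Hc Cfc h1 h2.
    by exists a; split => //; rewrite sa mul1n /ins_size leq_addr.
  have [A [HA BA sA]] := IH (ltnW mB).
  (* Vertices of [B] may already be covered as part of earlier pieces. *)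
  case: (leqP m.+1 #|B :&: mset A|) => mA.
    by exists A; split => //; apply: leq_trans sA _; rewrite leq_mul2r leqnSn orbT.
  have : (0 < #|B :\: mset A|)%N.
    by have := cardsID (mset A) B; move: mA mB; clear; lia.
  move=> /card_gt0P[b]; rewrite in_setD => /andP[bA bB].
  have sAL : (size A <= L)%N.
    by apply: leq_trans sA _; rewrite /L leq_mul2r ltnS (ltnW mB) orbT.
  have Yn : nb G b :\: mset A \subset nb G b by apply: subsetDl.
  have Yc : c * (p * n) <= #|nb G b :\: mset A|%:R.
    have := card_rem R (nb G b) (mset A); have := Hv b.
    have : #|mset A|%:R <= L%:R :> R by rewrite ler_nat (leq_trans (card_mset A)).
    by lra.
  have [||||z [a [sz Hz [sa va] ain HO]]] :=
      insert_one t0 J c0 c1 Hc Sdis Cfc HA (fun q qM => card_parts sAL (Sc q qM)) Yn Yc (v := b).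
  - by rewrite in_mset in bA.
  - by rewrite inE.
  - by move=> x; rewrite in_setD in_mset => /andP[-> _]; rewrite inE.
  - by move=> q _; rewrite -setI_eq0 setI0.
  exists (A ++ z ++ a); split => //.
    apply: (@leq_trans #|b |: (B :&: mset A)|).
      rewrite cardsU1 in_setI negb_and bA orbT add1n ltnS.
      exact: BA.
    apply: subset_leq_card; apply/subsetP => x.
    rewrite in_setU1 !in_setI !in_mset !mem_cat => /orP[/eqP ->|/andP[-> ->] //].
    by rewrite bB va !orbT.
  have E : (M + (2 * k).+1 = ins_size)%N by rewrite addnC.
  by rewrite !size_cat sz sa E mulSn [leqRHS]addnC leq_add2r.
have [A [HA BA sA]] := H _ (leqnn _).
exists A; split => //; apply/setIidPl/eqP.
by rewrite eqEcard subsetIl BA.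
Qed.

Variables (Z : nat -> {set T}) (W : {set T}) (A0 : seq T) (L : nat).
Definition abs_size := (M + piece_size k)%N.
Hypothesis Zdis : forall i j, (i < 12)%N -> (j < 12)%N -> i != j -> [disjoint Z i & Z j].
Hypothesis ZS : forall i q, (i < 12)%N -> (q < M)%N -> [disjoint Z i & S q].
Hypothesis WZ : forall i, (i < 12)%N -> [disjoint W & Z i].
Hypothesis WS : forall q, (q < M)%N -> [disjoint W & S q].
Hypothesis Sc : forall q, (q < M)%N -> c * n + (L + #|W| * abs_size)%N%:R <= #|S q|%:R.
Hypothesis Zc : forall i, (i < 12)%N -> 2 * c * n + (L + #|W| * abs_size)%N%:R <= #|Z i|%:R.

(** The condition on [mset A :&: W] says that absorbers take no vertices of the reservoir; only the
    initial path [A0] may contain some. *)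
Definition abs_inv A D := [/\ open_path A D, D \subset W, mset A0 \subset mset A,
  mset A :&: W \subset mset A0 & (size A <= L + #|D| * abs_size)%N].

Let sizeL A D : abs_inv A D -> (size A <= L + #|W| * abs_size)%N.
Proof.
case=> _ DW _ _ sA; apply: leq_trans sA _; rewrite leq_add2l leq_mul2r.
by rewrite subset_leq_card ?orbT.
Qed.

Lemma Z_left A D i : abs_inv A D -> (i < 12)%N -> 2 * c * n <= #|Z i :\: mset A|%:R.
Proof.
move=> HA i12; have sA := sizeL HA.
have := card_rem R (Z i) (mset A).
have : #|mset A|%:R <= (L + #|W| * abs_size)%N%:R :> R.
  by rewrite ler_nat (leq_trans (card_mset A)).
by move: (Zc i12); lra.
Qed.

Lemma abs_one A D r : abs_inv A D -> r \in W -> r \notin A -> r \notin D ->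
  (forall i, (i < 12)%N -> r \notin atyp G p (Z i :\: mset A)) ->
  exists A', abs_inv A' (r |: D).
Proof.
move=> HI rW rA rD rt; have [HA DW A0A AW sA] := HI.
have sAL := sizeL HI.
have [[_ _ _ AD _] SA CA] := HA.
pose Z' i := Z i :\: mset A; pose S' q := S q :\: mset A.
have Z'Z i : Z' i \subset Z i by apply: subsetDl.
have S'S i : S' i \subset S i by apply: subsetDl.
have cn : 0 < c * n by rewrite mulr_gt0.
have g : size ([seq S q :\: mset A | q <- iota 0 M] ++ Cf) = (M + size Cf)%N by exact: size_fam.
have [||||||||a [aa sa ain abt]] := absorber t0 J c0 c1 (fam := [seq S q :\: mset A | q <- iota 0 M] ++ Cf)
    (A := Z') (S := S') (r := r) _ (fam_card Cfc (fun q qM => card_parts sAL (Sc qM))) _ _ _ _ _ _ _.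
- by rewrite g.
- by move=> q qM; apply: card_parts sAL (Sc qM).
- by move=> i j i12 j12 ij; apply: disjointW (Z'Z i) (Z'Z j) (Zdis i12 j12 ij).
- by move=> i j iM jM ij; apply: disjointW (S'S i) (S'S j) (Sdis iM jM ij).
- by move=> i q i12 qM; apply: disjointW (Z'Z i) (S'S q) (ZS i12 qM).
- by move=> i i12; apply/negP => /(subsetP (Z'Z i)); exact: disjoint_mem (WZ i12) rW.
- by move=> q qM; apply/negP => /(subsetP (S'S q)); exact: disjoint_mem (WS qM) rW.
- move=> i i12; have h := Z_left HI i12; split; first by move: h cn; rewrite -mulrA; lra.
  apply: le_trans (natypP (rt i i12)); have := ler_wpM2l (ltW p0) h; lra.
have [a1 a2] := fam_split abt.
have inA x : x \in a -> x \notin A /\ x \notin W.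
  case/ain => -[i i12]; rewrite in_setD in_mset => /andP[xA xi]; split => //;
    apply/negP => xW.
    exact: disjoint_mem (WZ i12) xW xi.
  exact: disjoint_mem (WS i12) xW xi.
have [||||z [sz Hz HO]] := attach t0 J c0 c1 Hc Sdis HA aa a1 a2 sa.
- move=> x xA; rewrite in_set1; split; last by apply: contraNneq rA => <-.
  by apply/negP => /inA[]; rewrite xA.
- by move=> x /inA[_]; apply: contra => /(subsetP DW).
- by rewrite disjoint_sym disjoints1.
- by move=> q qM; rewrite disjoint_sym; apply: (disjointWl _ (WS qM)); rewrite subUset DW sub1set.
have zin x : x \in z -> exists2 q, (q < M)%N & x \in S q.
  move=> xz; have iM : (index x z < M)%N by rewrite -sz index_mem.
  exists (index x z) => //; have := Hz _ iM; rewrite nth_index //.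
  by rewrite in_setD => /andP[_]; rewrite in_setD => /andP[].
exists (A ++ z ++ a); split.
- by rewrite setUC in HO.
- by rewrite subUset sub1set rW.
- by apply: (subset_trans A0A); apply/subsetP => x; rewrite !in_mset mem_cat => ->.
- apply/subsetP => x; rewrite in_setI in_mset !mem_cat => /andP[/or3P[xA|xz|/inA[_ xnW]] xW].
  + by apply: (subsetP AW); rewrite in_setI in_mset xA.
  + by have [q qM xS] := zin x xz; case: (disjoint_mem (WS qM) xW xS).
  + by rewrite xW in xnW.
rewrite !size_cat sz cardsU1 rD mulnDl mul1n addnA addnAC addnA.
have : (M + size a <= abs_size)%N by rewrite leq_add2l.
move: sA sa; rewrite /abs_size; clear.
move: (size A) (size a) (#|D|) => u v w; move: (M) (piece_size k) => m K.
by rewrite mulnDr; nia.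
Qed.

(** Absorbers are added until none can be. A vertex still missing is then atypical for what is left
    of some [Z i], which happens for at most [eps p^k n] vertices for each of the twelve sets. *)
Lemma absorb_all : open_path A0 set0 -> (size A0 <= L)%N ->
  (forall i A D, (i < 12)%N -> abs_inv A D ->
     #|atyp G p (Z i :\: mset A)|%:R <= eps * p ^+ k * n) ->
  exists A D, abs_inv A D /\ #|W :\: D :\: mset A|%:R <= 12 * (eps * p ^+ k * n).
Proof.
move=> H0 s0 fa.
have I0 : abs_inv A0 set0.
  by split; rewrite ?sub0set ?subsetIl // cards0 mul0n addn0.
have H j : forall A D, abs_inv A D -> (#|W| - #|D| <= j)%N ->
    exists A D, abs_inv A D /\ #|W :\: D :\: mset A|%:R <= 12 * (eps * p ^+ k * n).
  elim: j => [|j IH] A D HI Hj.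
    exists A, D; split => //; have [_ DW _ _ _] := HI.
    have -> : W = D by apply/eqP; rewrite eq_sym eqEcard DW -subn_eq0 -leqn0.
    by rewrite setDv set0D cards0 !mulr_ge0 ?exprn_ge0 ?ler0n // ltW.
  have [[r rW [rA rD rt]]|N] := pselect (exists2 r, r \in W & [/\ r \notin A, r \notin D &
      forall i, (i < 12)%N -> r \notin atyp G p (Z i :\: mset A)]).
    have [A' HA'] := abs_one HI rW rA rD rt; apply: (IH _ _ HA').
    have : (#|r |: D| <= #|W|)%N.
      by have [_ DW _ _ _] := HA'; apply: subset_leq_card.
    by move: Hj; rewrite cardsU1 rD; clear; lia.
  exists A, D; split => //.
  have sub : W :\: D :\: mset A \subset
      [set x | has (fun i => x \in atyp G p (Z i :\: mset A)) (iota 0 12)].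
    apply/subsetP => x; rewrite !in_setD in_mset => /and3P[xA xD xW]; rewrite in_set.
    apply: contrapT => /negP/hasPn h; apply: N; exists x => //; split => // i i12.
    by apply: h; rewrite mem_iota.
  apply: (@le_trans _ _ #|[set x | has (fun i => x \in atyp G p (Z i :\: mset A)) (iota 0 12)]|%:R).
    by rewrite ler_nat subset_leq_card.
  have : forall s : seq nat, {subset s <= iota 0 12} ->
      #|[set x | has (fun i => x \in atyp G p (Z i :\: mset A)) s]|%:R <= (size s)%:R * (eps * p ^+ k * n).
    elim=> [|i s IHs] sub' /=.
      by rewrite mul0r eq_card0 // => x; rewrite in_set.
    have -> : [set x | (x \in atyp G p (Z i :\: mset A)) || has (fun i => x \in atyp G p (Z i :\: mset A)) s]
      = atyp G p (Z i :\: mset A) :|: [set x | has (fun i => x \in atyp G p (Z i :\: mset A)) s].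
      by apply/setP => x; rewrite in_setU !in_set.
    have h1 := IHs (fun x xs => sub' x (mem_behead (s := i :: s) xs)).
    have h2 : #|atyp G p (Z i :\: mset A)|%:R <= eps * p ^+ k * n.
      apply: (fa i A D) => //; have := sub' i (mem_head _ _).
      by rewrite mem_iota.
    rewrite -natr1 mulrDl mul1r addrC; apply: le_trans (lerD h2 h1).
    by rewrite -natrD ler_nat leq_card_setU.
  by move/(_ (iota 0 12)); rewrite size_iota; apply.
by apply: H I0 (leqnn _).
Qed.

End Phases.

(** * Counting long paths *)

Lemma count_tuples (R : realFieldType) (T : finType) (good : pred (seq T)) (m : nat -> R) N :
  good [::] -> (forall i, (i < N)%N -> 0 <= m i) ->
  (forall q, (size q < N)%N -> good q -> m (size q) <= #|[set v | good (v :: q)]|%:R) ->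
  \prod_(i < N) m i <= #|[set t : N.-tuple T | good t]|%:R.
Proof.
elim: N => [|N IH] g0 m0 H.
  rewrite big_ord0 ler1n; apply/card_gt0P; exists [tuple].
  by rewrite inE.
rewrite big_ord_recr /=.
pose P := [set x : N.-tuple T * T | good x.1 && good (x.2 :: x.1)].
have cP : #|P|%:R = \sum_(t in [set t : N.-tuple T | good t]) #|[set v | good (v :: t)]|%:R :> R.
  rewrite -natr_sum; congr (_%:R); rewrite -sum1_card.
  under [RHS]eq_bigr do rewrite -sum1_card.
  rewrite pair_big_dep /=; apply: eq_bigl => -[t v] /=.
  by rewrite !inE.
apply: (@le_trans _ _ #|P|%:R); last first.
  pose f (x : N.-tuple T * T) := [tuple of x.2 :: x.1].
  have fi : injective f by move=> [t v] [t' v'] /(congr1 val)[-> /val_inj ->].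
  rewrite -(card_imset _ fi) ler_nat; apply: subset_leq_card; apply/subsetP => y.
  by move=> /imsetP[x]; rewrite !inE => /andP[_ H2] ->.
rewrite cP; apply: (@le_trans _ _ (\sum_(t in [set t : N.-tuple T | good t]) m N)).
  rewrite sumr_const -mulr_natl ler_wpM2r //; first exact: m0.
  by apply: IH => // [i iN|q qN]; [apply: m0|apply: H]; rewrite ltnW // ltnS.
apply: ler_sum => t; rewrite inE => gt.
have := H t; rewrite size_tuple => /(_ (ltnSn N) gt); apply: le_trans.
by [].
Qed.

Lemma bernoulli_le (R : realFieldType) (g : R) m : 0 <= g -> g <= 1 -> 1 - m%:R * g <= (1 - g) ^+ m.
Proof.
move=> g0 g1; elim: m => [|m IH]; first by rewrite mul0r subr0 expr0.
rewrite exprSr; apply: (@le_trans _ _ ((1 - m%:R * g) * (1 - g))).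
  rewrite -natr1; have : 0 <= m%:R * g * g by rewrite !mulr_ge0 ?ler0n.
  by lra.
by rewrite ler_wpM2r // subr_ge0.
Qed.

Section LongPath.
Variables (R : realFieldType) (T : finType) (G : sgraph T) (eps p : R).
Variables (k : nat).
Hypothesis J : jumbled G eps p k.
Local Notation n := (#|T|%:R : R).

Let p0 := ju_p0 J. Let p1 := ju_p1 J. Let eps0 := ju_eps0 J. Let n0 := ju_n0 J.
Let k2 := ju_k2 J.

Variables (U : {set T}) (fam : seq {set T}) (c g lam : R).

Definition left q := U :\: mset q.

(* The newest vertex comes first. *)
Definition good_path q := [/\ uniq q, {subset q <= U}, pw G k q,
  forall l, (l <= k)%N ->
    (1 - g) ^+ l * p ^+ l * #|left q|%:R <= #|cN G (take l q) :&: left q|%:R &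
  forall S, S \in fam -> forall i l, (l <= k)%N ->
      c * (p / 2) ^+ l * n <= #|cN G (take l (drop i q)) :&: S|%:R].

Hypotheses (g0 : 0 < g) (gk : g * (2 * k.+1)%N%:R <= 1) (lam0 : 0 < lam) (c0 : 0 < c).
Hypothesis fag : few_atypical G eps p g k.-1.
Hypothesis elam : 20 * eps <= lam * g.
Hypothesis flam : (k + k * size fam)%N%:R * eps * 2 <= lam * g.
Hypothesis ec : (20 * 2 ^ k)%N%:R * eps <= c.
Hypothesis famc : forall S, S \in fam -> c * n <= #|S|%:R.

Let g1 : g <= 1.
Proof.
apply: le_trans gk; rewrite ler_peMr ?(ltW g0) // ler1n muln_gt0 //.
Qed.

Let omg : 0 <= 1 - g. Proof. by rewrite subr_ge0. Qed.
Let omg1 : 1 - g <= 1. Proof. by move: g0; lra. Qed.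

Let half_pow m : (m <= k)%N -> 1 / 2 <= (1 - g) ^+ m.
Proof.
move=> mk; apply: le_trans (bernoulli_le m (ltW g0) g1).
have : m%:R * g <= 1 / 2.
  apply: (@le_trans _ _ (k.+1%:R * g)).
    by rewrite ler_wpM2r ?(ltW g0) // ler_nat ltnW.
  by move: gk; rewrite natrM; lra.
by lra.
Qed.

Lemma left_cons v q : left (v :: q) = left q :\ v.
Proof. by apply/setP => x; rewrite !inE negb_or; case: eqP; case: (x \in q). Qed.

Lemma good_nil : good_path [::].
Proof.
split=> // [l lk|S SF i l lk].
  rewrite cN_nil setTI ler_piMl // mulr_ile1 ?exprn_ge0 ?exprn_ile1 ?(ltW p0) //.
rewrite cN_nil setTI; apply: le_trans (famc SF); rewrite ler_wpM2r //.
rewrite ler_piMr ?(ltW c0) // exprn_ile1 //; first by move: p0; lra.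
by move: p1 p0; lra.
Qed.

Lemma card_left q : uniq q -> {subset q <= U} -> #|left q| = (#|U| - size q)%N.
Proof.
move=> uq qU; rewrite /left cardsD; congr (_ - _)%N.
have -> : U :&: mset q = mset q by apply/setIidPr/subsetP => x; rewrite in_mset => /qU.
by rewrite cardsE; apply/card_uniqP.
Qed.

Definition gbad (X : {set T}) := [set v | #|nb G v :&: X|%:R < (1 - g) * p * #|X|%:R].

Lemma good_ext q v : good_path q -> v \in cN G (take k q) :&: left q ->
  (forall l, (l < k)%N -> v \notin gbad (cN G (take l q) :&: left q)) ->
  (forall S l, S \in fam -> (l < k)%N -> v \notin atyp G p (cN G (take l q) :&: S)) ->
  good_path (v :: q).
Proof.
move=> [uq qU pq Hq Fq]; rewrite !inE => /and3P[vc vq vU] vg va.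
have ph : 0 <= p / 2 by rewrite divr_ge0 // ltW.
split.
- by rewrite /= vq.
- by move=> x; rewrite inE => /orP[/eqP -> //|/qU].
- by rewrite /= pq andbT; apply/allP => x xq; rewrite (adj_sym G); apply: (allP vc).
- have lle : #|left (v :: q)|%:R <= #|left q|%:R :> R.
    by rewrite left_cons ler_nat subset_leq_card // subsetDl.
  case=> [|l] lk; first by rewrite take0 cN_nil setTI !expr0 !mul1r.
  have -> : cN G (take l.+1 (v :: q)) :&: left (v :: q) = nb G v :&: (cN G (take l q) :&: left q).
    rewrite cN_takeS left_cons; apply/setP => x; rewrite !in_setI in_setD1.
    by case: (eqVneq x v) => [->|_] //=; rewrite in_set (adj_irrefl G).
  apply: (@le_trans _ _ ((1 - g) * p * #|cN G (take l q) :&: left q|%:R)).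
    apply: (@le_trans _ _ ((1 - g) * p * ((1 - g) ^+ l * p ^+ l * #|left q|%:R))).
      have -> : (1 - g) ^+ l.+1 * p ^+ l.+1 * #|left (v :: q)|%:R =
         (1 - g) * p * ((1 - g) ^+ l * p ^+ l * #|left (v :: q)|%:R) by rewrite !exprS; ring.
      by rewrite ler_wpM2l ?mulr_ge0 ?exprn_ge0 ?(ltW p0) // ler_wpM2l ?mulr_ge0 ?exprn_ge0 ?(ltW p0).
    by rewrite ler_wpM2l ?mulr_ge0 ?(ltW p0) // Hq // ltnW.
  by have := vg l lk; rewrite inE -leNgt.
move=> S SF [|i] [|l] lk.
- by have := Fq S SF 0%N 0%N isT; rewrite !take0.
- rewrite drop0 cN_takeS; apply: (half_step p0 (va S l SF lk)).
  by have := Fq S SF 0%N l (ltnW lk); rewrite drop0.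
- exact: Fq S SF i 0%N lk.
- exact: Fq S SF i l.+1 lk.
Qed.

Lemma good_count q : good_path q -> lam * n <= (#|U| - size q)%N%:R ->
  (1 - g) ^+ k.+1 * p ^+ k * (#|U| - size q)%N%:R <= #|[set v | `[< good_path (v :: q) >]]|%:R.
Proof.
move=> Hg Hu; have [uq qU pq Hq Fq] := Hg; rewrite -(card_left uq qU) in Hu *.
set u := #|left q|%:R in Hu *.
pose Bs := [seq gbad (cN G (take l q) :&: left q) | l <- iota 0 k] ++
  [seq atyp G p (cN G (take l q) :&: X) | X <- fam, l <- iota 0 k].
have kk : k.-1.+1 = k by rewrite prednK // ltnW.
have epk0 : 0 <= eps * p ^+ k * n by rewrite !mulr_ge0 ?exprn_ge0 // ltW.
have smallB B : B \in Bs -> #|B|%:R <= eps * p ^+ k * n.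
  have pl l : (l < k)%N -> p ^+ k.-1 <= p ^+ l.
    by move=> lk; rewrite ler_wiXn2l ?(ltW p0) // -ltnS kk.
  rewrite mem_cat => /orP[/mapP[l]|/allpairsP[[S l] /= [SF]]];
    rewrite mem_iota add0n => /andP[_ lk] ->.
    rewrite -[X in p ^+ X]kk; apply: fag.
    apply: le_trans (Hq l (ltnW lk)); rewrite -/u.
    apply: (@le_trans _ _ (1 / 2 * p ^+ k.-1 * (lam * n))).
      have -> : 10 / g * (eps * p ^+ k.-1 * n) = (20 * eps) * (p ^+ k.-1 * n / 2 / g) by field; rewrite gt_eqF.
      have -> : 1 / 2 * p ^+ k.-1 * (lam * n) = (lam * g) * (p ^+ k.-1 * n / 2 / g) by field; rewrite gt_eqF.
      by rewrite ler_wpM2r // !divr_ge0 ?mulr_ge0 ?exprn_ge0 ?(ltW p0) ?(ltW g0).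
    apply: ler_pM => //.
    - by rewrite mulr_ge0 ?exprn_ge0 // ?(ltW p0) //; lra.
    - by rewrite mulr_ge0 // ltW.
    apply: ler_pM; rewrite ?exprn_ge0 ?(ltW p0) ?pl //.
      by lra.
    exact: half_pow (ltnW lk).
  rewrite -[X in p ^+ X]kk; apply: (atyp_le (ju_fa J)).
  have := Fq S SF 0%N l (ltnW lk); rewrite drop0; apply: le_trans.
  rewrite mulrA ler_wpM2r // expr_div_n.
  have -> : c * (p ^+ l / 2 ^+ l) = c / 2 ^+ l * p ^+ l by ring.
  rewrite mulrA; apply: ler_pM; rewrite ?exprn_ge0 ?mulr_ge0 ?(ltW p0) ?(ltW eps0) ?pl //.
  rewrite ler_pdivlMr ?exprn_gt0 //; apply: le_trans ec.
  rewrite natrM natrX mulrAC ler_wpM2r ?(ltW eps0) // ler_wpM2l // ler_weXn2l ?ler1n //.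
  exact: ltnW.
have sB : size Bs = (k + k * size fam)%N.
  by rewrite size_cat size_map size_iota size_allpairs size_iota mulnC.
pose A := cN G (take k q) :&: left q.
have cA := Hq k (leqnn k); rewrite -/A -/u in cA.
have cBad : #|[set v | has (fun B => v \in (B : {set T})) Bs]|%:R <= (size Bs)%:R * (eps * p ^+ k * n).
  exact: (@card_has R T Bs id).
have sub : A :\: [set v | has (fun B => v \in (B : {set T})) Bs] \subset [set v | `[< good_path (v :: q) >]].
  apply/subsetP => v; rewrite in_setD in_set => /andP[/hasPn h vA]; rewrite in_set.
  apply/asboolP; apply: good_ext => // [l lk|S l SF lk]; apply: h; rewrite mem_cat; apply/orP.
    by left; apply/mapP; exists l; rewrite ?mem_iota.
  by right; apply/allpairsP; exists (S, l); rewrite mem_iota.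
apply: (@le_trans _ _ #|A :\: [set v | has (fun B => v \in (B : {set T})) Bs]|%:R); last first.
  by rewrite ler_nat subset_leq_card.
apply: le_trans (card_rem R _ _).
have pk0 : 0 < p ^+ k by rewrite exprn_gt0.
have h1 : (size Bs)%:R * (eps * p ^+ k * n) <= g * ((1 - g) ^+ k * p ^+ k * u).
  have f1 : (size Bs)%:R * eps * 2 * (p ^+ k * n) <= lam * g * (p ^+ k * n).
    by rewrite ler_wpM2r ?mulr_ge0 ?(ltW pk0) // sB.
  have f2 : (lam * n) * (g * p ^+ k) <= u * (g * p ^+ k).
    by rewrite ler_wpM2r // mulr_ge0 // ltW.
  have f3 : 1 / 2 * (g * p ^+ k * u) <= (1 - g) ^+ k * (g * p ^+ k * u).
    by rewrite ler_wpM2r ?half_pow // !mulr_ge0 // ltW.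
  by move: f1 f2 f3; lra.
rewrite exprSr; move: cA cBad h1; lra.
Qed.

Lemma count_paths N : (N <= #|U|)%N -> lam * n <= (#|U| - N)%N%:R ->
  ((1 - g) ^+ k.+1 * p ^+ k) ^+ N * (#|U| ^_ N)%:R <=
    #|[set t : N.-tuple T | `[< good_path t >]]|%:R.
Proof.
move=> NU Hl.
have H := @count_tuples R T (fun q => `[< good_path q >])
  (fun i => (1 - g) ^+ k.+1 * p ^+ k * (#|U| - i)%N%:R) N.
have -> : ((1 - g) ^+ k.+1 * p ^+ k) ^+ N * (#|U| ^_ N)%:R =
   \prod_(i < N) ((1 - g) ^+ k.+1 * p ^+ k * (#|U| - i)%N%:R).
  by rewrite big_split /= prodr_const card_ord ffact_prod natr_prod.
apply: H.
- by apply/asboolP; apply: good_nil.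
- by move=> i _; rewrite !mulr_ge0 ?exprn_ge0 // ltW.
move=> q qN /asboolP gq; apply: good_count => //; apply: (le_trans Hl).
by rewrite ler_nat leq_sub2l // ltnW.
Qed.

End LongPath.

(** * Completing a long path to a cycle *)

Section Finish.
Variables (R : realFieldType) (T : finType) (G : sgraph T) (eps p : R).
Variables (k : nat) (t0 : T).
Hypothesis J : jumbled G eps p k.
Local Notation n := (#|T|%:R : R).
Local Notation rich := (rich G p k).
Local Notation M := (mlen k).

Let p0 := ju_p0 J. Let p1 := ju_p1 J. Let eps0 := ju_eps0 J. Let n0 := ju_n0 J.
Let k2 := ju_k2 J.

Section Fill.
Variables (c : R) (S : nat -> {set T}) (Cf : seq {set T}).
Hypotheses (c0 : 0 < c) (c1 : c <= 1).
Hypothesis Hc : (big_const k (M + size Cf))%:R * eps <= c ^+ 2.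
Hypothesis Sdis : forall i j, (i < M)%N -> (j < M)%N -> i != j -> [disjoint S i & S j].
Hypothesis Cfc : forall X, X \in Cf -> c * n <= #|X|%:R.

Local Notation open_path := (open_path G p k c S Cf).

Lemma fill m (Ls Y0 : {set T}) E0 : (#|Ls| <= m)%N -> open_path E0 set0 ->
  (forall q, (q < M)%N -> c * n + (m * ins_size k)%N%:R <= #|S q :\: mset E0|%:R) ->
  exists X, [/\ open_path (E0 ++ X) set0,
    {in X, forall x, [\/ x \in Ls, x \in Y0 | exists2 q, (q < M)%N & x \in S q]},
    (size X <= m * ins_size k)%N &
    forall v, v \in Ls -> v \notin E0 ++ X ->
      #|nb G v :&: (Y0 :\: mset (E0 ++ X))|%:R < c * (p * n)].
Proof.
elim: m Ls E0 => [|m IH] Ls E0 sL HE HS.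
  exists [::]; rewrite cats0; split => // v.
  by move: sL; rewrite leqn0 cards_eq0 => /eqP ->; rewrite inE.
have [[v vL [vE hv]]|N] := pselect (exists2 v, v \in Ls & v \notin E0 /\
    c * (p * n) <= #|nb G v :&: (Y0 :\: mset E0)|%:R); last first.
  exists [::]; rewrite cats0; split => // v vL vE.
  by rewrite ltNge; apply/negP => h; apply: N; exists v.
have h1 q : (q < M)%N -> c * n <= #|S q :\: mset E0|%:R.
  by move=> /HS; apply: le_trans; rewrite lerDl ler0n.
have [|||z [a [sz Hz [sa va] ain HO]]] :=
  insert_one t0 J c0 c1 Hc Sdis Cfc HE h1 (subsetIl (nb G v) (Y0 :\: mset E0)) hv vE.
- by rewrite inE.
- by move=> x; rewrite in_setI in_setD in_mset => /and3P[_ -> _]; rewrite inE.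
- by move=> q _; rewrite -setI_eq0 setI0.
have zin x : x \in z -> exists2 q, (q < M)%N & x \in S q.
  move=> xz; have iM : (index x z < M)%N by rewrite -sz index_mem.
  exists (index x z) => //; have := Hz _ iM; rewrite nth_index //.
  by rewrite in_setD => /andP[_]; rewrite in_setD => /andP[].
have sza : size (z ++ a) = ins_size k by rewrite size_cat sz sa addnC.
have [||X [HX Xin sX HXv]] := IH (Ls :\ v) (E0 ++ z ++ a) _ HO.
- by move: sL; rewrite (cardsD1 v Ls) vL.
- move=> q qM; have := card_rem R (S q :\: mset E0) (mset (z ++ a)).
  have -> : S q :\: mset E0 :\: mset (z ++ a) = S q :\: mset (E0 ++ z ++ a).
    apply/setP => x; rewrite !in_setD !in_mset (mem_cat x E0) negb_or.
    by rewrite andbCA andbA.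
  have : #|mset (z ++ a)|%:R <= (ins_size k)%:R :> R by rewrite ler_nat -sza card_mset.
  by have := HS q qM; rewrite mulSn natrD; lra.
exists ((z ++ a) ++ X); rewrite catA; split=> //.

- move=> x; rewrite !mem_cat -!orbA => /or3P[/zin xz|/ain [->|]|/Xin[]].
  + by constructor 3.
  + by constructor 1.
  + by rewrite in_setI in_setD => /and3P[_ _ xY]; constructor 2.
  + by rewrite in_setD1 => /andP[_ xL]; constructor 1.
  + by move=> xY; constructor 2.
  + by move=> xS; constructor 3.
- by rewrite size_cat sza mulSn leq_add2l.
move=> w wL wE; apply: HXv => //; rewrite in_setD1 wL andbT.
by apply: contraNneq wE => ->; rewrite !mem_cat va !orbT.
Qed.

End Fill.

Lemma good_rich (U : {set T}) fam (c g : R) q S : good_path G p k U fam c g q ->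
  0 <= c -> (k <= size q)%N -> S \in fam -> rich (c / 4 ^+ k) q S /\ rich (c / 4 ^+ k) (rev q) S.
Proof.
case=> uq qU pq _ Hf c0 kq SF; have [h1 h2] := infix_rich p0 c0 (Hf S SF).
have h : 2 ^+ k <= 4 ^+ k :> R by rewrite lerXn2r ?nnegrE // ler_nat.
by split; apply: (rich_pow J c0 h); rewrite ?exprn_gt0 //; apply: h2.
Qed.


Section Close.
Variables (c g : R) (A : seq T) (D : {set T}) (Rf Cl : nat -> {set T}) (R0 R1 : {set T}).
Hypotheses (c0 : 0 < c) (c1 : c <= 1).
Hypothesis Hc : (big_const k (M + M))%:R * eps <= c ^+ 2.

Local Notation clo := [seq Cl q | q <- iota 0 M].
Local Notation fam := ([seq Rf q | q <- iota 0 M] ++ clo).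
Local Notation U := (~: (mset A :|: D)).
Local Notation good := (good_path G p k U fam c g).
Local Notation c' := (c / 4 ^+ k).

Hypothesis HA : absorbing G k A D.
Hypothesis AC : forall q, (q < M)%N -> rich c' A (Cl q) /\ rich c' (rev A) (Cl q).
Hypothesis Rdis : forall i j, (i < M)%N -> (j < M)%N -> i != j -> [disjoint Rf i & Rf j].
Hypothesis Cdis : forall i j, (i < M)%N -> (j < M)%N -> i != j -> [disjoint Cl i & Cl j].
Hypothesis Rsub : forall q, (q < M)%N -> Rf q \subset D.
Hypothesis Csub : forall q, (q < M)%N -> Cl q \subset D.
Hypothesis R0sub : R0 \subset D.
Hypothesis R1sub : R1 \subset D.
Hypothesis CR : forall i q, (i < M)%N -> (q < M)%N -> [disjoint Cl i & Rf q].
Hypothesis CR0 : forall i, (i < M)%N -> [disjoint Cl i & R0].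
Hypothesis CR1 : forall i, (i < M)%N -> [disjoint Cl i & R1].
Hypothesis R1R : forall q, (q < M)%N -> [disjoint R1 & Rf q].
Hypothesis R10 : [disjoint R1 & R0].
Variable m : nat.
Hypothesis Rc : forall q, (q < M)%N -> c * n + (2 * m * ins_size k)%N%:R <= #|Rf q|%:R.
Hypothesis Cc : forall q, (q < M)%N -> c * n <= #|Cl q|%:R.
Hypothesis R0c : 2 * c * n + (m * ins_size k)%N%:R <= #|R0|%:R.
Hypothesis R1c : forall v, v \in U ->
  c * (p * n) + (ins_size k)%:R * (eps * p ^+ k * n) <= #|nb G v :&: R1|%:R.

Local Notation open_path := (open_path G p k c Rf clo).

Let AD x : x \in A -> x \in D -> False.
Proof. by move: HA => [_ _ _ h _] /h /negP. Qed.

Let UD x : x \in U -> x \notin A /\ x \notin D.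
Proof. by rewrite in_setC in_setU in_mset negb_or => /andP[]. Qed.

Let clo_card X : X \in clo -> c * n <= #|X|%:R.
Proof. by move/mapP => [q]; rewrite mem_iota add0n => /andP[_ qM] ->; apply: Cc. Qed.

Let sclo : size clo = M. Proof. by rewrite size_map size_iota. Qed.
Let Hc' : (big_const k (M + size clo))%:R * eps <= c ^+ 2. Proof. by rewrite sclo. Qed.

Lemma good_open q : good q -> (k <= size q)%N -> open_path q set0.
Proof.
move=> Hg kq; have [uq qU pq _ _] := Hg.
have inR i : (i < M)%N -> Rf i \in fam.
  by move=> iM; rewrite mem_cat; apply/orP; left; apply/mapP; exists i; rewrite ?mem_iota.
split; first exact: absorbing_pathP.
- move=> i iM; have [_ h] := good_rich Hg (ltW c0) kq (inR i iM).
  have -> : Rf i :\: mset q = Rf i.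
    apply/setDidPl; rewrite disjoints_subset; apply/subsetP => x xR.
    rewrite in_setC in_mset; apply/negP => /qU /UD[_ /negP]; apply.
    exact: (subsetP (Rsub iM)).
  apply: (rich_le J _ h); have : 0 < c' by rewrite divr_gt0 // exprn_gt0.
  by lra.
by move=> X XC; apply: (good_rich Hg (ltW c0) kq); rewrite mem_cat XC orbT.
Qed.

(* Leftover vertices first go through [R0]; those that are atypical to what remains of [R0] are so
   few that the fresh set [R1] takes them all. *)
Lemma insert_leftovers q : good q -> (k <= size q)%N -> (#|U :\: mset q| <= m)%N ->
  exists X, [/\ open_path (q ++ X) set0, {subset U <= q ++ X},
    {in q ++ X, forall x, x \notin A} & forall i, (i < M)%N -> {in q ++ X, forall x, x \notin Cl i}].
Proof.
move=> Hg kq Lm; have [uq qU pq _ _] := Hg; set Ls := U :\: mset q in Lm.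
have H0 := good_open Hg kq.
have cn : 0 < c * n by rewrite mulr_gt0.
have Rq i : (i < M)%N -> Rf i :\: mset q = Rf i.
  move=> iM; apply/setDidPl; rewrite disjoints_subset; apply/subsetP => x xR.
  rewrite in_setC in_mset; apply/negP => /qU /UD[_ /negP]; apply.
  exact: (subsetP (Rsub iM)).
have S1 i : (i < M)%N -> c * n + (m * ins_size k)%N%:R <= #|Rf i :\: mset q|%:R.
  move=> iM; rewrite Rq //; apply: le_trans (Rc iM); rewrite lerD2l ler_nat -mulnA.
  exact: leq_pmull.
have [X1 [O1 X1in s1 X1v]] := fill c0 c1 Hc' Rdis clo_card R0 Lm H0 S1.
set E1 := q ++ X1 in O1 X1v.
pose L1 := Ls :\: mset E1.
have R0q : R0 :\: mset E1 = R0 :\: mset X1.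
  apply/setP => x; rewrite !in_setD !in_mset mem_cat; case xq: (x \in q) => //=.
  have [_ xD] := UD (qU x xq); have /negbTE -> : x \notin R0 by apply: contra xD; apply: (subsetP R0sub).
  by rewrite andbF.
have cR0 : 2 * c * n <= #|R0 :\: mset E1|%:R.
  rewrite R0q; have := card_rem R R0 (mset X1).
  have : #|mset X1|%:R <= (m * ins_size k)%N%:R :> R by rewrite ler_nat (leq_trans (card_mset X1)).
  by move: R0c; lra.
(* The first pass stops only at vertices atypical for what is left of [R0], and this remainder is
   large. *)
have cL1 : #|L1|%:R <= eps * p ^+ k * n.
  have k0 : (0 < k)%N by apply: ltn_trans k2.
  rewrite -(prednK k0); apply: le_trans (atyp_le (ju_fa J) (X := R0 :\: mset E1) _).
    rewrite ler_nat; apply: subset_leq_card; apply/subsetP => v; rewrite in_setD in_mset => /andP[vE vL].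
    rewrite in_set; apply: lt_le_trans (X1v v vL vE) _.
    by have := ler_wpM2l (ltW p0) cR0; lra.
  apply: le_trans cR0; have [h _ _ _ _] := big_const_ge k (M + M).
  have h20 : 20%:R * eps <= c.
    by apply: (big_le1 J c0 c1 Hc); apply: leq_trans h; clear; lia.
  have : eps * p ^+ k.-1 * n <= eps * n.
    rewrite ler_wpM2r // ler_piMr ?(ltW eps0) // exprn_ile1 // ltW //.
  have := ler_wpM2r (ltW n0) h20; move: cn; lra.
have L1m : (#|L1| <= m)%N by apply: leq_trans Lm; rewrite subset_leq_card // subsetDl.
have S2 i : (i < M)%N -> c * n + (#|L1| * ins_size k)%N%:R <= #|Rf i :\: mset E1|%:R.
  move=> iM.
  have -> : Rf i :\: mset E1 = Rf i :\: mset X1.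
    by rewrite -{2}(Rq i iM); apply/setP => x; rewrite !in_setD !in_mset mem_cat negb_or; case: (x \in q); case: (x \in X1).
  have := card_rem R (Rf i) (mset X1).
  have : #|mset X1|%:R <= (m * ins_size k)%N%:R :> R by rewrite ler_nat (leq_trans (card_mset X1)).
  have : (#|L1| * ins_size k)%N%:R <= (m * ins_size k)%N%:R :> R by rewrite ler_nat leq_mul2r L1m orbT.
  by have := Rc iM; rewrite -mulnA mul2n -addnn natrD; lra.
have [X2 [O2 X2in s2 X2v]] := fill c0 c1 Hc' Rdis clo_card R1 (leqnn _) O1 S2.
rewrite /E1 -catA in O2 X2v.
have Xin x : x \in q ++ X1 ++ X2 -> x \in U \/ exists2 Z, x \in (Z : {set T}) &
    Z \subset D /\ forall i, (i < M)%N -> [disjoint Cl i & Z].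
  rewrite !mem_cat => /or3P[/qU|/X1in[|xR|[i iM xR]]|/X2in[|xR|[i iM xR]]]; try by left.
  - by rewrite in_setD => /andP[_]; left.
  - by right; exists R0.
  - by right; exists (Rf i) => //; split; [apply: Rsub|move=> j jM; apply: CR].
  - by rewrite !in_setD => /and3P[_ _]; left.
  - by right; exists R1.
  - by right; exists (Rf i) => //; split; [apply: Rsub|move=> j jM; apply: CR].
exists (X1 ++ X2); split => //.
- move=> v vU; apply: contraT => vE.
  have vL1 : v \in L1.
    rewrite !in_setD !in_mset vU andbT; move: vE; rewrite /E1 !mem_cat !negb_or => /and3P[-> ->].
    by [].
  (* The second pass uses at most [ins_size k] vertices for each of the few vertices of [L1]. By
     [R1c] this cannot exhaust the neighbours of [v] in [R1], so no [v] is left out. *)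
  have vA := UD vU; have := X2v v vL1 vE; rewrite ltNge => /negP; case.
  have h := R1c vU.
  have : #|nb G v :&: R1|%:R <= #|nb G v :&: (R1 :\: mset (q ++ X1 ++ X2))|%:R + (size X2)%:R :> R.
    rewrite -natrD ler_nat; apply: leq_trans (leq_add (leqnn _) (card_mset X2)).
    apply: leq_trans (leq_card_setU _ _); apply: subset_leq_card; apply/subsetP => x.
    rewrite in_setI => /andP[xv xR]; rewrite in_setU in_setI in_setD !in_mset xv xR andbT /=.
    rewrite !mem_cat; case x2: (x \in X2); rewrite ?orbT // !orbF.
    apply/norP; split.
      by apply/negP => /qU/UD[_ /negP]; apply; apply: (subsetP R1sub).
    apply/negP => /X1in[|xR0|[i iM xRi]].
    + by rewrite in_setD => /andP[_ /UD[_ /negP]]; apply; apply: (subsetP R1sub).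
    + exact: disjoint_mem R10 xR xR0.
    + exact: disjoint_mem (R1R iM) xR xRi.
  have : (size X2)%:R <= (ins_size k)%:R * (eps * p ^+ k * n).
    apply: (@le_trans _ _ ((#|L1| * ins_size k)%N%:R)); first by rewrite ler_nat.
    by rewrite natrM mulrC ler_wpM2l.
  by move: h; lra.
- move=> x /Xin[/UD[] //|[Z xZ [ZD _]]]; apply/negP => /AD; apply; exact: (subsetP ZD).
move=> i iM x /Xin[/UD[_]|[Z xZ [_ dZ]]].
  by apply: contra; apply: (subsetP (Csub iM)).
by apply/negP => xC; apply: disjoint_mem (dZ i iM) xC xZ.
Qed.


(** The cycle is [E ++ z1 ++ A' ++ z2], with [q] in front so that it can be recovered by truncation.
    The connections are built for [A] and stay valid for [A'], which has the same ends. *)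
Lemma close_cycle q : good q -> (k <= size q)%N -> (#|U :\: mset q| <= m)%N ->
  exists cyc, [/\ uniq cyc, size cyc = #|T|, pw G k (cyc ++ take k cyc) & take (size q) cyc = q].
Proof.
move=> Hg kq Lm; have [X [[[uE pE kE _ _] _ EC] UE EA ECl]] := insert_leftovers Hg kq Lm.
set E := q ++ X in uE pE kE EC UE EA ECl.
have EE : E = q ++ X by [].
clearbody E.
have [uA pA kA _ abs] := HA.
have inC i : (i < M)%N -> Cl i \in clo by move=> iM; apply/mapP; exists i; rewrite ?mem_iota.
have c'0 : 0 < c' by rewrite divr_gt0 // exprn_gt0.
have c'1 : c' <= 1.
  by rewrite ler_pdivrMr ?exprn_gt0 // mul1r; apply: (le_trans c1); rewrite exprn_ege1 // ler1n.
have q0 : 0 < c' / 2 / 2 by move: c'0; lra.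
have q1 : c' / 2 / 2 <= 1 by move: c'0 c'1; lra.
have qc : c' / 2 / 2 <= c' by move: c'0; lra.
have hc : c' / 2 / 2 <= c' / 2 by move: c'0; lra.
have Hcon : 4 ^+ (2 * k + 3) * eps <= (c' / 2 / 2) ^+ 2 by exact: (big_connect J Hc).
have szl (s : seq T) : (k <= size s)%N -> size (lastk k s) = k by move=> ks; rewrite size_drop subKn.
have [||||z1 [sz1 pz1 z1in]] := connect t0 p0 p1 eps0 (ju_eps4 J) k2 n0 (ju_fa J)
  (ju_d1 J) (ju_d2 J) Hcon q0 q1 Cdis (szl E kE) (size_takel kA) _ _ _ _.
- exact: pw_drop.
- exact: pw_take.
- by move=> i iM; apply/rich_rev_lastk; apply: (rich_le J qc); have [] := EC _ (inC i iM).
- by move=> i iM; apply/rich_take; apply: (rich_le J qc); have [] := AC iM.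
have inz1 x : x \in z1 -> exists2 i, (i < M)%N & x \in Cl i.
  move=> xz; have iM : (index x z1 < M)%N by rewrite -sz1 index_mem.
  by exists (index x z1); rewrite // -{1}(nth_index t0 xz); apply: z1in.
pose Cl' i := Cl i :\: mset z1.
have Cl'd i j : (i < M)%N -> (j < M)%N -> i != j -> [disjoint Cl' i & Cl' j].
  by move=> iM jM ij; apply: disjointW (subsetDl _ _) (subsetDl _ _) (Cdis iM jM ij).
have lossC i : #|Cl i :\: Cl' i|%:R <= c' / 2 * p ^+ k * n.
  apply: le_trans (half_loss J c0).
  apply: (loss_list J c0 c1 Hc' (l := z1)).
    by apply/subsetP => x; rewrite !in_setD in_mset; case: (x \in z1); case: (x \in Cl i).
  by rewrite sz1 leq_addl.
have rich' s i : rich c' s (Cl i) -> rich (c' / 2 / 2) s (Cl' i).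
  by move=> h; apply: (rich_le J hc); apply: (rich_loss J (ltW c'0) (lossC i) h).
have [||||z2 [sz2 pz2 z2in]] := connect t0 p0 p1 eps0 (ju_eps4 J) k2 n0 (ju_fa J)
  (ju_d1 J) (ju_d2 J) Hcon q0 q1 Cl'd (szl A kA) (size_takel kE) _ _ _ _.
- exact: pw_drop.
- exact: pw_take.
- by move=> i iM; apply/rich_rev_lastk; apply: rich'; have [] := AC iM.
- by move=> i iM; apply/rich_take; apply: rich'; have [] := EC _ (inC i iM).
have inz2 x : x \in z2 -> x \notin z1 /\ exists2 i, (i < M)%N & x \in Cl i.
  move=> xz; have iM : (index x z2 < M)%N by rewrite -sz2 index_mem.
  have := z2in _ iM; rewrite nth_index // in_setD in_mset => /andP[-> h]; split => //.
  by exists (index x z2).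
have uz1 : uniq z1.
  by apply: (uniq_parts (t0 := t0) (S := Cl)) => [i j|i]; rewrite sz1; [apply: Cdis|apply: z1in].
have uz2 : uniq z2.
  by apply: (uniq_parts (t0 := t0) (S := Cl')) => [i j|i]; rewrite sz2; [apply: Cl'd|apply: z2in].
(* All that is still uncovered lies in [D], since [E] covers [U]; it can be absorbed at once. *)
pose W := D :\: (mset E :|: mset z1 :|: mset z2).
have [A' [uA' pA' eA' tA' lA']] := abs W (subsetDl _ _).
have kA' := size_takek kA tA'.
have EA' x : x \in E -> x \notin A'.
  move=> xE; rewrite eA' inE /= (negbTE (EA x xE)) /= in_setD !in_setU in_mset xE //.
have zA x i : (i < M)%N -> x \in Cl i -> x \notin A.
  by move=> iM xC; apply/negP => /AD; apply; apply: (subsetP (Csub iM)).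
have z1A x : x \in z1 -> x \notin A'.
  move=> xz; have [i iM xC] := inz1 x xz.
  by rewrite eA' inE /= (negbTE (zA x i iM xC)) /= in_setD !in_setU !in_mset xz orbT.
have z2A x : x \in z2 -> x \notin A'.
  move=> xz; have [_ [i iM xC]] := inz2 x xz.
  by rewrite eA' inE /= (negbTE (zA x i iM xC)) /= in_setD !in_setU !in_mset xz orbT.
have Ez1 x : x \in z1 -> x \notin E.
  by move/inz1 => [i iM xC]; apply: contraL xC; apply: ECl.
have Ez2 x : x \in z2 -> x \notin E.
  by move/inz2 => [_ [i iM xC]]; apply: contraL xC; apply: ECl.
pose cyc := E ++ z1 ++ A' ++ z2.
have ucyc : uniq cyc.
  rewrite !cat_uniq uE uz1 uA' uz2 /= andbT; apply/and3P; split.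
  - apply/hasPn => x; rewrite !mem_cat => /or3P[/Ez1 //|xA|/Ez2 //].
    by apply: contraL xA; apply: EA'.
  - apply/hasPn => x; rewrite !mem_cat => /orP[xA|/inz2[] //].
    by apply: contraL xA; apply: z1A.
  - by apply/hasPn => x /z2A.
exists cyc; split => //.
- rewrite -(card_uniqP ucyc); apply: eq_card => x; rewrite [RHS]inE !mem_cat eA' inE /= in_setD !in_setU !in_mset.
  case xE: (x \in E) => //=; case xz1: (x \in z1) => //=; case xz2: (x \in z2) => //=; rewrite ?orbT ?orbF //.
  case xA: (x \in A) => //=; apply: contraFT xE => xD; apply: UE.
  by rewrite in_setC in_setU in_mset xA.
- have -> : cyc ++ take k cyc = (E ++ z1 ++ A') ++ z2 ++ take k E.
    by rewrite /cyc takel_cat // -!catA.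
  have kM := mlen_ge J.
  apply: pw_join; rewrite ?sz2 ?size_takel //.
  + by rewrite size_cat (leq_trans kE) // leq_addr.
  + by apply: pw_join; rewrite ?sz1 ?tA'.
  + exact: pw_take.
  + by rewrite (catA E) lastk_cat // lA' take_takel.
by rewrite /cyc EE -!catA take_size_cat.
Qed.

End Close.
End Finish.

(** * Putting the pieces together *)

Section Core.
Variables (R : realFieldType) (T : finType) (G : sgraph T) (eps p : R).
Variables (k : nat) (t0 : T).
Hypothesis J : jumbled G eps p k.
Local Notation n := (#|T|%:R : R).
Local Notation rich := (rich G p k).
Local Notation M := (mlen k).
Local Notation ins := (ins_size k).

Let p0 := ju_p0 J. Let p1 := ju_p1 J. Let eps0 := ju_eps0 J. Let n0 := ju_n0 J.
Let k2 := ju_k2 J.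

Definition small_blocks := (2 * M + 2)%N.
(** Every reservoir vertex costs itself and at most [abs_size k] vertices of the absorbing path; [m]
    vertices are left over by the long path. *)
Definition used s m := (small_blocks * s * (abs_size k).+1 + m)%N.

Variables (c g lam : R) (m s b : nat).
Hypotheses (c0 : 0 < c) (c1 : c <= 1).
Hypothesis Hc : (big_const k (M + M))%:R * eps <= (c / 2) ^+ 2.
Hypothesis HK : (4 ^ k * (8 * (12 + 6 * ins)))%N%:R * eps <= c.
Hypotheses (g0 : 0 < g) (gk : g * (2 * k.+1)%N%:R <= 1) (lam0 : 0 < lam).
Hypothesis fag : few_atypical G eps p g k.-1.
Hypothesis elam : 20 * eps <= lam * g.
Hypothesis flam : (k + k * (M + M))%N%:R * eps * 2 <= lam * g.
Hypothesis ec : (20 * 2 ^ k)%N%:R * eps <= c / 2.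
Hypothesis hm : lam * n <= m%:R.
Hypothesis hs : 2 * c * n + (2 * m * ins)%N%:R <= s%:R.
Hypothesis hb : 3 * c * n + (small_blocks * s * abs_size k)%N%:R <= b%:R.
Hypothesis hn : (small_blocks * s + (M + 12) * b <= #|T|)%N.
Hypothesis hd : forall v, 2 * c * (p * n) <= #|nb G v|%:R.
Hypothesis hH : c * n + (used s m + k)%N%:R <= n.

Let e := eps * p ^+ k * n.
Let e4 : 1 <= 4 * e. Proof. exact: (ju_h J). Qed.
Let k0 : (0 < k)%N. Proof. exact: ltn_trans k2. Qed.
Let e0 : 0 < e. Proof. by rewrite /e !mulr_gt0 // exprn_gt0. Qed.
Let en : e <= eps * n.
Proof. by rewrite /e ler_wpM2r // ler_piMr ?(ltW eps0) // exprn_ile1 // ltW. Qed.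
Let epn : e <= eps * (p * n).
Proof.
rewrite /e -mulrA ler_wpM2l ?(ltW eps0) // ler_wpM2r // -[leRHS]expr1.
by rewrite ler_wiXn2l // ltW.
Qed.
Let cn : 0 < c * n. Proof. by rewrite mulr_gt0. Qed.
Let cpn : 0 < c * (p * n). Proof. by rewrite !mulr_gt0. Qed.
Let pn0 : 0 < p * n. Proof. by rewrite mulr_gt0. Qed.

Let HK' a x : (a <= 8 * (12 + 6 * ins))%N -> 0 <= x -> a%:R * (eps * x) <= c * x.
Proof.
move=> ha x0; rewrite mulrA ler_wpM2r //; apply: le_trans HK.
rewrite ler_wpM2r ?(ltW eps0) // ler_nat; apply: (leq_trans ha).
by rewrite leq_pmull // expn_gt0.
Qed.

Let HKn a : (a <= 8 * (12 + 6 * ins))%N -> a%:R * e <= c * n.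
Proof.
move=> ha; apply: le_trans (HK' ha (ltW n0)); exact: ler_wpM2l.
Qed.

Let HKpn a : (a <= 8 * (12 + 6 * ins))%N -> a%:R * e <= c * (p * n).
Proof.
move=> ha; apply: le_trans (HK' ha (ltW pn0)); exact: ler_wpM2l.
Qed.

Lemma core_count : exists u N : nat, [/\ (N <= u <= #|T|)%N,
  n - N%:R <= c * n + (used s m)%:R &
  ((1 - g) ^+ k.+1 * p ^+ k) ^+ N * (u ^_ N)%:R <= #|ham_power_copies G k|%:R].
Proof.
(* The small blocks [Rq], [Cq], [R0], [R1] form the reservoir [W]; leftovers are inserted through
   [Rq], [R0], [R1] and the cycle is closed through [Cq]. The absorbing path is built in [S] and [Z]. *)
pose sz i := if (i < small_blocks)%N then s else b.
have [|blk [cblk dblk]] := @blocks T sz (small_blocks + (M + 12)).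
  rewrite big_split_ord /=; apply: leq_trans hn; apply: eq_leq; congr (_ + _)%N.
    under eq_bigr => i _ do rewrite /sz ltn_ord.
    by rewrite sum_nat_const card_ord.
  under eq_bigr => i _ do rewrite /sz ltnNge leq_addr /=.
  by rewrite sum_nat_const card_ord.
pose Rq q := blk q. pose Cq q := blk (M + q)%N. pose R0 := blk (2 * M)%N. pose R1 := blk (2 * M).+1.
pose S q := blk (small_blocks + q)%N. pose Z i := blk (small_blocks + M + i)%N.
pose W := [set x | has (fun i => x \in blk i) (iota 0 small_blocks)].
have sb i : (i < small_blocks)%N -> #|blk i| = s /\ blk i \subset W.
  move=> ib; split; first by rewrite cblk /sz ?ib //; apply: ltn_addr.
  by apply/subsetP => x xi; rewrite in_set; apply/hasP; exists i; rewrite ?mem_iota.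
have cW : (#|W| <= small_blocks * s)%N.
  rewrite -(ler_nat R) natrM.
  have := @card_has R T [seq blk i | i <- iota 0 small_blocks] id s%:R.
  rewrite size_map size_iota => h; apply: le_trans (h _).
    rewrite ler_nat; apply: subset_leq_card; apply/subsetP => x; rewrite !in_set => /hasP[i ii xi].
    by rewrite has_map; apply/hasP; exists i.
  by move=> X /mapP[i]; rewrite mem_iota add0n => /andP[_ ib] ->; rewrite (sb i ib).1.
have qs q : (q < M)%N -> [/\ q < small_blocks, M + q < small_blocks,
    small_blocks + q < small_blocks + (M + 12) & small_blocks <= small_blocks + q]%N.
  by rewrite /small_blocks; clear => qM; split; lia.
have zs i : (i < 12)%N -> (small_blocks + M + i < small_blocks + (M + 12))%N.
  by clear; lia.
have r01 : (2 * M < small_blocks)%N /\ ((2 * M).+1 < small_blocks)%N.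
  by rewrite /small_blocks; clear; split; lia.
have dW i : (small_blocks <= i < small_blocks + (M + 12))%N -> [disjoint W & blk i].
  move=> /andP[bi ir]; rewrite disjoints_subset; apply/subsetP => x; rewrite in_set in_setC.
  move=> /hasP[j]; rewrite mem_iota add0n => /andP[_ jb] xj; apply/negP => xi.
  apply: disjoint_mem (dblk j i _ ir _) xj xi; first by apply: ltn_addr.
  by rewrite neq_ltn (leq_trans jb bi).
have Sdis i j : (i < M)%N -> (j < M)%N -> i != j -> [disjoint S i & S j].
  by move=> /qs[_ _ ri _] /qs[_ _ rj _] ij; apply: dblk; rewrite ?eqn_add2l.
have Zdis i j : (i < 12)%N -> (j < 12)%N -> i != j -> [disjoint Z i & Z j].
  by move=> /zs ri /zs rj ij; apply: dblk; rewrite ?eqn_add2l.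
have ZS i q : (i < 12)%N -> (q < M)%N -> [disjoint Z i & S q].
  move=> i12 qM; have [_ _ rq _] := qs q qM; apply: dblk; rewrite ?zs //.
  by rewrite -addnA eqn_add2l; move: qM; clear; lia.
have WZ i : (i < 12)%N -> [disjoint W & Z i].
  by move=> i12; apply: dW; rewrite zs // -addnA leq_addr.
have WS q : (q < M)%N -> [disjoint W & S q].
  by move=> /qs[_ _ h1 h2]; apply: dW; rewrite h1 h2.
have cS q : (q < M)%N -> #|S q| = b.
  by move=> /qs[_ _ h1 h2]; rewrite cblk // /sz ltnNge h2.
have cZ i : (i < 12)%N -> #|Z i| = b.
  by move=> i12; rewrite cblk ?zs // /sz ltnNge -addnA leq_addr.
pose clo := [seq Cq q | q <- iota 0 M].
have sclo : size clo = M by rewrite size_map size_iota.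
have cn2 : 2 * c * n <= s%:R.
  by apply: le_trans hs; rewrite lerDl ler0n.
have Cfc X : X \in clo -> c * n <= #|X|%:R.
  move=> /mapP[q]; rewrite mem_iota add0n => /andP[_ /qs[_ q2 _ _]] ->.
  by rewrite (sb _ q2).1; move: cn2 cn; lra.
have HcA : (big_const k (M + size clo))%:R * eps <= c ^+ 2.
  rewrite sclo; apply: (le_trans Hc); rewrite lerXn2r ?nnegrE //; try by move: c0; lra.
(* These vertices go into the absorbing path at the outset, so that every vertex of [U] has many
   neighbours in [R1]. *)
pose B := atyp G p R1.
have cR1 : #|R1| = s by rewrite (sb _ r01.2).1.
have h20 : 20 * e <= c * n by apply: (HKn (a := 20)); move: (12 + 6 * ins)%N (leq_addr (6 * ins) 12); clear; lia.
have atyp_e (X : {set T}) : c * n <= #|X|%:R -> #|atyp G p X|%:R <= e.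
  move=> hX; rewrite /e -{1}(prednK k0); apply: (atyp_le (ju_fa J)); apply: le_trans hX.
  have h : 20%:R * eps <= c.
    have := HK' (a := 20) (x := 1) _ ler01; rewrite !mulr1; apply.
    by move: (12 + 6 * ins)%N (leq_addr (6 * ins) 12); clear; lia.
  have : eps * p ^+ k.-1 * n <= eps * n.
    by rewrite ler_wpM2r // ler_piMr ?(ltW eps0) // exprn_ile1 // ltW.
  by have := ler_wpM2r (ltW n0) h; lra.
have cB : #|B|%:R <= e by apply: atyp_e; rewrite cR1; move: cn2 cn; lra.
pose L := (#|B|.+1 * ins)%N.
have LE : L%:R <= (5 * ins)%N%:R * e.
  have h : #|B|%:R + 1 <= 5 * e by move: cB e4; lra.
  by have := ler_wpM2r (ler0n R ins) h; rewrite /L 2!natrM -natr1; lra.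
have Lcn : L%:R <= c * n.
  by apply: (le_trans LE); apply: HKn; clear; lia.
have Lcpn : L%:R <= c * (p * n).
  by apply: (le_trans LE); apply: HKpn; clear; lia.
have Wab : (#|W| * abs_size k <= small_blocks * s * abs_size k)%N by rewrite leq_mul2r cW orbT.
have WabR : (#|W| * abs_size k)%N%:R <= (small_blocks * s * abs_size k)%N%:R :> R by rewrite ler_nat.
have bc : 3 * c * n <= b%:R by apply: le_trans hb; rewrite lerDl ler0n.
have [||A0 [HA0 BA0 sA0]] := @insert_all R T G eps p k t0 J c S clo c0 c1 HcA Sdis Cfc B.
- by move=> q qM; rewrite cS //; move: bc Lcn cn; rewrite /L; lra.
- by move=> v; have := hd v; move: Lcpn cpn; rewrite /L; lra.
have Sc q : (q < M)%N -> c * n + (L + #|W| * abs_size k)%N%:R <= #|S q|%:R.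
  by move=> qM; rewrite cS // natrD; move: hb WabR Lcn cn; lra.
have Zc i : (i < 12)%N -> 2 * c * n + (L + #|W| * abs_size k)%N%:R <= #|Z i|%:R.
  by move=> qM; rewrite cZ // natrD; move: hb WabR Lcn cn; lra.
have [|A [D [HI cWD]]] := absorb_all t0 J c0 c1 HcA Sdis Cfc Zdis ZS WZ WS Sc Zc HA0 sA0.
  move=> i A D i12 HI; apply: atyp_e; have := Z_left Zc HI i12.
  by move: cn; lra.
have [HAo DW A0A AW sA] := HI; have [abA _ CA] := HAo.
have BA : B \subset mset A by apply: subset_trans A0A.
(* In units of [e], at most [12] account for reservoir vertices without absorber and [5 * ins] for
   those on [A0]; the [5] is [1 + 4], from [#|B| + 1 <= 5 * e]. *)
pose Dl := (12 + 5 * ins)%N.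
have cWD' : #|W :\: D|%:R <= Dl%:R * e.
  have h1 : #|W :\: D|%:R <= #|W :\: D :\: mset A|%:R + L%:R :> R.
    rewrite -natrD ler_nat -(cardsID (mset A) (W :\: D)) addnC leq_add2l.
    apply: leq_trans sA0; apply: leq_trans (card_mset A0); apply: subset_leq_card.
    apply: subset_trans AW; rewrite setIC; apply: setIS; exact: subsetDl.
  apply: (le_trans h1); rewrite [Dl%:R]natrD mulrDl; apply: lerD LE.
  exact: cWD.
have lossX (X : {set T}) : X \subset W -> #|X|%:R - Dl%:R * e <= #|X :&: D|%:R.
  move=> XW; have := card_rem R X (W :\: D); have -> : X :\: (W :\: D) = X :&: D.
    apply/setP => x; rewrite in_setI !in_setD negb_and negbK.
    by case xX: (x \in X); rewrite ?andbF //= (subsetP XW) // orbF andbT.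
  by move: cWD'; lra.
have Dln : Dl%:R * e * 2 <= c * n.
  have -> : Dl%:R * e * 2 = (2 * Dl)%N%:R * e by rewrite natrM; ring.
  by apply: HKn; rewrite /Dl; clear; lia.
pose Rf q := Rq q :&: D. pose Cl q := Cq q :&: D. pose R0' := R0 :&: D. pose R1' := R1 :&: D.
pose clo' := [seq Cl q | q <- iota 0 M].
pose fam := [seq Rf q | q <- iota 0 M] ++ clo'.
pose U := ~: (mset A :|: D).
have c20 : 0 < c / 2 by move: c0; lra.
have c21 : c / 2 <= 1 by move: c0 c1; lra.
have sizeD i : (i < small_blocks)%N -> c / 2 * n + (2 * m * ins)%N%:R <= #|blk i :&: D|%:R.
  move=> ib; have [si sW] := sb i ib; have := lossX _ sW; rewrite si.
  by move: hs Dln cn; lra.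
have sizeD2 i : (i < small_blocks)%N -> c / 2 * n <= #|blk i :&: D|%:R.
  by move=> /sizeD; apply: le_trans; rewrite lerDl ler0n.
have famc X : X \in fam -> c / 2 * n <= #|X|%:R.
  rewrite mem_cat => /orP[]/mapP[q]; rewrite mem_iota add0n => /andP[_ /qs[q1 q2 _ _]] ->;
  exact: sizeD2.
have sfam : size fam = (M + M)%N by rewrite size_cat !size_map !size_iota.
have flam' : (k + k * size fam)%N%:R * eps * 2 <= lam * g by rewrite sfam.
have AC q : (q < M)%N -> rich (c / 2 / 4 ^+ k) A (Cl q) /\ rich (c / 2 / 4 ^+ k) (rev A) (Cl q).
  move=> qM; have [_ q2 _ _] := qs q qM; have [_ CW] := sb _ q2.
  have [h1 h2] : rich (c / 4 ^+ k) A (Cq q) /\ rich (c / 4 ^+ k) (rev A) (Cq q).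
    by apply: CA; apply/mapP; exists q; rewrite ?mem_iota.
  have loss : #|Cq q :\: Cl q|%:R <= c / 4 ^+ k / 2 * p ^+ k * n.
    apply: (@le_trans _ _ (Dl%:R * e)).
      apply: le_trans cWD'; rewrite ler_nat; apply: subset_leq_card; apply/subsetP => x.
      rewrite !in_setD in_setI; case xC: (x \in Cq q); rewrite ?andbF //= andbT => ->.
      exact: (subsetP CW).
    have k4 : 0 < 4 ^+ k :> R by rewrite exprn_gt0.
    have -> : Dl%:R * e = Dl%:R * eps * (p ^+ k * n) by rewrite /e; ring.
    rewrite -[leRHS]mulrA ler_wpM2r ?mulr_ge0 ?exprn_ge0 ?(ltW p0) //.
    have -> : c / 4 ^+ k / 2 = c / (2 * 4 ^+ k) by field; rewrite gt_eqF.
    rewrite ler_pdivlMr ?mulr_gt0 //; apply: le_trans HK.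
    have -> : Dl%:R * eps * (2 * 4 ^+ k) = (4 ^ k * (2 * Dl))%N%:R * eps by rewrite !natrM natrX; ring.
    rewrite ler_wpM2r ?(ltW eps0) // ler_nat leq_mul2l; apply/orP; right.
    by rewrite /Dl; clear; lia.
  have -> : c / 2 / 4 ^+ k = c / 4 ^+ k / 2 by rewrite mulrAC.
  have cc : 0 <= c / 4 ^+ k by rewrite divr_ge0 ?exprn_ge0 // ltW.
  by split; apply: (rich_loss J cc loss).
have dI i j : (i < small_blocks)%N -> (j < small_blocks)%N -> i != j -> [disjoint blk i :&: D & blk j :&: D].
  by move=> ib jb ij; apply: disjointW (subsetIl _ _) (subsetIl _ _) (dblk i j _ _ ij); apply: ltn_addr.
have R1c v : v \in U -> c / 2 * (p * n) + ins%:R * (eps * p ^+ k * n) <= #|nb G v :&: R1'|%:R.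
  rewrite in_setC in_setU negb_or => /andP[vA _].
  have vB : v \notin B by apply: contra vA; apply: (subsetP BA).
  have h1 := natypP vB; rewrite cR1 in h1.
  have h2 : #|nb G v :&: R1|%:R <= #|nb G v :&: R1'|%:R + #|W :\: D|%:R :> R.
    rewrite -natrD ler_nat; apply: leq_trans (leq_card_setU _ _); apply: subset_leq_card.
    apply/subsetP => x; rewrite in_setI => /andP[xv xR].
    rewrite in_setU !in_setI in_setD xv xR /= (subsetP (sb _ r01.2).2) // andbT.
    exact: orbN.
  have h3 : (Dl + ins)%N%:R * e * 2 <= c * (p * n).
    have -> : (Dl + ins)%N%:R * e * 2 = (2 * (Dl + ins))%N%:R * e by rewrite natrM; ring.
    by apply: HKpn; rewrite /Dl; clear; lia.
  rewrite natrD in h3; rewrite -/e.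
  have := ler_wpM2l (ltW p0) cn2.
  by move: h1 h2 h3 cWD' cpn; lra.
have cc := @close_cycle R T G eps p k t0 J (c / 2) g A D Rf Cl R0' R1' c20 c21 Hc abA AC _ _ _ _ _ _ _ _ _ _ _ m _ _ _ R1c.
have {}cc q : good_path G p k U fam (c / 2) g q -> (k <= size q)%N -> (#|U :\: mset q| <= m)%N ->
    exists cyc, [/\ uniq cyc, size cyc = #|T|, pw G k (cyc ++ take k cyc) & take (size q) cyc = q].
  apply: cc => //.
  - by move=> i j /qs[ib _ _ _] /qs[jb _ _ _]; apply: dI.
  - by move=> i j /qs[_ ib _ _] /qs[_ jb _ _] ij; apply: dI => //; rewrite eqn_add2l.
  - by move=> q0 _; apply: subsetIr.
  - by move=> q0 _; apply: subsetIr.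
  - exact: subsetIr.
  - exact: subsetIr.
  - move=> i q0 iM q0M; have [_ ib _ _] := qs i iM; have [jb _ _ _] := qs q0 q0M; apply: dI => //.
    by move: q0M; clear; lia.
  - by move=> i iM; have [_ ib _ _] := qs i iM; apply: dI r01.1 _ => //; move: iM; clear; lia.
  - by move=> i iM; have [_ ib _ _] := qs i iM; apply: dI r01.2 _ => //; move: iM; clear; lia.
  - by move=> i iM; have [ib _ _ _] := qs i iM; apply: dI r01.2 ib _; move: iM; clear; lia.
  - by apply: dI r01.2 r01.1 _; clear; lia.
  - by move=> q0 /qs[ib _ _ _]; apply: sizeD.
  - by move=> q0 /qs[_ ib _ _]; apply: sizeD2.
  have := lossX _ (sb _ r01.1).2; rewrite (sb _ r01.1).1.
  have : (m * ins)%N%:R <= (2 * m * ins)%N%:R :> R by rewrite ler_nat -mulnA leq_pmull.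
  by move: hs Dln cn; rewrite /R0' /R0; lra.
have cAD : #|mset A :|: D|%:R + m%:R <= c * n + (used s m)%:R.
  have h1 : (#|mset A :|: D| <= L + small_blocks * s * (abs_size k).+1)%N.
    apply: leq_trans (leq_card_setU _ _) _.
    have h2 : (#|D| <= small_blocks * s)%N by apply: leq_trans cW; apply: subset_leq_card.
    have h3 := leq_trans (card_mset A) sA.
    have h4 := leq_mul h2 (leqnn (abs_size k)).
    by move: h2 h3 h4; rewrite mulnS; clear; lia.
  have : #|mset A :|: D|%:R <= L%:R + (small_blocks * s * (abs_size k).+1)%N%:R :> R by rewrite -natrD ler_nat.
  by rewrite /used natrD; move: Lcn; lra.
have cU : (#|mset A :|: D| + #|U| = #|T|)%N by apply: cardsC.
have mU : (#|mset A :|: D| + m + k <= #|T|)%N.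
  rewrite -(ler_nat R) !natrD; apply: le_trans hH; rewrite natrD; move: cAD; lra.
exists #|U|, (#|U| - m)%N; split.
- by rewrite leq_subr max_card.
- apply: le_trans cAD; rewrite lerBlDr -!natrD ler_nat.
  by move: cU mU; clear; lia.
have mU' : (m + k <= #|U|)%N by move: cU mU; clear; lia.
have NU : (#|U| - m <= #|U|)%N by apply: leq_subr.
have hN : lam * n <= (#|U| - (#|U| - m))%N%:R.
  by rewrite subKn //; apply: leq_trans mU'; apply: leq_addr.
apply: le_trans (count_paths J g0 gk lam0 c20 fag elam flam' ec famc NU hN) _.
rewrite ler_nat; apply: copies_ge.
- by move: mU; clear; lia.
- by apply: leq_trans NU _; apply: max_card.
move=> t /asboolP Hg; have := cc t Hg; rewrite size_tuple; apply; first by move: mU'; clear; lia.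
have [ut tU _ _ _] := Hg; have := card_left ut tU; rewrite /left size_tuple => ->.
by rewrite subKn //; apply: leq_trans mU'; apply: leq_addr.
Qed.

End Core.

(** * Consequences of the hypotheses on the graph *)

Lemma min_degree_le (T : finType) (G : sgraph T) x : (min_degree G <= degree G x)%N.
Proof.
rewrite /min_degree; have : x \in index_enum T by apply: mem_index_enum.
elim: (index_enum T) => [|y s IH] //; rewrite inE big_cons geq_min => /predU1P[->|/IH ->].
  by rewrite leqnn.
by rewrite orbT.
Qed.

Lemma edges_betweenE (T : finType) (G : sgraph T) (X Y : {set T}) : [disjoint X & Y] ->
  edges_between G X Y = (\sum_(y in Y) #|nb G y :&: X|)%N.
Proof.
move=> dXY; pose P := [set z : T * T | [&& z.1 \in Y, z.2 \in X & G z.1 z.2]].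
have -> : edges_between G X Y = #|P|.
  rewrite -(@card_in_imset _ _ (fun z => [set z.2; z.1]) P); last first.
    move=> [y x] [y' x']; rewrite !inE /= => /and3P[yY xX _] /and3P[y'Y x'X _] E.
    have Ex : x = x'.
      have : x \in [set x'; y'] by rewrite -E set21.
      by rewrite !inE => /orP[]/eqP // Ex; case: (disjoint_mem dXY xX); rewrite Ex.
    have : y \in [set x'; y'] by rewrite -E set22.
    rewrite !inE => /orP[]/eqP Ey; last by rewrite Ex Ey.
    by case: (disjoint_mem dXY x'X); rewrite -Ey.
  congr #|pred_of_set _|; apply/setP => E; apply/imset2P/imsetP => [[x y xX]|[[y x]]].
    rewrite inE => /andP[yY xy] ->; exists (y, x); rewrite // inE /= xX yY /=.
    by rewrite (adj_sym G).
  rewrite inE /= => /and3P[yY xX yx] ->; exists x y; rewrite // inE yY /=.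
  by rewrite (adj_sym G).
rewrite -sum1_card; under [RHS]eq_bigr do rewrite -sum1_card.
rewrite [RHS]pair_big_dep /=; apply: eq_bigl => -[y x] /=.
by rewrite !inE /= [G y x && _]andbC.
Qed.

Section Pseudo.
Variables (R : realType) (T : finType) (G : sgraph T) (eps p : R).
Local Notation n := (#|T|%:R : R).

Lemma pseudo_edges a b (X Y : {set T}) : pseudorandom G eps p a b -> [disjoint X & Y] ->
  eps * p ^+ a * n <= #|X|%:R -> eps * p ^+ b * n <= #|Y|%:R ->
  (1 - eps) * p * #|X|%:R * #|Y|%:R < (\sum_(y in Y) #|nb G y :&: X|)%N%:R /\
  (\sum_(y in Y) #|nb G y :&: X|)%N%:R < (1 + eps) * p * #|X|%:R * #|Y|%:R.
Proof.
move=> H d hX hY; have := H X Y d hX hY; rewrite edges_betweenE // ltr_norml.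
by move/andP => [h1 h2]; split; lra.
Qed.

Lemma pseudo_dense a b : pseudorandom G eps p a b ->
  dense G eps p (eps * p ^+ a * n) (eps * p ^+ b * n).
Proof.
move=> H X Y d hX hY; have [h _] := pseudo_edges H d hX hY.
by rewrite -natr_sum; apply: ltW.
Qed.

(* If both thresholds were below one, singletons would show that [G] is complete; if only the
   smaller one is, a set of about [eps p^a n] vertices would send fewer than one edge, but a
   positive number of them, to a vertex outside it. *)
Lemma complete_or_large a : 0 < p -> p <= 1 -> 0 < eps -> eps <= 1 / 4 -> (1 < #|T|)%N ->
  pseudorandom G eps p a a.+1 ->
  (forall x y, x != y -> G x y) \/ 1 <= 4 * (eps * p ^+ a.+1 * n).
Proof.
move=> p0 p1 e0 e4 T1 H; set w := eps * p ^+ a * n.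
have wE : eps * p ^+ a.+1 * n = p * w by rewrite exprS /w; ring.
have w0 : 0 <= w by rewrite /w !mulr_ge0 ?exprn_ge0 ?ler0n // ltW.
have pw0 : p * w <= w by rewrite ler_piMl.
case: (leP 1 (4 * (eps * p ^+ a.+1 * n))) => [h|hs]; [by right|left=> x y xy].
rewrite wE in hs.
have [w1|w1] := leP w 1.
  have d : [disjoint [set x] & [set y]] by rewrite disjoints1 inE.
  have [|| h _] := pseudo_edges H d; rewrite ?cards1 //; first by rewrite wE; lra.
  move: h; rewrite big_set1 !cards1 !mulr1 => h; apply: contraT => nxy.
  have E : nb G y :&: [set x] = set0.
    apply/setP => z; rewrite !inE; case: (eqVneq z x) => [->|]; rewrite ?andbF // andbT.
    by rewrite (adj_sym G) (negbTE nxy).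
  have h3 : 0 < (1 - eps) * p by rewrite mulr_gt0 //; move: e4; lra.
  by move: h h3; rewrite E cards0; lra.
(* Then [w < m <= 2 * w], so that [p * m] is below [1 / 2] and the edge count to one vertex lies
   strictly between [0] and [1]. *)
pose m := (Num.truncn w).+1.
have /andP[m1 m2] := truncn_itv w0.
have mw : m%:R <= 2 * w by rewrite /m -natr1; lra.
have w4 : w <= 1 / 4 * n.
  rewrite /w -mulrA; apply: ler_pM => //; [exact: ltW|by rewrite mulr_ge0 ?exprn_ge0 ?ler0n ?ltW|].
  by rewrite ler_piMl ?ler0n // exprn_ile1 // ltW.
have mT : (m <= #|~: [set y]|)%N.
  have h2 : (m * 2 <= #|T|)%N by rewrite -(ler_nat R) natrM; lra.
  by have := cardsC [set y]; rewrite cards1; move: T1 h2; clear; lia.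
have [X XY cX] := subset_of_card mT.
have d : [disjoint X & [set y]] by rewrite disjoints_subset.
have [||h1 h2] := pseudo_edges H d; rewrite ?cX ?cards1; [exact: ltW|by rewrite wE; lra|].
move: h1 h2; rewrite big_set1 cards1 cX !mulr1.
have pm : 0 < p * m%:R by rewrite mulr_gt0 // ltr0n.
have pm1 : p * m%:R <= 2 * (p * w) by have := ler_wpM2l (ltW p0) mw; lra.
case: (#|nb G y :&: X|) => [|j] h1 h2.
  have h3 : 0 < (1 - eps) * (p * m%:R) by rewrite mulr_gt0 //; move: e4; lra.
  by move: h1 h3; rewrite mulrA; lra.
have : 1 <= j.+1%:R :> R by rewrite ler1n.
have : (1 + eps) * (p * m%:R) <= 5 / 4 * (p * m%:R) by rewrite ler_wpM2r ?(ltW pm) //; lra.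
by move: h2; rewrite mulrA; lra.
Qed.

End Pseudo.

(** For [k > 2] the exponents [k - 1] and [2k - 1] give the densities for connecting, and [k],
    [k + 1] serve the absorbers and the lower bound on [eps p^(k+1) n]. For [k = 2] one has
    [2k - 2 = k], so a single condition yields both the density and the bound. *)
Lemma complete_or_jumbled (R : realType) (T : finType) (G : sgraph T) (eps p g : R) k :
  (2 <= k)%N -> 0 < p -> p <= 1 -> 0 < eps -> eps <= 1 / 4 -> (1 < #|T|)%N ->
  0 < g -> g <= 1 -> eps <= g / 2 ->
  (k = 2%N -> pseudorandom G eps p 1 2) ->
  ((2 < k)%N -> pseudorandom G eps p (k - 1) (2 * k - 1) /\ pseudorandom G eps p k (k + 1)) ->
  (forall x y, x != y -> G x y) \/ (jumbled G eps p k /\ few_atypical G eps p g k.-1).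
Proof.
move=> k2 p0 p1 e0 e4 T1 g0 g1 eg H2 H3.
set n := (#|T|%:R : R).
have n0 : 0 < n by rewrite ltr0n ltnW.
have pl a b : (a <= b)%N -> eps * p ^+ b * n <= eps * p ^+ a * n.
  by move=> ab; rewrite ler_wpM2r ?(ltW n0) // ler_wpM2l ?(ltW e0) // ler_wiXn2l // ltW.
have half0 : 0 < 1 / 2 :> R by lra.
have half1 : 1 / 2 <= 1 :> R by lra.
have ehalf : eps <= 1 / 2 / 2 by lra.
have kk : k.-1.+1 = k by rewrite prednK // ltnW.
have finish : dense G eps p (eps * p ^+ k.-1 * n) (eps * p ^+ k * n) ->
    1 <= 4 * (eps * p ^+ k * n) ->
    few_atypical G eps p (1 / 2) k.-1 /\ few_atypical G eps p g k.-1.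
  by move=> d h; split; apply: few_atypicalP => //; rewrite kk.
have [k3|] := ltnP 2 k; last first.
  move=> kle; have kE : k = 2%N by apply/eqP; rewrite eqn_leq kle k2.
  have P := H2 kE; have [C|h] := complete_or_large p0 p1 e0 e4 T1 P; [by left|right].
  have d := pseudo_dense P; rewrite kE in kk finish *; have [f1 f2] := finish d h.
  split=> //; split => //.
  exact: dense_sym d.
have [P Q] := H3 k3; rewrite addn1 in Q.
have [C|h'] := complete_or_large p0 p1 e0 e4 T1 Q; [by left|right].
have h : 1 <= 4 * (eps * p ^+ k * n) by move: h' (pl k k.+1 (leqnSn k)); rewrite -/n; lra.
have d := pseudo_dense P; rewrite subn1 in d.
have [|f1 f2] := finish _ h.
  by apply: dense_mono d => //; apply: pl; move: k2; clear; lia.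
split => //; split => //.
- by apply/dense_sym; apply: dense_mono d => //; apply: pl; clear; lia.
- by move=> _; apply: dense_sym d.
by move=> _; apply: few_atypicalP => //; apply: pseudo_dense Q.
Qed.

(** * Choice of the constants *)

Section Constants.
Variable k : nat.
Local Notation M := (mlen k).
Local Notation ins := (ins_size k).

(** Block sizes are multiples of [m], itself about [lam * n]; the multipliers are read off from the
    hypotheses [hs] and [hb] of [core_count]. *)
Definition small_mul := (2 + 2 * ins)%N.
Definition big_mul := (3 + small_blocks k * small_mul * abs_size k)%N.
Definition used_mul := (small_blocks k * small_mul * (abs_size k).+1 + 1)%N.
Definition scale_const : nat :=
  (2 * (1 + used_mul + k + (small_blocks k * small_mul + (M + 12) * big_mul)))%N.
Definition eps_const : nat :=
  (4 * big_const k (M + M) + 4 ^ k * (8 * (12 + 6 * ins)) + 20 +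
   (k + k * (M + M)) * 2 + 20 * 2 ^ k * 2 + 4)%N.

Lemma scaled_count (R : realType) (T : finType) (G : sgraph T) (eps p g lam : R) :
  jumbled G eps p k -> few_atypical G eps p g k.-1 ->
  0 < g -> g * (2 * k.+1)%N%:R <= 1 -> 0 < lam -> scale_const%:R * lam <= 1 ->
  eps_const%:R * eps <= lam ^+ 2 * g ->
  (forall v, 2 * lam * (p * #|T|%:R) <= #|nb G v|%:R) ->
  exists u N : nat, [/\ (N <= u <= #|T|)%N, #|T|%:R - N%:R <= scale_const%:R * lam * #|T|%:R &
    ((1 - g) ^+ k.+1 * p ^+ k) ^+ N * (u ^_ N)%:R <= #|ham_power_copies G k|%:R].
Proof.
move=> J fag g0 gk lam0 Hs He hd; set n := (#|T|%:R : R).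
have n0 := ju_n0 J; have e0 := ju_eps0 J.
have g1 : g <= 1 by apply: le_trans gk; rewrite ler_peMr ?(ltW g0) // ler1n muln_gt0.
have lam1 : lam <= 1.
  apply: le_trans Hs; rewrite ler_peMl ?(ltW lam0) // ler1n /scale_const; clear; lia.
have Q a : (a <= eps_const)%N -> a%:R * eps <= lam ^+ 2 * g.
  by move=> h; apply: le_trans He; rewrite ler_wpM2r ?(ltW e0) // ler_nat.
have l2 : lam ^+ 2 <= lam by rewrite expr2 ler_piMr // ltW.
have l2g : lam ^+ 2 * g <= lam ^+ 2 by rewrite ler_piMr // exprn_ge0 // ltW.
have lg : lam ^+ 2 * g <= lam * g by rewrite ler_wpM2r // ltW.
have Q1 a : (a <= eps_const)%N -> a%:R * eps <= lam.
  by move=> /Q h; apply: le_trans l2; apply: le_trans l2g.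
(* The bound [ju_h] makes [lam * n] at least [1], so that rounding up at most doubles it. *)
have ln1 : 1 <= lam * n.
  have h4 : 4%:R * eps <= lam by apply: Q1; rewrite /eps_const; clear; lia.
  apply: (le_trans (ju_h J)); rewrite !mulrA ler_wpM2r ?(ltW n0) //; apply: le_trans h4.
  by rewrite ler_piMr ?mulr_ge0 ?(ltW e0) // exprn_ile1 // ?(ltW (ju_p0 J)) // (ju_p1 J).
pose m := (Num.truncn (lam * n)).+1.
have /andP[m1 m2] := truncn_itv (ltW (mulr_gt0 lam0 n0)).
have lm : lam * n <= m%:R by apply: ltW.
have mw : m%:R <= 2 * (lam * n) by rewrite /m -natr1; lra.
have scale a : (2 * a <= scale_const)%N -> (a * m)%N%:R <= n.
  move=> ha; rewrite natrM; have h1 := ler_wpM2l (ler0n R a) mw.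
  have h2 : (2 * a)%N%:R * (lam * n) <= scale_const%:R * (lam * n).
    by rewrite ler_wpM2r ?ler_nat // mulr_ge0 // ltW.
  have h3 : scale_const%:R * lam * n <= 1 * n by rewrite ler_wpM2r // ltW.
  by move: h2 h1; rewrite natrM; lra.
have /card_gt0P[t0 _] : (0 < #|T|)%N by rewrite -(ltr0n R).
have Hc : (big_const k (M + M))%:R * eps <= (lam / 2) ^+ 2.
  have h := Q (4 * big_const k (M + M))%N; rewrite natrM in h.
  have h' : 4%:R * (big_const k (M + M))%:R * eps <= lam ^+ 2.
    by apply: le_trans l2g; apply: h; rewrite /eps_const; clear; lia.
  have -> : (lam / 2) ^+ 2 = lam ^+ 2 / 4 by rewrite expr_div_n; congr (_ / _); ring.
  by move: h'; lra.
have HK : (4 ^ k * (8 * (12 + 6 * ins)))%N%:R * eps <= lam.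
  by apply: Q1; rewrite /eps_const; clear; lia.
have elam : 20 * eps <= lam * g.
  by apply: le_trans lg; apply: Q; rewrite /eps_const; clear; lia.
have flam : (k + k * (M + M))%N%:R * eps * 2 <= lam * g.
  apply: le_trans lg; rewrite mulrAC -natrM; apply: Q; rewrite /eps_const; clear; lia.
have ec : (20 * 2 ^ k)%N%:R * eps <= lam / 2.
  have : (20 * 2 ^ k)%N%:R * 2%:R * eps <= lam.
    by have := Q1 (20 * 2 ^ k * 2)%N; rewrite natrM; apply; rewrite /eps_const; clear; lia.
  by lra.
have hs : 2 * lam * n + (2 * m * ins)%N%:R <= (small_mul * m)%N%:R.
  rewrite /small_mul mulnDl [(2 * ins * m)%N]mulnAC natrD lerD2r natrM -mulrA.
  exact: ler_wpM2l.
have hb : 3 * lam * n + (small_blocks k * (small_mul * m) * abs_size k)%N%:R <= (big_mul * m)%N%:R.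
  rewrite /big_mul mulnDl natrD [(3 * m)%N%:R]natrM; apply: lerD.
    by rewrite -mulrA ler_wpM2l.
  by rewrite ler_nat; apply: eq_leq; rewrite mulnA mulnAC.
have hn : (small_blocks k * (small_mul * m) + (M + 12) * (big_mul * m) <= #|T|)%N.
  rewrite !mulnA -mulnDl -(ler_nat R); apply: scale.
  by rewrite /scale_const; clear; lia.
have uE : used k (small_mul * m) m = (used_mul * m)%N.
  by rewrite /used /used_mul mulnDl mul1n mulnA; congr (_ + _)%N; rewrite mulnAC.
have hH : lam * n + (used k (small_mul * m) m + k)%N%:R <= n.
  apply: (@le_trans _ _ ((1 + used_mul + k) * m)%N%:R).
    have -> : ((1 + used_mul + k) * m = m + (used_mul * m + k * m))%N.
      by rewrite 2!mulnDl mul1n addnA.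
    rewrite uE [leRHS]natrD; apply: lerD => //.
    by rewrite ler_nat leq_add2l leq_pmulr.
  by apply: scale; rewrite /scale_const; clear; lia.
have [u [N [h1 h2 h3]]] := core_count t0 J lam0 lam1 Hc HK g0 gk lam0 fag elam flam ec lm hs hb hn hd hH.
exists u, N; split => //; apply: (le_trans h2); rewrite uE.
apply: (@le_trans _ _ ((1 + used_mul) * m)%N%:R).
  by rewrite mulnDl mul1n natrD lerD2r.
rewrite natrM -mulrA; apply: le_trans (ler_wpM2l (ler0n R _) mw) _.
rewrite [leLHS]mulrA; apply: ler_wpM2r; first by rewrite mulr_ge0 // ltW.
by rewrite -natrM ler_nat /scale_const; clear; lia.
Qed.

End Constants.

Lemma ffact_leX a b m : (a <= b)%N -> (a ^_ m <= b ^ m)%N.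
Proof.
move=> ab; rewrite ffact_prod -[m in (b ^ m)%N]card_ord -prod_nat_const.
by apply: leq_prod => i _; apply: leq_trans ab; apply: leq_subr.
Qed.

(** The factors of [n!] missing from [u ^_ N] are [n - u] leading and [u - N] trailing ones, each at
    most [n]. *)
Lemma fact_le_ffact n u N : (N <= u <= n)%N -> (n`! <= n ^ (n - N) * u ^_ N)%N.
Proof.
case/andP=> Nu un; rewrite -(ffact_fact (leq_subr u n)) subKn // -(ffact_fact Nu).
rewrite mulnCA mulnC leq_mul2r; apply/orP; right.
have -> : (n - N = (n - u) + (u - N))%N by move: Nu un; clear; lia.
by rewrite expnD leq_mul ?ffact_leX // -ffactnn ffact_leX // (leq_trans (leq_subr _ _)).
Qed.

Lemma ln_ge_half (R : realType) n : (3 <= n)%N -> 1 / 2 <= ln (n%:R : R).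
Proof.
move=> n3; have n0 : 0 < n%:R :> R by rewrite ltr0n; apply: leq_trans n3.
rewrite -ler_expR lnK ?posrE //; have := expR_ge1Dx (- (1 / 2) : R).
rewrite expRN => h; apply: (@le_trans _ _ 3%:R); last by rewrite ler_nat.
have e0 := expR_gt0 (1 / 2 : R).
have h2 : 1 / 2 * expR (1 / 2) <= (expR (1 / 2 : R))^-1 * expR (1 / 2).
  by rewrite ler_wpM2r ?(ltW e0) //; apply: le_trans h; lra.
by rewrite mulVf ?gt_eqF // in h2; lra.
Qed.

Lemma power_loss (R : realType) n j (nu : R) : (0 < n)%N -> 0 <= nu -> nu <= 1 ->
  j%:R * ln (n%:R : R) <= nu / 2 * n%:R -> n%:R ^+ j * (1 - nu / 2) ^+ n <= 1.
Proof.
move=> n0 nu0 nu1 H; have nR : 0 < n%:R :> R by rewrite ltr0n.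
have -> : (n%:R : R) ^+ j = expR (j%:R * ln n%:R) by rewrite expRM_natl lnK ?posrE.
have h : (1 - nu / 2) ^+ n <= expR (n%:R * - (nu / 2)).
  rewrite expRM_natl lerXn2r ?nnegrE ?expR_ge0 //; first by lra.
  exact: expR_ge1Dx.
apply: (@le_trans _ _ (expR (j%:R * ln n%:R) * expR (n%:R * - (nu / 2)))).
  by rewrite ler_wpM2l ?expR_ge0.
rewrite -expRD -[leRHS]expR0 ler_expR; move: H; lra.
Qed.

Theorem theorem5 (R : realType) (k : nat) (beta nu : R) :
  (2 <= k)%N -> 0 < beta -> 0 < nu -> nu < 1 ->
  exists c : R, 0 < c /\
    forall (n : nat) (eps p : R),
      (3 <= n)%N ->
      0 < eps -> eps <= c / (ln n%:R) ^+ 2 ->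
      0 < p -> p < 1 ->
      forall (T : finType) (G : sgraph T),
        #|T| = n ->
        beta * p * n%:R <= (min_degree G)%:R ->
        (k = 2%N -> pseudorandom G eps p 1 2) ->
        ((2 < k)%N -> pseudorandom G eps p (k - 1) (2 * k - 1) /\
                      pseudorandom G eps p k (k + 1)) ->
        (1 - nu) ^+ n * p ^+ (k * n) * n`!%:R <= #|ham_power_copies G k|%:R.
Proof.
move=> k2 beta0 nu0 nu1.
(* By Bernoulli's inequality [(1 - g) ^+ k.+1] is at least [1 - nu / 2]. *)
pose g := nu / (2 * k.+1)%N%:R.
pose K := (scale_const k)%:R : R.
pose Q := (eps_const k)%:R : R.
(* The first bound makes the minimum degree at least [2 * lam * p * n]; the second keeps [K * sig]
   at most [nu / 4], the exponent per vertex lost by ignoring the order of the remaining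
   vertices. *)
pose sig := Num.min (beta / 4) (nu / (4 * K)).
have kR : 0 < (2 * k.+1)%N%:R :> R by rewrite ltr0n muln_gt0.
have K1 : 1 <= K by rewrite ler1n /scale_const; clear; lia.
have K0 : 0 < K by apply: lt_le_trans K1.
have Q4 : 4 <= Q by rewrite ler_nat /eps_const; clear; lia.
have Q0 : 0 < Q by apply: lt_le_trans Q4.
have g0 : 0 < g by rewrite divr_gt0.
have gk : g * (2 * k.+1)%N%:R <= 1 by rewrite /g divfK ?gt_eqF // ltW.
have g1 : g <= 1 by apply: le_trans gk; rewrite ler_peMr ?(ltW g0) // ler1n muln_gt0.
have sig0 : 0 < sig by rewrite lt_min !divr_gt0 // mulr_gt0.
have sigb : 4 * sig <= beta.
  have h : sig <= beta / 4 by rewrite ge_min lexx.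
  by move: h; lra.
have sign : 4 * (K * sig) <= nu.
  have : sig <= nu / (4 * K) by rewrite ge_min lexx orbT.
  by rewrite ler_pdivlMr ?mulr_gt0 //; lra.
exists (sig ^+ 2 * g / Q); split; first by rewrite !divr_gt0 // mulr_gt0 // exprn_gt0.
move=> n eps p n3 e0 He p0 p1 T G Tn Hd H2 H3.
set ell := ln n%:R in He; have ellh : 1 / 2 <= ell by apply: ln_ge_half.
have ell0 : 0 < ell by lra.
(* With this choice [n ^ (K * lam * n)] equals [exp (K * sig * n)], and the hypothesis on [eps]
   becomes [Q * eps <= lam ^+ 2 * g]. *)
pose lam := sig / ell.
have lam0 : 0 < lam by rewrite divr_gt0.
have lamE : lam * ell = sig by rewrite divfK ?gt_eqF.
have lam2 : lam <= 2 * sig.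
  by have := ler_wpM2l (ltW lam0) ellh; rewrite lamE; lra.
have Klam : K * lam <= 1 by have := ler_wpM2l (ltW K0) lam2; lra.
have lam1 : lam <= 1 by have := ler_wpM2r (ltW lam0) K1; lra.
have Qe : Q * eps <= lam ^+ 2 * g.
  have -> : lam ^+ 2 * g = Q * (sig ^+ 2 * g / Q / ell ^+ 2).
    by rewrite /lam; field; rewrite !gt_eqF.
  by rewrite ler_wpM2l // ltW.
have Qeg : Q * eps <= g.
  by apply: (le_trans Qe); rewrite ler_piMl ?(ltW g0) // exprn_ile1 // ltW.
have e4 : 4 * eps <= g by have := ler_wpM2r (ltW e0) Q4; lra.
have T1 : (1 < #|T|)%N by rewrite Tn; apply: leq_trans n3.
have nR : 0 < n%:R :> R by rewrite ltr0n; apply: leq_trans n3.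
have n1 : 0 <= 1 - nu by lra.
have [||C|[J fag]] := @complete_or_jumbled R T G eps p g k k2 p0 (ltW p1) e0 _ T1 g0 g1 _ H2 H3.
- by lra.
- by lra.
- apply: (@le_trans _ _ n`!%:R); last by rewrite ler_nat -{1}Tn complete_copies.
  by rewrite ler_piMl ?ler0n // mulr_ile1 ?exprn_ge0 ?exprn_ile1 ?(ltW p0) ?(ltW p1) //; lra.
have hd v : 2 * lam * (p * #|T|%:R) <= #|nb G v|%:R.
  apply: (@le_trans _ _ (min_degree G)%:R); last by rewrite ler_nat; apply: min_degree_le.
  apply: le_trans Hd; rewrite Tn -[leRHS]mulrA ler_wpM2r ?mulr_ge0 ?(ltW p0) //.
  by lra.
have [u [N [Nun HN Hc]]] := scaled_count J fag g0 gk lam0 Klam Qe hd.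
rewrite Tn in Nun HN; have /andP[Nu un] := Nun.
have Nn := leq_trans Nu un.
apply: le_trans Hc.
pose a := 1 - nu / 2.
have a0 : 0 <= a by rewrite /a; lra.
have a1 : a <= 1 by rewrite /a; lra.
have ag : a <= (1 - g) ^+ k.+1.
  apply: le_trans (bernoulli_le k.+1 (ltW g0) g1).
  have : (2 * k.+1)%N%:R * g = nu by rewrite mulrC /g divfK ?gt_eqF.
  by rewrite natrM /a; lra.
have loss : n%:R ^+ (n - N) * a ^+ n <= 1.
  apply: power_loss; rewrite ?(ltW nu0) ?(ltW nu1) //; first by apply: leq_trans n3.
  rewrite natrB // -/ell; have := ler_wpM2r (ltW ell0) HN.
  have -> : K * lam * n%:R * ell = K * (lam * ell) * n%:R by ring.
  have := ler_wpM2r (ltW nR) sign; rewrite lamE; have : 0 <= nu * n%:R by rewrite mulr_ge0 // ltW.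
  by lra.
have fct : n`!%:R <= n%:R ^+ (n - N) * (u ^_ N)%:R :> R.
  by rewrite -natrX -natrM ler_nat fact_le_ffact.
have pk0 m : 0 <= p ^+ m by rewrite exprn_ge0 // ltW.
have pkN : p ^+ (k * n) <= p ^+ (k * N).
  by rewrite ler_wiXn2l ?(ltW p0) ?(ltW p1) // leq_mul2l Nn orbT.
(* As [1 - nu <= (1 - nu / 2) ^+ 2], one factor pays for the proportions [1 - g] along the path and
   the other for the power of [n] in [loss]. *)
have nu2 : (1 - nu) ^+ n <= a ^+ n * a ^+ n.
  rewrite -exprMn lerXn2r ?nnegrE ?mulr_ge0 // /a; have : 0 <= nu * nu by rewrite mulr_ge0 // ltW.
  by lra.
apply: (@le_trans _ _ (a ^+ n * a ^+ n * p ^+ (k * n) * (n%:R ^+ (n - N) * (u ^_ N)%:R))).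
  by apply: ler_pM => //; [rewrite mulr_ge0 // exprn_ge0|rewrite ler_wpM2r].
have -> : a ^+ n * a ^+ n * p ^+ (k * n) * (n%:R ^+ (n - N) * (u ^_ N)%:R) =
  n%:R ^+ (n - N) * a ^+ n * (a ^+ n * p ^+ (k * n) * (u ^_ N)%:R) by ring.
apply: (@le_trans _ _ (a ^+ n * p ^+ (k * n) * (u ^_ N)%:R)).
  apply: ler_piMl => //; apply: mulr_ge0 => //; apply: mulr_ge0 => //; exact: exprn_ge0.
rewrite ler_wpM2r ?ler0n // exprMn -(exprM p); apply: ler_pM => //; first exact: exprn_ge0.
apply: (@le_trans _ _ (a ^+ N)); first exact: ler_wiXn2l.
by rewrite lerXn2r ?nnegrE ?exprn_ge0 //; lra.
Qed.
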